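(* Let $\alpha\in(0,1)$ with $\alpha\ne1/n$ for all $n\in\mathbb N$, $N=\lfloor1/\alpha\rfloor$, and $0<\beta<\alpha$. Define the sets of sections $$\Gamma=\{\mathbf X\mapsto\Gamma_{\mathbf X}(f):f\in\mathcal S_N\},\qquad\Gamma_0=\{\mathbf X\mapsto\Gamma_{\mathbf X}(f):f\in\mathcal S^0_N\}.$$ Then: (i) $\Gamma$ is a linear subspace of $\prod_{\mathbf X\in\mathscr C^\alpha}\mathscr D^{\alpha,\beta}_{\mathbf X}$. (ii) For every $\mathbf X\in\mathscr C^\alpha$, $\{\gamma(\mathbf X):\gamma\in\Gamma_0\}$ is a countable dense subset of $\mathscr D^{\alpha,\beta}_{\mathbf X}$. (iii) For every $\gamma\in\Gamma$ with $\gamma(\mathbf X)=\Gamma_{\mathbf X}(f)$, the function $\mathscr C^\alpha\to\mathbb R$, $\mathbf X\mapsto|||\gamma(\mathbf X)|||_\alpha=|||\Gamma_{\mathbf X}(f)|||_\alpha$ is continuous.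
   Context: Forests. $A$ is a fixed finite nonempty set. $\mathcal F$ is the set of forests (commutative monomials of non-planar rooted trees with nodes labelled by $A$), including the empty forest $\mathbf 1$; $\mathcal H$ is the real vector space with basis $\mathcal F$, i.e. the polynomial algebra on trees. $|h|$ is the number of nodes of $h\in\mathcal F$; $\mathcal F_{(n)}=\{h\in\mathcal F:|h|\le n\}$; $\mathcal F^+_{(n)}=\mathcal F_{(n)}\setminus\{\mathbf 1\}$. $[h]_a$ is the tree obtained by grafting the trees of $h$ on a new root labelled $a\in A$. The coproduct $\Delta$ is the algebra morphism with $\Delta[h]_a=(\mathrm{id}\otimes[\cdot]_a)\Delta h+[h]_a\otimes\mathbf 1$. On $\mathcal H^*$, $\langle\phi\star\psi,h\rangle=\langle\phi\otimes\psi,\Delta h\rangle$. A forest $h$ is identified with the functional $h'\mapsto\delta_{h,h'}$, so the span of forests is a subalgebra of $(\mathcal H^*,\star)$. Rough paths. $T>0$ is fixed. An $\alpha$-branched rough path is a family $\mathbf X=(\mathbf X_{s,t})_{s,t\in[0,T]}$ of characters (unital multiplicative linear functionals) of $\mathcal H$ with $\mathbf X_{s,u}\star\mathbf X_{u,t}=\mathbf X_{s,t}$ and $\sup_{s\ne t}|\langle\mathbf X_{s,t},h\rangle|/|t-s|^{\alpha|h|}<\infty$ for all $h\in\mathcal F$. $\mathbf X^h_{s,t}=\langle\mathbf X_{s,t},h\rangle$ (extended linearly in $h$), $\|F\|_\gamma=\sup_{s\neq t}|F_{s,t}|/|t-s|^\gamma$. $\mathscr C^\alpha$ is the set of these with metric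 $\rho_\alpha(\mathbf X,\tilde{\mathbf X})=\max_{h\in\mathcal F^+_{(N)}}\|\mathbf X^h-\tilde{\mathbf X}^h\|_{|h|\alpha}$. Controlled paths. For a path $\mathbf Z:[0,T]\to\mathrm{span}\,\mathcal F_{(N-1)}$ put $R^h_{s,t}=\langle h,\mathbf Z_t\rangle-\langle\mathbf X_{s,t}\star h,\mathbf Z_s\rangle$ and $|||\mathbf Z|||_\gamma=\sum_{h\in\mathcal F_{(N-1)}}(|\langle h,\mathbf Z_0\rangle|+\|R^h\|_{(N-|h|)\gamma})$ for $0<\gamma\le\alpha$. $\mathscr D^\alpha_{\mathbf X}=\{|||\mathbf Z|||_\alpha<\infty\}$; $\mathscr D^{\alpha,\beta}_{\mathbf X}$ is its closure under $|||\cdot|||_\beta$ (inside the paths with $|||\mathbf Z|||_\beta<\infty$), with norm $|||\cdot|||_\beta$. The map $\Gamma_{\mathbf X}$. For forests, $h\top h'$ is $\frac1{|h'|}$ times the sum over nodes $v$ of $h'$ of the forest obtained by grafting all trees of $h$ at $v$ (bilinear extension). $\mathcal P$ is a basis of homogeneous elements of the primitive elements $\{h\in\bigoplus_{n\ge1}\mathcal H_n:\Delta h=h\otimes\mathbf 1+\mathbf 1\otimes h\}$. Then $\mathcal P^\top$, the set of $\top(p_1,\dots,p_k)=(\cdots(p_1\top p_2)\cdots)\top p_k$, $p_i\in\mathcal P$, $k\ge1$, together with $\mathbf 1$, is a basis of $\mathcal H$; $\rho^*$ denotes the dual basis element of $\rho\in\mathcal P^\top$ in the graded dual, i.e. in the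 span of forests. Fix $\varepsilon\in(0,1-N\alpha)$; $C^{0,1-\varepsilon}$ is the closure of $C^\infty([0,T])$ in the $(1-\varepsilon)$-H\''older norm, $\Omega$ a countable dense subset of it; $\mathcal S_N=\bigoplus_{h\in\mathcal F_{(N-1)}}C^{0,1-\varepsilon}$, $\mathcal S^0_N=\bigoplus_{h\in\mathcal F_{(N-1)}}\Omega$. For $f\in\mathcal S_N$, the path $\Gamma_{\mathbf X}(f)\in\mathscr D^\alpha_{\mathbf X}$ has components defined by decreasing recursion on $|h|$: $\Gamma_{\mathbf X}(f)^h_t=f^h_t$ if $|h|=N-1$; if $0\le|h|<N-1$, $\Gamma_{\mathbf X}(f)^h_t=\sum_{p\in\mathcal P,|p|<N-|h|}\int_0^t\Gamma_{\mathbf X}(f)^{p^*\star h}_r\,d\mathbf X^p_r+f^h_t$, where the integral is $\lim_{|\pi|\to0}\sum_{[a,b]\in\pi}\sum_{\rho\in\mathcal P^\top,|\rho|<N-|h|-|p|}\Gamma_{\mathbf X}(f)^{\rho^*\star p^*\star h}_a\mathbf X^{\rho\top p}_{a,b}$ over partitions $\pi$ of $[0,t]$ ($\Gamma_{\mathbf X}(f)^g$ is extended linearly in $g$, $\mathbf 1\top p=p$). *)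

(* Defs.v *)
From HB Require Import structures.
From mathcomp Require Import all_boot all_order all_algebra.
From mathcomp Require Import finmap monalg.
From mathcomp Require Import boolp classical_sets functions cardinality fsbigop.
From mathcomp Require Import reals constructive_ereal ereal topology normedtype.
From mathcomp Require Import derive numfun exp.

Set Implicit Arguments.
Unset Strict Implicit.
Unset Printing Implicit Defensive.

Import Order.TTheory GRing.Theory Num.Theory.
Import numFieldNormedType.Exports.

Local Open Scope classical_set_scope.
Local Open Scope ring_scope.

(** Non-planar trees are represented by canonical planar ones: branches are
    sorted at every node, for the order induced by an enumeration of planar
    trees.  See [eq_canon]. *)

Inductive ptree (A : Type) : Type := Node of A & seq (ptree A).

Fixpoint ptree_enc A (t : ptree A) : GenTree.tree A :=
  let: Node a ts := t in
  GenTree.Node 0 (GenTree.Leaf a :: map (@ptree_enc A) ts).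

Fixpoint ptree_dec A (g : GenTree.tree A) : option (ptree A) :=
  match g with
  | GenTree.Node _ (GenTree.Leaf a :: gs) =>
      Some (Node a (pmap (@ptree_dec A) gs))
  | _ => None
  end.

Fixpoint all_prop A (Q : A -> Prop) (s : seq A) : Prop :=
  if s is x :: s' then Q x /\ all_prop Q s' else True.

Definition ptree_rect' A (Q : ptree A -> Prop)
    (IH : forall a ts, all_prop Q ts -> Q (Node a ts)) : forall t, Q t :=
  fix F t := let: Node a ts := t in
    IH a ts ((fix G ts : all_prop Q ts :=
      if ts is t :: ts' then conj (F t) (G ts') else I) ts).

Lemma ptree_encK A : pcancel (@ptree_enc A) (@ptree_dec A).
Proof.
elim/ptree_rect' => a ts IH /=; congr (Some (Node a _)).
by elim: ts IH => //= t ts IHts [-> /IHts ->].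
Qed.

HB.instance Definition _ (A : countType) :=
  Countable.copy (ptree A) (pcan_type (@ptree_encK A)).

Section Forest.
Variable A : finType.
Implicit Types (t u : ptree A) (s : seq (ptree A)).

Definition ptree_le t u := (choice.pickle t <= choice.pickle u)%N.

Lemma ptree_le_total : total ptree_le.
Proof. by move=> t u; apply: leq_total. Qed.

Lemma ptree_le_trans : transitive ptree_le.
Proof. by move=> t u v; apply: leq_trans. Qed.

Lemma ptree_le_anti : antisymmetric ptree_le.
Proof.
by move=> t u le_tu; apply: (pcan_inj choice.pickleK); apply: anti_leq.
Qed.

Let sortP := perm_sortP ptree_le_total ptree_le_trans ptree_le_anti.

Fixpoint canon t : ptree A :=
  let: Node a s := t in Node a (sort ptree_le (map canon s)).

Definition canons s := sort ptree_le (map canon s).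

Lemma canonK t : canon (canon t) = canon t.
Proof.
elim/ptree_rect': t => a s IH /=; congr Node.
have {IH} IH : map canon (map canon s) = map canon s.
  by elim: s IH => //= t s IHs [-> /IHs ->].
apply/sortP; rewrite (perm_trans (perm_map _ (permEl (perm_sort _ _)))) // IH.
by rewrite perm_refl.
Qed.

Lemma canons_id s : map canon (canons s) = canons s.
Proof.
have : {subset canons s <= map canon s} by move=> t; rewrite mem_sort.
elim: (canons s) => //= t s' IH sub; rewrite IH; last first.
  by move=> u us; apply: sub; rewrite inE us orbT.
by have /mapP[u _ ->] := sub t (mem_head _ _); rewrite canonK.
Qed.

Lemma canonsK s : canons (canons s) = canons s.
Proof.
rewrite {1}/canons canons_id; apply/sortP; rewrite perm_sort; exact: perm_refl.
Qed.

Lemma canons_cat s1 s2 : canons (canons s1 ++ s2) = canons (s1 ++ s2).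
Proof.
apply/sortP; rewrite !map_cat canons_id perm_cat2r.
by rewrite perm_sort perm_refl.
Qed.

Lemma canons_perm s1 s2 : perm_eq s1 s2 -> canons s1 = canons s2.
Proof. by move=> s12; apply/sortP/perm_map. Qed.

Lemma eq_canons s1 s2 :
  canons s1 = canons s2 <-> perm_eq (map canon s1) (map canon s2).
Proof. by split=> [/sortP|?] //; apply/sortP. Qed.

Lemma eq_canon a b s1 s2 :
  canon (Node a s1) = canon (Node b s2) <->
  a = b /\ perm_eq (map canon s1) (map canon s2).
Proof. by split=> [[-> /sortP]|[-> /sortP /= ->]]. Qed.

Record forest := Forest { trees : seq (ptree A); _ : canons trees == trees }.

HB.instance Definition _ := [isSub for trees].
HB.instance Definition _ := [Countable of forest by <:].

Definition forest_of s : forest := @Forest (canons s) (introT eqP (canonsK s)).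

Definition fone : forest := forest_of [::].
Definition fmul (h1 h2 : forest) : forest := forest_of (trees h1 ++ trees h2).

Lemma forest_ofK h : forest_of (trees h) = h.
Proof. by apply: val_inj; case: h => s /= /eqP. Qed.

Lemma eq_forest_of s1 s2 : canons s1 = canons s2 -> forest_of s1 = forest_of s2.
Proof. by move=> s12; apply: val_inj. Qed.

Lemma fmulC : commutative fmul.
Proof. by move=> h1 h2; apply/eq_forest_of/canons_perm; rewrite perm_catC. Qed.

Lemma fmul_of s1 s2 : fmul (forest_of s1) (forest_of s2) = forest_of (s1 ++ s2).
Proof.
apply: eq_forest_of; rewrite /= canons_cat (canons_perm (permEl (perm_catC _ _))).
by rewrite canons_cat (canons_perm (permEl (perm_catC _ _))).
Qed.

Lemma fmulA : associative fmul.
Proof.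
move=> h1 h2 h3; rewrite -(forest_ofK h1) -(forest_ofK h2) -(forest_ofK h3).
by rewrite !fmul_of catA.
Qed.

Lemma fmul1 : left_id fone fmul.
Proof. by move=> h; rewrite -{1}(forest_ofK h) fmul_of forest_ofK. Qed.

Lemma fmulr1 : right_id fone fmul.
Proof. by move=> h; rewrite fmulC fmul1. Qed.

Lemma fmul_unit h1 h2 : fmul h1 h2 = fone -> h1 = fone /\ h2 = fone.
Proof.
move=> /(congr1 (fun h => size (trees h))) /=.
rewrite !size_sort size_map size_cat /= => /eqP.
rewrite addn_eq0 !size_eq0 => /andP[/eqP s1 /eqP s2].
by rewrite -(forest_ofK h1) -(forest_ofK h2) s1 s2.
Qed.

HB.instance Definition _ :=
  Choice_isMonomialDef.Build forest fmulA fmul1 fmulr1 fmul_unit.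
HB.instance Definition _ := MonomialDef_isConomialDef.Build forest fmulC.

Fixpoint ptree_nodes t : nat :=
  let: Node _ s := t in (sumn (map ptree_nodes s)).+1.

Definition nodes (h : forest) : nat := sumn (map ptree_nodes (trees h)).

Definition forest_le (n : nat) : set forest := [set h | (nodes h <= n)%N].

Definition broot (a : A) (h : forest) : forest := forest_of [:: Node a (trees h)].

Lemma finite_forest_le n : finite_set (forest_le n).
Proof.
pose S m := [set s : seq (ptree A) | (sumn (map ptree_nodes s) <= m)%N].
suff finS : forall m, finite_set (S m).
  apply: (@sub_finite_set _ _ (forest_of @` S n)); last exact: finite_image.
  by move=> h hn; exists (trees h) => //; rewrite forest_ofK.
elim=> [|m IHm].
  apply: (@sub_finite_set _ _ [set [::]]) => // -[|[a s] s'] //=.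
pose g (x : A * (seq (ptree A) * seq (ptree A))) := Node x.1 x.2.1 :: x.2.2.
apply: (@sub_finite_set _ _ ([set [::]] `|` g @` (setT `*` (S m `*` S m)))).
  move=> [|[a s] s'] /=; first by left.
  rewrite /S /= addSn ltnS => le_m; right; exists (a, (s, s')) => //; split=> //.
  by split; rewrite /S /=; apply: leq_trans le_m; rewrite ?leq_addr ?leq_addl.
rewrite finite_setU; split=> //; apply: finite_image.
by apply: finite_setX => //; apply: finite_setX.
Qed.

End Forest.

Section ProductMonomial.
Variables M1 M2 : conomType.

Definition pmone : M1 * M2 := (mone, mone).
Definition pmmul (x y : M1 * M2) : M1 * M2 := (mmul x.1 y.1, mmul x.2 y.2).

Lemma pmmulA : associative pmmul.
Proof. by move=> x y z; rewrite /pmmul !mulmA. Qed.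
Lemma pmmulC : commutative pmmul.
Proof. by move=> x y; rewrite /pmmul mulmC [mmul x.2 _]mulmC. Qed.
Lemma pmmul1 : left_id pmone pmmul.
Proof. by move=> [x y]; rewrite /pmmul /= !mul1m. Qed.
Lemma pmmulr1 : right_id pmone pmmul.
Proof. by move=> x; rewrite pmmulC pmmul1. Qed.
Lemma pmmul_unit x y : pmmul x y = pmone -> x = pmone /\ y = pmone.
Proof.
by case: x y => [x1 x2] [y1 y2] [] /unitm[-> ->] /unitm[-> ->].
Qed.

HB.instance Definition _ :=
  Choice_isMonomialDef.Build (M1 * M2)%type pmmulA pmmul1 pmmulr1 pmmul_unit.
HB.instance Definition _ :=
  MonomialDef_isConomialDef.Build (M1 * M2)%type pmmulC.

End ProductMonomial.

Section Hopf.
Variables (R : realType) (A : finType).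

(** [<< h >>] is the basis element [h], [x@_h] the [h]-coefficient of [x];
    the basis [F * F] makes [HH] the tensor square of [H], as an algebra. *)
Local Notation F := (forest A).
Local Notation H := {malg R[F]}.
Local Notation HH := {malg R[(F * F)%type]}.

Implicit Types (h g : F) (x y p rho : H).

Definition tens x y : HH :=
  \sum_(h <- msupp x) \sum_(g <- msupp y) << x@_h * y@_g *g (h, g) >>.

Definition id_broot (a : A) (z : HH) : HH :=
  \sum_(k <- msupp z) << z@_k *g (k.1, broot a k.2) >>.

Fixpoint coprod_tree (t : ptree A) : HH :=
  let: Node a s := t in
  id_broot a (\prod_(z <- map coprod_tree s) z) + << (forest_of [:: t], mone) >>.

Definition coprod_forest h : HH := \prod_(t <- trees h) coprod_tree t.

Definition coprod x : HH := \sum_(h <- msupp x) x@_h *: coprod_forest h.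

Lemma coprodE (d : {fset F}) x : fsubset (msupp x) d ->
  coprod x = \sum_(h <- d) x@_h *: coprod_forest h.
Proof.
move=> le_d; rewrite /coprod (big_fset_incl _ le_d) // => h _ /mcoeff_outdom ->.
by rewrite scale0r.
Qed.

Lemma coprodU h : coprod << h >> = coprod_forest h.
Proof. by rewrite (coprodE msuppU_le) big_seq_fset1 mcoeffUU scale1r. Qed.

Lemma coprod_is_linear : linear coprod.
Proof.
move=> c x y; pose d := fsetU (msupp x) (msupp y).
have dx : fsubset (msupp x) d by apply: fsubsetUl.
have dy : fsubset (msupp y) d by apply: fsubsetUr.
have dxy : fsubset (msupp (c *: x + y)) d.
  apply: (fsubset_trans (msuppD_le _ _)); rewrite fsubUset dy andbT.
  exact: fsubset_trans (msuppZ_le _ _) dx.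
rewrite (coprodE dx) (coprodE dy) (coprodE dxy) scaler_sumr -big_split /=.
by apply: eq_bigr => h _; rewrite mcoeffD mcoeffZ scalerDl scalerA.
Qed.

HB.instance Definition _ := GRing.isLinear.Build R H HH _ coprod coprod_is_linear.

Lemma coprod_treeE a (s : seq (ptree A)) :
  coprod_tree (Node a s) =
  id_broot a (\prod_(t <- s) coprod_tree t) + << (forest_of [:: Node a s], mone) >>.
Proof. by rewrite /= big_map. Qed.

Lemma coprod_tree_canon (t : ptree A) : coprod_tree (canon t) = coprod_tree t.
Proof.
elim/ptree_rect': t => a s IH.
have E : map (coprod_tree \o @canon A) s = map coprod_tree s.
  by elim: s IH => //= t s IHs [-> /IHs ->].
rewrite [canon _]/= !coprod_treeE -/(canons s).
have -> : forest_of [:: Node a (canons s)] = forest_of [:: Node a s].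
  by apply: eq_forest_of; have := canonK (Node a s); rewrite /canons /= => ->.
suff -> : \prod_(t <- canons s) coprod_tree t = \prod_(t <- s) coprod_tree t by [].
rewrite (perm_big (map (@canon A) s)); last by rewrite perm_sort.
by rewrite -!(big_map coprod_tree xpredT id) -map_comp E.
Qed.

Lemma coprod_forest_of (s : seq (ptree A)) :
  coprod_forest (forest_of s) = \prod_(t <- s) coprod_tree t.
Proof.
rewrite /coprod_forest (perm_big (map (@canon A) s)) /=; last by rewrite perm_sort.
by rewrite big_map; apply: eq_bigr => t _; rewrite coprod_tree_canon.
Qed.

Lemma coprod1 : coprod 1 = 1.
Proof. by rewrite coprodU coprod_forest_of big_nil. Qed.

Lemma coprodM x y : coprod (x * y) = coprod x * coprod y.
Proof.
rewrite malgME /coprod -/(coprod _) raddf_sum mulr_suml; apply: eq_bigr => h _.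
rewrite raddf_sum mulr_sumr; apply: eq_bigr => g _ /=.
rewrite (coprodE msuppU_le) big_seq_fset1 mcoeffUU.
rewrite /mmul /= /fmul coprod_forest_of big_cat /=.
by rewrite -scalerAl -scalerAr scalerA.
Qed.

Lemma coprod_broot a h :
  coprod << broot a h >> = id_broot a (coprod << h >>) + << (broot a h, mone) >>.
Proof.
by rewrite !coprodU coprod_forest_of big_seq1 /= big_map.
Qed.

(** A functional on [H] is given by its values on the basis, so that [H^*] is
    [F -> R]; [pairing] evaluates the linear extension. *)
Definition pairing (K : choiceType) (phi : K -> R) (z : {malg R[K]}) : R :=
  \sum_(k <- msupp z) z@_k * phi k.

Definition star (phi psi : F -> R) : F -> R :=
  fun h => pairing (fun k => phi k.1 * psi k.2) (coprod << h >>).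

Definition functional_of x : F -> R := fun h => x@_h.

Definition is_character (phi : F -> R) : Prop :=
  pairing phi 1 = 1 /\ forall x y, pairing phi (x * y) = pairing phi x * pairing phi y.

Definition primitive : set H :=
  [set x | x@_mone = 0 /\ coprod x = tens x 1 + tens 1 x].

Fixpoint graft_tree (s : seq (ptree A)) (t : ptree A) : seq (ptree A) :=
  let: Node a ts := t in
  Node a (s ++ ts) ::
  map (Node a)
    ((fix graft_in us :=
        if us is u :: us' then
          map (fun u' => u' :: us') (graft_tree s u) ++
          map (cons u) (graft_in us')
        else [::]) ts).

Fixpoint graft_trees (s ts : seq (ptree A)) : seq (seq (ptree A)) :=
  if ts is t :: ts' then
    map (fun t' => t' :: ts') (graft_tree s t) ++
    map (cons t) (graft_trees s ts')
  else [::].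

Definition gtop_forest h g : H :=
  (nodes g)%:R^-1 *:
  \sum_(s <- graft_trees (trees h) (trees g)) << forest_of s >>.

Lemma graft_tree_nil (t : ptree A) :
  graft_tree [::] t = nseq (ptree_nodes t) t.
Proof.
elim/ptree_rect': t => a ts IH /=; congr cons.
rewrite -map_nseq; congr map; elim: ts IH => //= t ts IHts [-> /IHts ->].
by rewrite !map_nseq nseqD.
Qed.

Lemma graft_trees_nil (ts : seq (ptree A)) :
  graft_trees [::] ts = nseq (sumn (map (@ptree_nodes A) ts)) ts.
Proof.
by elim: ts => //= t ts ->; rewrite graft_tree_nil !map_nseq nseqD.
Qed.

Lemma gtop_forest1 h : (0 < nodes h)%N -> gtop_forest mone h = << h >>.
Proof.
move=> h_gt0; rewrite /gtop_forest /= /canons /= graft_trees_nil -/(nodes h).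
rewrite big_nseq iter_addr_0 forest_ofK -(scaler_nat (nodes h) << h >>) scalerA.
rewrite mulVf ?scale1r //.
by rewrite pnatr_eq0 -lt0n.
Qed.

Definition gtop x y : H :=
  \sum_(h <- msupp x) \sum_(g <- msupp y) (x@_h * y@_g) *: gtop_forest h g.

Definition hdeg x : nat := \max_(h <- msupp x) nodes h.

Definition homogeneous x : Prop := forall h, h \in msupp x -> nodes h = hdeg x.

Definition basis_of (B W : set H) : Prop :=
  [/\ B `<=` W,
      forall (s : seq H) (c : H -> R), uniq s -> (forall b, b \in s -> B b) ->
        \sum_(b <- s) c b *: b = 0 -> forall b, b \in s -> c b = 0
    & forall w, W w -> exists (s : seq H) (c : H -> R),
        (forall b, b \in s -> B b) /\ w = \sum_(b <- s) c b *: b].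

Definition primitive_basis (P : set H) : Prop :=
  basis_of P primitive /\ forall p, P p -> homogeneous p.

Section PrimitiveBasis.
Variable P : set H.

(** The set [P^\top] together with the empty forest: a basis of [H] when [P] is
    a basis of the primitive elements, which makes [dual_elt] well defined. *)
Definition Ptop : set H :=
  [set rho | rho = 1 \/ exists p ps,
     [/\ P p, forall q, q \in ps -> P q & rho = foldl gtop p ps]].

Definition dual_elt rho : H :=
  xget 0 [set x | forall sigma, Ptop sigma ->
    pairing (functional_of x) sigma = (sigma == rho)%:R].

End PrimitiveBasis.

End Hopf.

Section Time.
Variables (R : realType) (T : {posnum R}).

Definition time : Type := {t : R | 0 <= t <= T%:num}.

Lemma time0_subproof : 0 <= (0 : R) <= T%:num.
Proof. by rewrite lexx /=. Qed.

Definition time0 : time := exist _ 0 time0_subproof.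

Implicit Types (s t : time).

Definition hoelder (g : R) (F : time -> time -> R) : \bar R :=
  ereal_sup [set (`|F x.1 x.2| / `|\val x.2 - \val x.1| `^ g)%:E
            | x in [set x : time * time | x.1 <> x.2]].

Definition hoelder_norm (g : R) (f : time -> R) : \bar R :=
  (ereal_sup [set `|f t|%:E | t in [set: time]] +
   hoelder g (fun s t => f t - f s)%R)%E.

(** Restrictions to [0, T] of smooth functions on the line. *)
Definition smooth (f : time -> R) : Prop :=
  exists g : R -> R, (forall n x, derivable (derive1n n g) x 1) /\
    forall t, f t = g (\val t).

Definition little_hoelder (g : R) : set (time -> R) :=
  [set f | forall e : R, 0 < e ->
    exists2 k, smooth k & (hoelder_norm g (f - k)%R < e%:E)%E].

Definition countable_dense (g : R) (Omega : set (time -> R)) : Prop :=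
  [/\ countable Omega, Omega `<=` little_hoelder g &
      forall f, little_hoelder g f -> forall e : R, 0 < e ->
        exists2 k, Omega k & (hoelder_norm g (f - k)%R < e%:E)%E].

(** A partition 0 = t_0 < ... < t_n = t is given by the sequence t_1, ..., t_n,
    as in [itv_partition]. *)
Definition intervals (pi : seq time) : seq (time * time) := zip (time0 :: pi) pi.

Definition mesh_to_0 (t : time) : set_system (seq time) :=
  [set Q | exists2 d : R, 0 < d &
    forall pi, itv_partition 0 (\val t) (map \val pi) ->
      (forall ab, ab \in intervals pi -> \val ab.2 - \val ab.1 < d) -> Q pi].

Definition mesh_limit (Xi : time -> time -> R) (t : time) : R :=
  lim ((fun pi => \sum_(ab <- intervals pi) Xi ab.1 ab.2) @ mesh_to_0 t).

End Time.

Section RoughPaths.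
Variables (R : realType) (A : finType) (T : {posnum R}).
Local Notation F := (forest A).
Local Notation H := {malg R[F]}.
Local Notation I := (time T).

Record rough_path (alpha : R) := RoughPath {
  rp : I -> I -> F -> R;
  rp_character : forall s t, is_character (rp s t);
  rp_chen : forall s u t, star (rp s u) (rp u t) = rp s t;
  rp_hoelder : forall h,
    (hoelder (alpha *+ nodes h) (fun s t => rp s t h) < +oo)%E
}.

Variable alpha : R.
Implicit Types (X Y : rough_path alpha) (Z W : I -> H).

Definition Nlevel : nat := Num.truncn alpha^-1.
Local Notation N := Nlevel.

Definition rough_dist X Y : \bar R :=
  ereal_sup [set hoelder (alpha *+ nodes h) (fun s t => rp X s t h - rp Y s t h)
            | h in [set h : F | forest_le N h /\ h <> mone]].

Definition remainder X Z (h : F) (s t : I) : R :=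
  (Z t)@_h - pairing (star (rp X s t) (functional_of << h >>)) (Z s).

Definition ctrl_norm X (g : R) Z : \bar R :=
  (\sum_(h \in forest_le N.-1)
     (`|(Z (time0 T))@_h|%R%:E + hoelder (g *+ (N - nodes h))%R (remainder X Z h)))%E.

Definition span_valued Z : Prop :=
  forall t h, h \in msupp (Z t) -> forest_le N.-1 h.

Definition ctrl X : set (I -> H) :=
  [set Z | span_valued Z /\ (ctrl_norm X alpha Z < +oo)%E].

Definition ctrl_closure X (beta : R) : set (I -> H) :=
  [set Z | [/\ span_valued Z, (ctrl_norm X beta Z < +oo)%E &
    forall e : R, 0 < e ->
      exists2 W, ctrl X W & (ctrl_norm X beta (Z - W)%R < e%:E)%E]].

Variable P : set H.

(** The index sets of the sums below are finite.  The empty forest is among the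
    [rho]: it contributes the leading term [Z^{p^* \star h}_a X^p_{a,b}]. *)
Definition local_integral X Z (h : F) (p : H) (a b : I) : R :=
  \sum_(rho \in [set rho : H | Ptop P rho /\ (hdeg rho < N - nodes h - hdeg p)%N])
    pairing (star (functional_of (dual_elt P rho))
               (star (functional_of (dual_elt P p)) (functional_of << h >>))) (Z a)
    * pairing (rp X a b) (gtop rho p).

Definition integral_sum X Z (h : F) (t : I) : R :=
  \sum_(p \in [set p : H | P p /\ (hdeg p < N - nodes h)%N])
    mesh_limit (local_integral X Z h p) t.

(** The part of [Gamma_X f] carried by the forests with at least [N - 1 - k]
    nodes; the integrals defining the components with [|h| = N - 1 - k.+1] only
    involve components of higher degree. *)
Fixpoint Gamma_upto X (f : F -> I -> R) (k : nat) (t : I) : H :=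
  if k is k'.+1 then
    Gamma_upto X f k' t +
    \sum_(h \in [set h : F | nodes h = N.-1 - k'.+1]%N)
      << integral_sum X (Gamma_upto X f k') h t + f h t *g h >>
  else \sum_(h \in [set h : F | nodes h = N.-1]) << f h t *g h >>.

Definition Gamma_path f X : I -> H := Gamma_upto X f N.-1.

(** The direct sum of copies of [C] indexed by the forests of [F_(N-1)]. *)
Definition coeffs (C : set (I -> R)) : set (F -> I -> R) :=
  [set f | forall h, (forest_le N.-1 h -> C (f h)) /\
                     (~ forest_le N.-1 h -> f h = 0)].

Definition sections (C : set (I -> R)) : set (rough_path alpha -> I -> H) :=
  [set Gamma_path f | f in coeffs C].

End RoughPaths.

Definition linear_subspace (R : realType) (V : lmodType R) (S : set V) : Prop :=
  [/\ S 0, forall u v, S u -> S v -> S (u + v)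
    & forall (c : R) u, S u -> S (c *: u)].

(* Main.v *)
(** The path [Z = Gamma_X f] is characterised by [Z_0 = f_0] and
    [R^h_{s,t} = f^h_t - f^h_s + O(|t - s|^(1 - eps + alpha))] for all [h]. Indeed the basis [P^\top]
    gives the expansion [X_{s,t} - 1 = sum_p X^{(. \top p)}_{s,t} \star p^*], so that the sum over
    [p] of the integrals against [X^p] is obtained by sewing the germ
    [<(X_{s,t} - 1) \star h, Z_s>]; the exponent exceeds 1 because [(N + 1) alpha > 1] and
    [eps < 1 - N alpha]. Uniqueness makes [Gamma_X] linear. By decreasing induction on [|h|], the a
    priori form of the sewing estimate bounds [R^h] by the Hoelder norm of [f], and the difference of
    the remainders for [X] and [Y] by the distance of [X] and [Y], in both cases with the exponent
    [1 - eps > N alpha]; hence the continuity of the norm, and the possibility to replace [f] by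
    coefficients in [Omega].

    For the density, let [Z] be in [D^alpha_X] and choose coefficients [f] which are affine between
    the points of a grid of width [d], in such a way that [Gamma_X f = Z] on the grid; this
    determines [f^h] by decreasing recursion on [|h|]. Between two consecutive points of the grid the
    remainder of [Gamma_X f] is [O(d^((N - |h|) alpha) |t - s| / d)]. Hence [V = Z - Gamma_X f], which
    vanishes on the grid, has remainders [O(d^(alpha - beta) |t - s|^((N - |h|) beta))]. Piecewise
    affine functions are limits of smooth functions in the [(1 - eps)]-Hoelder norm because
    [max(x, 0)] is the limit of [d ln(1 + e^(x / d))]. *)

(* The elements dual to [Ptop] are specified only by their pairings, so the formula for Gamma_X
   carries information only once [Ptop] is known to be a homogeneous basis. Generation and
   independence both follow from one identity for primitive p, Delta (h \top p) = (h \top p) (x) 1 +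
   (id (x) (. \top p)) Delta h: collecting the terms whose left factor is a forest of the highest
   relevant degree isolates primitive elements, and degrees are then removed one by one. Paired with
   X, the same identity is a Chen relation for X^(. \top p), which makes the additivity defect of
   each integral germ a product of a remainder and an increment of X. Sewing enters in two forms.
   The construction yields the integral with a constant that depends on X and f in an uncontrolled
   way. The a priori form takes that estimate as mere qualitative input and returns a constant
   depending only on a bound for the rough path. This uniformity is what continuity in X and all the
   approximation arguments require. *)
From HB Require Import structures.
From mathcomp Require Import all_boot all_order all_algebra.
From mathcomp Require Import finmap monalg.
From mathcomp Require Import boolp classical_sets functions cardinality fsbigop.
From mathcomp Require Import reals constructive_ereal ereal topology normedtype.
From mathcomp Require Import derive numfun exp sequences realfun.
Require Import Defs.
From mathcomp Require Import ring lra zify.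

Set Implicit Arguments.
Unset Strict Implicit.
Unset Printing Implicit Defensive.

Import Order.TTheory GRing.Theory Num.Theory.
Import numFieldNormedType.Exports.

Local Open Scope classical_set_scope.
Local Open Scope ring_scope.

(** * Linear extension from a basis *)

(** Sealed: unification would otherwise unfold the finite sums. *)
HB.lock Definition lext (K : choiceType) (R : comRingType) (V : lmodType R)
    (f : K -> V) (z : {malg R[K]}) : V := \sum_(k <- msupp z) z@_k *: f k.

HB.lock Definition bas (K : choiceType) (R : comRingType) (k : K) :
  {malg R[K]} := << k >>.
Arguments bas {K R}.

Section LinearExtension.
Variables (K : choiceType) (R : comRingType).
Implicit Types (V W : lmodType R) (z : {malg R[K]}).

Lemma lextEw V (f : K -> V) (d : {fset K}) z : fsubset (msupp z) d ->
  lext f z = \sum_(k <- d) z@_k *: f k.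
Proof.
move=> le_d; rewrite lext.unlock (big_fset_incl _ le_d) // => k _ /mcoeff_outdom ->.
by rewrite scale0r.
Qed.

Lemma lext_is_linear V (f : K -> V) : linear (lext f).
Proof.
move=> c x y; pose d := fsetU (msupp x) (msupp y).
have dx : fsubset (msupp x) d by apply: fsubsetUl.
have dy : fsubset (msupp y) d by apply: fsubsetUr.
have dxy : fsubset (msupp (c *: x + y)) d.
  apply: (fsubset_trans (msuppD_le _ _)); rewrite fsubUset dy andbT.
  exact: fsubset_trans (msuppZ_le _ _) dx.
rewrite (lextEw f dx) (lextEw f dy) (lextEw f dxy) scaler_sumr -big_split /=.
by apply: eq_bigr => h _; rewrite mcoeffD mcoeffZ scalerDl scalerA.
Qed.

HB.instance Definition _ V (f : K -> V) :=
  GRing.isLinear.Build R {malg R[K]} V _ (lext f) (lext_is_linear f).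

Lemma lextUc V (f : K -> V) c k : lext f << c *g k >> = c *: f k.
Proof. by rewrite (lextEw f msuppU_le) big_seq_fset1 mcoeffUU. Qed.

Lemma lextU V (f : K -> V) k : lext f (bas k) = f k.
Proof. by rewrite bas.unlock lextUc scale1r. Qed.

Lemma basE k : << k >> = bas k :> {malg R[K]}.
Proof. by rewrite bas.unlock. Qed.

Lemma malgUZ c k : << c *g k >> = c *: bas k :> {malg R[K]}.
Proof.
rewrite bas.unlock; apply/malgP => l; rewrite mcoeffZ !mcoeffU.
by case: eqP => _; rewrite ?mulr1 ?mulr0.
Qed.

Lemma coeff_bas k l : (bas k : {malg R[K]})@_l = (k == l)%:R.
Proof. by rewrite bas.unlock mcoeffU. Qed.

Lemma lext_id z : lext bas z = z.
Proof.
by rewrite [RHS]monalgE lext.unlock; apply: eq_bigr => k _; rewrite -malgUZ.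
Qed.

Lemma eq_in_lext V (f g : K -> V) z :
  (forall k, k \in msupp z -> f k = g k) -> lext f z = lext g z.
Proof. by rewrite lext.unlock => fg; apply: eq_big_seq => k /fg ->. Qed.

Lemma eq_lext V (f g : K -> V) : f =1 g -> lext f =1 lext g.
Proof. by move=> fg z; apply: eq_in_lext => k _; rewrite fg. Qed.

Lemma lext_comp V W (L : {linear V -> W}) (f : K -> V) z :
  L (lext f z) = lext (L \o f) z.
Proof. by rewrite lext.unlock linear_sum; apply: eq_bigr => k _; rewrite linearZ. Qed.

Lemma lextDf V (f g : K -> V) z : lext (fun k => f k + g k) z = lext f z + lext g z.
Proof. by rewrite lext.unlock -big_split; apply: eq_bigr => k _; rewrite scalerDr. Qed.

Lemma lextZf V (f : K -> V) c z : lext (fun k => c *: f k) z = c *: lext f z.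
Proof. by rewrite lext.unlock scaler_sumr; apply: eq_bigr => k _; rewrite !scalerA mulrC. Qed.

Lemma lext0f V z : lext (fun=> 0 : V) z = 0.
Proof. by rewrite lext.unlock; apply: big1 => k _; rewrite scaler0. Qed.

Lemma lext_scalel V (f : K -> R^o) (v : V) z :
  lext (fun k => f k *: v) z = lext f z *: v.
Proof.
by rewrite lext.unlock scaler_suml; apply: eq_bigr => k _; rewrite scalerA.
Qed.

Lemma lext_sumf V (I : Type) (r : seq I) (c : I -> R) (f : I -> K -> V) z :
  lext (fun k => \sum_(i <- r) c i *: f i k) z = \sum_(i <- r) c i *: lext (f i) z.
Proof.
elim: r => [|i r IH].
  by rewrite big_nil -[RHS](lext0f V z); apply: eq_lext => k; rewrite big_nil.
rewrite big_cons -IH -lextZf -lextDf; apply: eq_lext => k; by rewrite big_cons.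
Qed.

End LinearExtension.

Lemma lext_lext (K L : choiceType) (R : comRingType) (V : lmodType R)
    (f : L -> V) (g : K -> {malg R[L]}) z :
  lext f (lext g z) = lext (fun k => lext f (g k)) z.
Proof. exact: lext_comp. Qed.

Lemma lext_exchange (K L : choiceType) (R : comRingType) (V : lmodType R)
    (f : K -> L -> V) (z : {malg R[K]}) (w : {malg R[L]}) :
  lext (fun k => lext (f k) w) z = lext (fun l => lext (f^~ l) z) w.
Proof.
rewrite lext.unlock; under eq_bigr do rewrite scaler_sumr.
rewrite exchange_big; apply: eq_bigr => l _; rewrite scaler_sumr.
by apply: eq_bigr => k _; rewrite !scalerA mulrC.
Qed.

Lemma coeff_lext (K L : choiceType) (R : comRingType) (f : K -> {malg R[L]}) z l :
  (lext f z)@_l = lext (fun k => (f k)@_l : R^o) z.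
Proof. by rewrite lext.unlock raddf_sum; apply: eq_bigr => k _; rewrite /= mcoeffZ. Qed.

Lemma lext_delta (K : choiceType) (R : comRingType) (V : lmodType R)
    (z : {malg R[K]}) k (v : V) :
  lext (fun l => (l == k)%:R *: v) z = z@_k *: v.
Proof.
rewrite lext.unlock; under eq_bigr do rewrite scalerA; rewrite -scaler_suml.
congr (_ *: _); rewrite [in RHS](monalgE z) raddf_sum; apply: eq_bigr => l _ /=.
by rewrite mcoeffU mulr_natr.
Qed.

Lemma lext_delta1 (K : choiceType) (R : comRingType) (z : {malg R[K]}) k :
  lext (fun l => (l == k)%:R : R^o) z = z@_k.
Proof.
rewrite -[RHS]mulr1 -[RHS](lext_delta z k (1 : R^o)); apply: eq_lext => l.
by rewrite /GRing.scale /= mulr1.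
Qed.

Lemma mul_lextl (L : choiceType) (R : comRingType) (W : comAlgType R)
    (f : L -> W) y w :
  lext f y * w = lext (fun k => f k * w) y.
Proof. by rewrite lext.unlock mulr_suml; apply: eq_bigr => k _; rewrite scalerAl. Qed.

Lemma mul_lextr (L : choiceType) (R : comRingType) (W : comAlgType R)
    (f : L -> W) y w :
  w * lext f y = lext (fun k => w * f k) y.
Proof. by rewrite lext.unlock mulr_sumr; apply: eq_bigr => k _; rewrite scalerAr. Qed.

Section LinearExtensionProduct.
Variables (K : conomType) (R : comRingType).
Implicit Types (z w : {malg R[K]}).

Lemma mulUU (k l : K) : bas k * bas l = bas (mmul k l) :> {malg R[K]}.
Proof. by rewrite bas.unlock malgM_def fgmulUU mulr1. Qed.

Lemma malg1E : 1 = bas mone :> {malg R[K]}.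
Proof. by rewrite bas.unlock. Qed.

(** Bilinear identities involving a product are checked on monomials. *)
Lemma lextM (V : lmodType R) (f : K -> V) z w :
  lext f (z * w) = lext (fun k => lext (fun l => f (mmul k l)) w) z.
Proof.
rewrite -{1}(lext_id z) mul_lextl lext_lext; apply: eq_lext => k.
rewrite -{1}(lext_id w) mul_lextr lext_lext; apply: eq_lext => l.
by rewrite mulUU lextU.
Qed.

Lemma lext_morph (W : comAlgType R) (f : K -> W) z w :
  (forall k l, f (mmul k l) = f k * f l) ->
  lext f (z * w) = lext f z * lext f w.
Proof.
move=> fM; rewrite lextM mul_lextl; apply: eq_lext => k.
by rewrite mul_lextr; apply: eq_lext => l.
Qed.

Lemma lext_deriv (W : comAlgType R) (f i : K -> W) z w :
  (forall k l, f (mmul k l) = f k * i l + i k * f l) ->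
  lext f (z * w) = lext f z * lext i w + lext i z * lext f w.
Proof.
move=> fM; rewrite lextM !mul_lextl -lextDf; apply: eq_lext => k.
by rewrite !mul_lextr -lextDf; apply: eq_lext => l.
Qed.

End LinearExtensionProduct.

Section Support.
Variable R : comRingType.

Definition on_supp (K : choiceType) (Q : K -> Prop) (z : {malg R[K]}) : Prop :=
  forall k, k \in msupp z -> Q k.

Lemma on_suppD (K : choiceType) (Q : K -> Prop) (z w : {malg R[K]}) :
  on_supp Q z -> on_supp Q w -> on_supp Q (z + w).
Proof.
move=> Qz Qw k; rewrite -mcoeff_neq0 mcoeffD => kzw.
have [kz|] := boolP (k \in msupp z); first exact: Qz.
move/mcoeff_outdom => z0; apply: Qw; rewrite -mcoeff_neq0.
by move: kzw; rewrite z0 add0r.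
Qed.

Lemma on_suppZ (K : choiceType) (Q : K -> Prop) c (z : {malg R[K]}) :
  on_supp Q z -> on_supp Q (c *: z).
Proof.
move=> Qz k; rewrite -mcoeff_neq0 mcoeffZ => kz; apply: Qz.
by rewrite -mcoeff_neq0; apply: contraNneq kz => ->; rewrite mulr0.
Qed.

Lemma on_supp0 (K : choiceType) (Q : K -> Prop) : on_supp Q (0 : {malg R[K]}).
Proof. by move=> k; rewrite -mcoeff_neq0 mcoeff0 eqxx. Qed.

Lemma on_suppU (K : choiceType) (Q : K -> Prop) k : Q k -> on_supp Q (bas k : {malg R[K]}).
Proof. by move=> Qk l; rewrite bas.unlock => /(fsubsetP msuppU_le)/fset1P ->. Qed.

Lemma on_supp_sum (I : eqType) (K : choiceType) (Q : K -> Prop) (r : seq I)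
    (f : I -> {malg R[K]}) :
  (forall i, i \in r -> on_supp Q (f i)) -> on_supp Q (\sum_(i <- r) f i).
Proof.
elim: r => [|i r IH] Qf; first by rewrite big_nil; apply: on_supp0.
rewrite big_cons; apply: on_suppD; first by apply: Qf; rewrite mem_head.
by apply: IH => j jr; apply: Qf; rewrite inE jr orbT.
Qed.

Lemma on_supp_lext (K L : choiceType) (Q : K -> Prop) (Q' : L -> Prop)
    (f : K -> {malg R[L]}) (z : {malg R[K]}) :
  on_supp Q z -> (forall k, Q k -> on_supp Q' (f k)) -> on_supp Q' (lext f z).
Proof.
rewrite lext.unlock => Qz Qf; apply: on_supp_sum => k kz; apply: on_suppZ.
by apply: Qf; apply: Qz.
Qed.

End Support.

(** * The coproduct and its transpose *)

Section Forests.
Variable A : finType.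
Implicit Types (h g : forest A) (s : seq (ptree A)) (t : ptree A).

Lemma canons_trees h : canons (trees h) = trees h.
Proof. by case: h => s /= /eqP. Qed.

Lemma broot_of a s : broot a (forest_of s) = forest_of [:: Node a s].
Proof.
by apply: eq_forest_of; have := canonK (Node a s); rewrite /canons /= => ->.
Qed.

Lemma trees_broot a h : trees (broot a h) = [:: Node a (trees h)].
Proof. by rewrite -[in RHS](canons_trees h). Qed.

Lemma forest_of_cons t s : forest_of (t :: s) = mmul (forest_of [:: t]) (forest_of s).
Proof. by rewrite /mmul /= fmul_of. Qed.

(** A tree is the [broot] of its branches, so the empty forest, [broot] and the product generate all
    forests. The coproduct and the grafting are known precisely through their behaviour under these
    three operations. *)
Lemma forest_rect_mul (Q : forest A -> Prop) :
  Q mone -> (forall a h, Q h -> Q (broot a h)) ->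
  (forall h g, Q h -> Q g -> Q (mmul h g)) -> forall h, Q h.
Proof.
move=> Q1 Qb QM.
have Qt : forall t, Q (forest_of [:: t]).
  elim/ptree_rect' => a s IH; rewrite -broot_of; apply: Qb.
  elim: s IH => [|t s IHs] //= [Qt /IHs Qs].
  by rewrite forest_of_cons; apply: QM.
move=> h; rewrite -(forest_ofK h); elim: (trees h) => [|t s IHs] //.
by rewrite forest_of_cons; apply: QM.
Qed.

Lemma ptree_nodes_canon t : ptree_nodes (canon t) = ptree_nodes t.
Proof.
elim/ptree_rect': t => a s IH /=; congr S.
have /perm_sumn -> := perm_map (@ptree_nodes A) (permEl (perm_sort (@ptree_le A) (map (@canon A) s))).
by congr sumn; elim: s IH => //= t s IHs [-> /IHs ->].
Qed.

Lemma nodes_of s : nodes (forest_of s) = sumn (map (@ptree_nodes A) s).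
Proof.
rewrite /nodes /=.
have /perm_sumn -> := perm_map (@ptree_nodes A) (permEl (perm_sort (@ptree_le A) (map (@canon A) s))).
by rewrite -map_comp; congr sumn; apply: eq_map => t /=; rewrite ptree_nodes_canon.
Qed.

Lemma nodesM h g : nodes (mmul h g) = (nodes h + nodes g)%N.
Proof. by rewrite /mmul /= nodes_of map_cat sumn_cat. Qed.

Lemma nodes1 : nodes (mone : forest A) = 0%N.
Proof. by rewrite nodes_of. Qed.

Lemma nodes_broot a h : nodes (broot a h) = (nodes h).+1.
Proof. by rewrite nodes_of /= addn0. Qed.

Lemma nodes_eq0 h : (nodes h == 0%N) = (h == mone).
Proof.
apply/eqP/eqP => [h0|->]; last exact: nodes1.
rewrite -(forest_ofK h); move: h0; rewrite /nodes.
by case: (trees h) => [|[a s] s'].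
Qed.

Lemma mmul_eq1 h g : (mmul h g == mone) = (h == mone) && (g == mone).
Proof. by rewrite -!nodes_eq0 nodesM addn_eq0. Qed.

Lemma broot_eq1 a h : (broot a h == mone) = false.
Proof. by rewrite -nodes_eq0 nodes_broot. Qed.

End Forests.

HB.lock Definition cop (R : realType) (A : finType) (h : forest A) :=
  @coprod_forest R A h.

Section Coalgebra.
Variables (R : realType) (A : finType).
Local Notation F := (forest A).
Local Notation H := {malg R[F]}.
Local Notation HH := {malg R[(F * F)%type]}.
Local Notation HHH := {malg R[(F * (F * F))%type]}.
Implicit Types (h g : F) (x y p : H) (w z : HH).
Local Notation cop := (@cop R A).

Lemma pairingE (K : choiceType) (phi : K -> R) (z : {malg R[K]}) :
  pairing phi z = lext (phi : K -> R^o) z.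
Proof. by rewrite lext.unlock. Qed.

Lemma coprodEl x : coprod x = lext cop x.
Proof. by rewrite lext.unlock cop.unlock. Qed.

Lemma copE h : cop h = coprod (bas h).
Proof. by rewrite cop.unlock -basE coprodU. Qed.

Lemma tensE x y :
  tens x y = lext (fun h => lext (fun g => bas (h, g) : HH) y) x.
Proof.
rewrite /tens lext.unlock; apply: eq_bigr => h _; rewrite scaler_sumr.
by apply: eq_bigr => g _; rewrite malgUZ scalerA.
Qed.

Lemma id_brootE a w : id_broot a w = lext (fun k => bas (k.1, broot a k.2) : HH) w.
Proof. by rewrite lext.unlock; apply: eq_bigr => k _; rewrite malgUZ. Qed.

Lemma cop1 : cop mone = 1.
Proof. by rewrite copE -malg1E coprod1. Qed.

Lemma copM h g : cop (mmul h g) = cop h * cop g.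
Proof. by rewrite !copE -coprodM mulUU. Qed.

Lemma cop_broot a h : cop (broot a h) =
  lext (fun k => bas (k.1, broot a k.2) : HH) (cop h) + bas (broot a h, mone).
Proof. by rewrite !copE -!basE coprod_broot id_brootE !basE. Qed.

(** Restatements for canonical structures which unification does not find. *)
Lemma lextM2 (V : lmodType R) (f : F * F -> V) w z :
  lext f (w * z) = lext (fun k => lext (fun l => f (mmul k l)) z) w.
Proof. exact: lextM. Qed.

Lemma lext_morph2 (W : comAlgType R) (f : F * F -> W) w z :
  (forall k l, f (mmul k l) = f k * f l) ->
  lext f (w * z) = lext f w * lext f z.
Proof. exact: lext_morph. Qed.

Lemma lext_deriv2 (W : comAlgType R) (f i : F * F -> W) w z :
  (forall k l, f (mmul k l) = f k * i l + i k * f l) ->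
  lext f (w * z) = lext f w * lext i z + lext i w * lext f z.
Proof. exact: lext_deriv. Qed.

Lemma lext_copM x y : lext cop (x * y) = lext cop x * lext cop y.
Proof. by rewrite -!coprodEl coprodM. Qed.

Definition cop_l (k : F * F) : HHH :=
  lext (fun l => bas (l.1, (l.2, k.2)) : HHH) (cop k.1).
Definition cop_r (k : F * F) : HHH := lext (fun l => bas (k.1, l) : HHH) (cop k.2).

Lemma cop_lM k l : cop_l (mmul k l) = cop_l k * cop_l l.
Proof.
rewrite /cop_l /= copM lextM2 mul_lextl; apply: eq_lext => i.
by rewrite mul_lextr; apply: eq_lext => j; rewrite mulUU.
Qed.

Lemma cop_rM k l : cop_r (mmul k l) = cop_r k * cop_r l.
Proof.
rewrite /cop_r /= copM lextM2 mul_lextl; apply: eq_lext => i.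
by rewrite mul_lextr; apply: eq_lext => j; rewrite mulUU.
Qed.

Lemma one_lext (K : conomType) (V : lmodType R) (f : K -> V) :
  lext f (1 : {malg R[K]}) = f mone.
Proof. by rewrite malg1E lextU. Qed.

(** Both sides are multiplicative. On [broot a h] each side has three summands: the iterated
    coproduct of h with its third factor rooted, the coproduct of h with its second factor rooted
    and an empty third one, and [h]_a with two empty factors. Only the first needs the induction
    hypothesis. *)
Lemma coassoc h : lext cop_l (cop h) = lext cop_r (cop h).
Proof.
elim/forest_rect_mul: h => [|a h IH|h g IHh IHg].
- by rewrite cop1 !one_lext /cop_l /cop_r /= cop1 !one_lext.
- pose B (l : F * (F * F)) : HHH := bas (l.1, (l.2.1, broot a l.2.2)).
  rewrite cop_broot !linearD /= !lext_lext !lextU.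
  have -> : cop_l (broot a h, mone) =
      lext (fun k => bas (k.1, (broot a k.2, mone)) : HHH) (cop h) +
      bas (broot a h, (mone, mone)).
    rewrite /cop_l /= cop_broot linearD /= lext_lext lextU; congr (_ + _).
    by apply: eq_lext => k; rewrite lextU.
  have -> : cop_r (broot a h, mone) = bas (broot a h, (mone, mone)).
    by rewrite /cop_r /= cop1 one_lext.
  rewrite addrA; congr (_ + _).
  have -> : lext (fun k => lext cop_l (bas (k.1, broot a k.2) : HH)) (cop h) =
      lext B (lext cop_l (cop h)).
    rewrite lext_lext; apply: eq_lext => k; rewrite lextU /cop_l lext_lext /=.
    by apply: eq_lext => l; rewrite lextU.
  rewrite IH lext_lext -lextDf; apply: eq_lext => k.
  rewrite lextU /cop_r /= cop_broot linearD /= !lext_lext lextU; congr (_ + _).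
  by apply: eq_lext => l; rewrite !lextU.
- by rewrite copM [LHS](lext_morph2 _ _ cop_lM) [RHS](lext_morph2 _ _ cop_rM) IHh IHg.
Qed.

Lemma counitl h : lext (fun k => (k.1 == mone)%:R *: bas k.2 : H) (cop h) = bas h.
Proof.
elim/forest_rect_mul: h => [|a h IH|h g IHh IHg].
- by rewrite cop1 one_lext eqxx scale1r.
- rewrite cop_broot linearD /= lext_lext lextU /= scale0r addr0.
  rewrite -[RHS](@lextU _ _ _ (fun h : F => (bas (broot a h)) : H)) -[in RHS]IH lext_lext.
  by apply: eq_lext => k; rewrite !lextU linearZ /= lextU.
- rewrite copM [LHS]lext_morph2 ?IHh ?IHg ?mulUU // => k l /=.
  rewrite mmul_eq1 -scalerAl -scalerAr scalerA mulUU.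
  by do 2!case: eqP => _; rewrite ?mulr1 ?mulr0.
Qed.

Lemma counitr h : lext (fun k => (k.2 == mone)%:R *: bas k.1 : H) (cop h) = bas h.
Proof.
elim/forest_rect_mul: h => [|a h IH|h g IHh IHg].
- by rewrite cop1 one_lext eqxx scale1r.
- rewrite cop_broot linearD /= lext_lext lextU /= ?eqxx scale1r.
  rewrite (eq_lext (g := fun=> 0)) ?lext0f ?add0r // => k.
  by rewrite lextU /= ?broot_eq1 scale0r.
- rewrite copM [LHS]lext_morph2 ?IHh ?IHg ?mulUU // => k l /=.
  rewrite mmul_eq1 -scalerAl -scalerAr scalerA mulUU.
  by do 2!case: eqP => _; rewrite ?mulr1 ?mulr0.
Qed.

Lemma cop_nodes h : on_supp (fun k => nodes k.1 + nodes k.2 = nodes h)%N (cop h).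
Proof.
elim/forest_rect_mul: h => [|a h IH|h g IHh IHg].
- by rewrite cop1 malg1E; apply: on_suppU; rewrite !nodes1.
- rewrite cop_broot; apply: on_suppD; last first.
    by apply: on_suppU; rewrite /= nodes1 addn0.
  apply: (on_supp_lext IH) => k kh; apply: on_suppU => /=.
  by rewrite !nodes_broot -kh addnS.
- rewrite copM -[cop h]lext_id mul_lextl; apply: (on_supp_lext IHh) => k kh.
  rewrite -[cop g]lext_id mul_lextr; apply: (on_supp_lext IHg) => l lg.
  by rewrite mulUU; apply: on_suppU; rewrite /= !nodesM -kh -lg addnACA.
Qed.

Definition counit (h : F) : R := (h == mone)%:R.

Lemma starE (phi psi : F -> R) h :
  star phi psi h = lext (fun k => phi k.1 * psi k.2 : R^o) (cop h).
Proof. by rewrite /star pairingE copE basE. Qed.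

Lemma lext_scale (K : choiceType) (f : K -> R^o) (c : R) (z : {malg R[K]}) :
  c * lext f z = lext (fun k => c * f k : R^o) z.
Proof. by rewrite lextZf. Qed.

Lemma starA (phi psi chi : F -> R) :
  star phi (star psi chi) = star (star phi psi) chi.
Proof.
apply/funext => h; rewrite !starE.
pose T3 (l : F * (F * F)) : R^o := phi l.1 * (psi l.2.1 * chi l.2.2).
transitivity (lext T3 (lext cop_r (cop h))).
  rewrite lext_lext; apply: eq_lext => k; rewrite starE /cop_r lext_lext lext_scale.
  by apply: eq_lext => l; rewrite lextU.
rewrite -coassoc lext_lext; apply: eq_lext => k; rewrite starE /cop_l lext_lext.
rewrite mulrC lext_scale; apply: eq_lext => l; rewrite lextU /T3 /=; ring.
Qed.

Lemma star1f (phi : F -> R) : star counit phi = phi.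
Proof.
apply/funext => h; rewrite starE -[RHS](@lextU _ R R^o phi) -counitl lext_lext.
by apply: eq_lext => k; rewrite linearZ /= lextU.
Qed.

Lemma starf1 (phi : F -> R) : star phi counit = phi.
Proof.
apply/funext => h; rewrite starE -[RHS](@lextU _ R R^o phi) -counitr lext_lext.
by apply: eq_lext => k; rewrite linearZ /= lextU mulrC.
Qed.

End Coalgebra.

(** * Grafting and primitive elements *)

Section Grafting.
Variables (R : realType) (A : finType).
Local Notation F := (forest A).
Local Notation H := {malg R[F]}.
Local Notation HH := {malg R[(F * F)%type]}.
Implicit Types (h g : F) (x y p : H) (w z : HH) (s ts : seq (ptree A)) (t : ptree A).
Local Notation cop := (@cop R A).

Definition graft s ts : H := \sum_(r <- graft_trees s ts) bas (forest_of r).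
Definition graft1 s t : H := \sum_(t' <- graft_tree s t) bas (forest_of [:: t']).

Lemma graft_tree_node s a ts : graft_tree s (Node a ts) =
  Node a (s ++ ts) :: map (Node a) (graft_trees s ts).
Proof. by rewrite /=; congr (_ :: map _ _); elim: ts => //= t ts ->. Qed.

Definition lbroot a : H -> H := lext (fun h => bas (broot a h)).

Lemma graft1_node s a ts :
  graft1 s (Node a ts) = bas (broot a (forest_of (s ++ ts))) + lbroot a (graft s ts).
Proof.
rewrite /graft1 graft_tree_node big_cons big_map -broot_of; congr (_ + _).
by rewrite /lbroot linear_sum; apply: eq_bigr => r _; rewrite /= lextU broot_of.
Qed.

Lemma graft_cons s t ts : graft s (t :: ts) =
  graft1 s t * bas (forest_of ts) + bas (forest_of [:: t]) * graft s ts.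
Proof.
rewrite /graft /= big_cat !big_map /= /graft1 mulr_suml mulr_sumr.
congr (_ + _); apply: eq_bigr => r _; by rewrite mulUU -forest_of_cons.
Qed.

Lemma forest_of_cat s ts : forest_of (s ++ ts) = mmul (forest_of s) (forest_of ts).
Proof. by rewrite /mmul /= fmul_of. Qed.

Lemma graft_nil s : graft s [::] = 0. Proof. exact: big_nil. Qed.

Lemma graft_cat s ts1 ts2 : graft s (ts1 ++ ts2) =
  graft s ts1 * bas (forest_of ts2) + bas (forest_of ts1) * graft s ts2.
Proof.
elim: ts1 => [|t ts1 IH]; first by rewrite graft_nil mul0r add0r -malg1E mul1r.
rewrite cat_cons !graft_cons IH forest_of_cat [forest_of (t :: ts1)]forest_of_cons -!mulUU.
ring.
Qed.

(** Grafting is computed on planar representatives. By [graft_cat] it obeys the Leibniz rule with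
    values in a commutative algebra, hence the order of the branches is irrelevant and it descends
    to forests. *)
Lemma graft_perm s ts1 ts2 : perm_eq ts1 ts2 -> graft s ts1 = graft s ts2.
Proof.
elim: ts1 ts2 => [|t ts1 IH] ts2 perm12.
  by move: perm12; rewrite perm_sym => /perm_nilP ->.
have tin : t \in ts2 by rewrite -(perm_mem perm12) mem_head.
case/path.splitPr: tin perm12 => l1 l2 perm12.
have perm1 : perm_eq ts1 (l1 ++ l2).
  by rewrite -(perm_cons t) (perm_trans perm12) // -cat1s perm_catCA.
have E : forest_of ts1 = forest_of (l1 ++ l2) by exact/eq_forest_of/canons_perm.
rewrite graft_cons (IH _ perm1) E !graft_cat graft_cons !forest_of_cat.
rewrite [forest_of (t :: l2)]forest_of_cons -!mulUU; ring.
Qed.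

Lemma forest_of_map_canon ts : forest_of (map (@canon A) ts) = forest_of ts.
Proof.
apply: eq_forest_of; rewrite /canons -map_comp; congr sort.
by apply: eq_map => t; rewrite /comp canonK.
Qed.

Lemma graft_map_canon s ts :
  all_prop (fun t => graft1 s (canon t) = graft1 s t) ts ->
  graft s (map (@canon A) ts) = graft s ts.
Proof.
elim: ts => [|t ts IH] // [Et /IH {}IH]; rewrite map_cons !graft_cons IH Et.
by rewrite forest_of_map_canon (forest_of_map_canon [:: t]).
Qed.

Lemma graft1_canon s t : graft1 s (canon t) = graft1 s t.
Proof.
elim/ptree_rect': t => a us IH.
rewrite -[canon _]/(Node a (canons us)) !graft1_node.
rewrite (graft_perm s (permEl (perm_sort _ _))) graft_map_canon // !forest_of_cat.
by rewrite (eq_forest_of (canonsK us)).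
Qed.

Lemma graft_canons s ts : graft s (canons ts) = graft s ts.
Proof.
rewrite (graft_perm s (permEl (perm_sort _ _))) graft_map_canon //.
by elim: ts => // t ts IH; split=> //; exact: graft1_canon.
Qed.

(** [graft h g], without the normalisation of [gtop_forest]: a derivation in [g]. *)
Definition fgraft h g : H := graft (trees h) (trees g).

Lemma fgraft1 h : fgraft h mone = 0. Proof. exact: graft_nil. Qed.

Lemma fgraftM h g1 g2 :
  fgraft h (mmul g1 g2) = fgraft h g1 * bas g2 + bas g1 * fgraft h g2.
Proof.
have -> : mmul g1 g2 = forest_of (trees g1 ++ trees g2) by [].
by rewrite /fgraft graft_canons graft_cat !forest_ofK.
Qed.

Lemma fgraft_broot h a g :
  fgraft h (broot a g) = bas (broot a (mmul h g)) + lbroot a (fgraft h g).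
Proof.
rewrite /fgraft trees_broot graft_cons graft_nil mulr0 addr0 -malg1E mulr1.
by rewrite graft1_node forest_of_cat !forest_ofK.
Qed.

Definition tgraft (k l : F * F) : HH :=
  lext (fun r => bas (mmul k.1 l.1, r) : HH) (fgraft k.2 l.2).
Definition lgraft h (l : F * F) : HH := lext (fun r => bas (r, l.2) : HH) (fgraft h l.1).

(** The left factor of the coproduct is the pruned part, the right factor the trunk. Let h be
    grafted at a node v of g and cut the result. If v stays in the trunk of g, then h is cut as well
    and its trunk remains grafted at v: this is [tgraft]. If v is pruned, all of h goes with it:
    this is [lgraft]. *)
Lemma cop_fgraft h g : lext cop (fgraft h g) =
  lext (fun k => lext (tgraft k) (cop g)) (cop h) + lext (lgraft h) (cop g).
Proof.
rewrite lext_exchange -lextDf.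
elim/forest_rect_mul: g => [|a g IH|g1 g2 IH1 IH2].
- rewrite fgraft1 linear0 cop1 one_lext /lgraft fgraft1 linear0 addr0.
  rewrite (eq_lext (g := fun=> 0)) ?lext0f // => k.
  by rewrite /tgraft fgraft1 linear0.
- rewrite fgraft_broot linearD /= lextU /lbroot lext_lext.
  rewrite (eq_lext (g := fun k => lext (fun l => bas (l.1, broot a l.2) : HH) (cop k) +
            bas (broot a k, mone))); last by move=> k; rewrite lextU cop_broot.
  rewrite lextDf -lext_lext IH lext_lext !cop_broot linearD /= !lextU !lext_lext.
  rewrite copM lextM2.
  rewrite [X in _ = _ + (X + _)](eq_lext (g := fun=> 0)); last first.
    by move=> k; rewrite /tgraft fgraft1 linear0.
  rewrite lext0f add0r /lgraft /= fgraft_broot linearD /= lextU /lbroot lext_lext.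
  rewrite addrACA addrC -!addrA [RHS]addrC -!addrA; congr (_ + _); congr (_ + _).
    by apply: eq_lext => r; rewrite lextU.
  rewrite -/(lext _ _) lext_exchange -lextDf; apply: eq_lext => l.
  rewrite linearD /= [RHS]lextU addrA; congr (_ + _); last first.
    by rewrite lext_lext; apply: eq_lext => r; rewrite lextU.
  rewrite lext_lext -lextDf; apply: eq_lext => k.
  rewrite /tgraft /= fgraft_broot linearD /= lextU /lbroot !lext_lext.
  by congr (_ + _); apply: eq_lext => r; rewrite !lextU.
- have E k l : lext (tgraft^~ (mmul k l)) (cop h) + lgraft h (mmul k l) =
    (lext (tgraft^~ k) (cop h) + lgraft h k) * bas l +
    bas k * (lext (tgraft^~ l) (cop h) + lgraft h l).
    rewrite mulrDl mulrDr addrACA; congr (_ + _).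
      rewrite mul_lextl mul_lextr -lextDf; apply: eq_lext => j.
      rewrite /tgraft /= fgraftM linearD /= -[fgraft j.2 k.2]lext_id.
      rewrite -[fgraft j.2 l.2]lext_id mul_lextl mul_lextr !lext_lext.
      rewrite mul_lextl mul_lextr; congr (_ + _); apply: eq_lext => r.
        by rewrite !mulUU !lextU mulUU; congr bas; apply/pair_equal_spec; split=> //; exact: mulmA.
      by rewrite !mulUU !lextU mulUU; congr bas; apply/pair_equal_spec; split=> //; exact: Monoid.mulmCA.
    rewrite /lgraft /= fgraftM linearD /= -[fgraft h k.1]lext_id.
    rewrite -[fgraft h l.1]lext_id mul_lextl mul_lextr !lext_lext.
    rewrite mul_lextl mul_lextr; congr (_ + _); apply: eq_lext => r.
      by rewrite !mulUU !lextU mulUU.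
    by rewrite !mulUU !lextU mulUU.
  rewrite fgraftM linearD /= (lext_copM (fgraft h g1)) (lext_copM (bas g1)) !lextU.
  rewrite IH1 IH2 copM; apply: esym; apply: etrans (lext_deriv2 _ _ E) _.
  by rewrite !lext_id.
Qed.

End Grafting.

(** * Grafting onto primitive elements and partial evaluations of the coproduct *)

Section PrimitiveGrafting.
Variables (R : realType) (A : finType).
Local Notation F := (forest A).
Local Notation H := {malg R[F]}.
Local Notation HH := {malg R[(F * F)%type]}.
Implicit Types (h g : F) (x y p : H) (w z : HH).
Local Notation cop := (@cop R A).

Lemma fgraft_nodes h g :
  on_supp (fun k => nodes k = nodes h + nodes g)%N (fgraft R h g).
Proof.
elim/forest_rect_mul: g => [|a g IH|g1 g2 IH1 IH2].
- by rewrite fgraft1; apply: on_supp0.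
- rewrite fgraft_broot; apply: on_suppD.
    by apply: on_suppU; rewrite !nodes_broot nodesM addnS.
  apply: (on_supp_lext IH) => k kh; apply: on_suppU.
  by rewrite !nodes_broot kh addnS.
- rewrite fgraftM; apply: on_suppD.
    rewrite -[fgraft R h g1]lext_id mul_lextl; apply: (on_supp_lext IH1) => k kh.
    by rewrite mulUU; apply: on_suppU; rewrite !nodesM kh addnA.
  rewrite -[fgraft R h g2]lext_id mul_lextr; apply: (on_supp_lext IH2) => k kh.
  by rewrite mulUU; apply: on_suppU; rewrite !nodesM kh addnCA.
Qed.

Lemma gtop_forestE h g : gtop_forest R h g = (nodes g)%:R^-1 *: fgraft R h g.
Proof.
by rewrite /gtop_forest /fgraft /graft; congr (_ *: _); apply: eq_bigr => r _; rewrite basE.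
Qed.

(** This is h \top p; the arguments are exchanged because p is kept fixed while h is extended
    linearly. *)
Definition gt p h : H := lext (@gtop_forest R A h) p.

Lemma gtopE x p : gtop x p = lext (gt p) x.
Proof.
rewrite /gtop /gt lext.unlock; apply: eq_bigr => h _; rewrite scaler_sumr.
by apply: eq_bigr => g _; rewrite scalerA.
Qed.

Lemma gt_nodes n p h : on_supp (fun k => nodes k = n) p ->
  on_supp (fun k => nodes k = nodes h + n)%N (gt p h).
Proof.
move=> pn; apply: (on_supp_lext pn) => g gn; rewrite gtop_forestE.
by apply: on_suppZ => k /fgraft_nodes; rewrite gn.
Qed.

Lemma gt_mone p : p@_mone = 0 -> gt p mone = p.
Proof.
move=> p0; rewrite -[RHS]lext_id; apply: eq_in_lext => h hp.
rewrite gtop_forest1 ?basE // lt0n nodes_eq0.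
by apply: contraTneq hp => ->; rewrite -mcoeff_neq0 p0 eqxx.
Qed.

Lemma gt_sum h (s : seq H) (c : H -> R) :
  gt (\sum_(p <- s) c p *: p) h = \sum_(p <- s) c p *: gt p h.
Proof. by rewrite /gt linear_sum; apply: eq_bigr => p _; rewrite linearZ. Qed.

Definition embl : H -> HH := lext (fun r => bas (r, mone) : HH).
Definition embr h : H -> HH := lext (fun r => bas (h, r) : HH).

HB.instance Definition _ := GRing.Linear.on embl.
HB.instance Definition _ h := GRing.Linear.on (embr h).

Lemma tensx1 x : tens x 1 = embl x.
Proof. by rewrite tensE malg1E; apply: eq_lext => h; rewrite lextU. Qed.

Lemma tens1x x : tens 1 x = embr mone x.
Proof. by rewrite tensE malg1E lextU. Qed.

Lemma primitiveE x : primitive x <->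
  x@_mone = 0 /\ lext cop x = embl x + embr mone x.
Proof. by rewrite /primitive /= coprodEl tensx1 tens1x. Qed.

(** Insert Delta p = p (x) 1 + 1 (x) p into [cop_fgraft]: grafting onto the empty forest gives 0, so
    one summand survives in each sum. Homogeneity turns the normalisation of \top into a single
    scalar. *)
Lemma cop_gt_homogeneous p h : primitive p -> homogeneous p ->
  lext cop (gt p h) = embl (gt p h) + lext (fun k => embr k.1 (gt p k.2)) (cop h).
Proof.
move=> /primitiveE[_ copp] homp.
have gtE k : gt p k = (hdeg p)%:R^-1 *: lext (fgraft R k) p.
  rewrite -lextZf; apply: eq_in_lext => g /homp gp.
  by rewrite gtop_forestE gp.
rewrite gtE !linearZ /=.
rewrite [X in _ = _ + X](eq_lext
  (g := fun k => (hdeg p)%:R^-1 *: embr k.1 (lext (fgraft R k.2) p))); last first.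
  by move=> k; rewrite gtE linearZ.
rewrite lextZf -scalerDr; congr (_ *: _).
rewrite lext_lext; under eq_lext do rewrite cop_fgraft.
rewrite lextDf addrC -lext_lext copp; congr (_ + _).
  rewrite linearD /= /embl /embr !lext_lext [X in _ + X](eq_lext (g := fun=> 0)).
    by rewrite lext0f addr0; apply: eq_lext => g; rewrite lextU.
  by move=> g; rewrite lextU /lgraft fgraft1 linear0.
rewrite lext_exchange; apply: eq_lext => k.
rewrite -lext_lext copp linearD /= /embl /embr !lext_lext.
rewrite [X in X + _](eq_lext (g := fun=> 0)).
  rewrite lext0f add0r; apply: eq_lext => g; rewrite lextU /tgraft.
  by apply: eq_lext => r; rewrite mulm1.
by move=> g; rewrite lextU /tgraft fgraft1 linear0.
Qed.

(** The partial evaluation [(h^* (x) id) Delta y]. *)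
Definition dl h y : H := lext (fun k => (k.1 == h)%:R *: bas k.2 : H) (lext cop y).

Lemma dl_is_linear h : linear (dl h).
Proof. by move=> c x y; rewrite /dl !linearP. Qed.
HB.instance Definition _ h := GRing.isLinear.Build R H H _ (dl h) (dl_is_linear h).

Lemma dl_embl h x : lext (fun k => (k.1 == h)%:R *: bas k.2 : H) (embl x) = x@_h *: bas mone.
Proof.
rewrite lext_lext -lext_delta; apply: eq_lext => k; by rewrite lextU.
Qed.

Lemma dl_embr h k x : lext (fun k => (k.1 == h)%:R *: bas k.2 : H) (embr k x) = (k == h)%:R *: x.
Proof.
rewrite lext_lext -[in RHS](lext_id x) -lextZf; apply: eq_lext => r; by rewrite lextU.
Qed.

(** A left factor h leaves no node for the right factor, and by the counit the only term of Delta k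
    with empty right factor is k (x) 1. *)
Lemma dl_top h k : (nodes k <= nodes h)%N -> dl h (bas k) = (k == h)%:R *: bas mone.
Proof.
move=> kh; rewrite /dl lextU.
transitivity (lext (fun l => (l == h)%:R *: bas mone : H)
    (lext (fun l => (l.2 == mone)%:R *: bas l.1 : H) (cop k))).
  rewrite lext_lext; apply: eq_in_lext => l /cop_nodes lk.
  rewrite linearZ /= lextU; case: eqVneq => [l1h|_]; last by rewrite !scale0r scaler0.
  have /eqP -> : l.2 == mone by rewrite -nodes_eq0 -leqn0 -(leq_add2l (nodes h)) addn0 -[X in (nodes X + _)%N]l1h lk.
  by rewrite eqxx !scale1r.
by rewrite counitr lextU.
Qed.

Lemma dl_mone y : dl mone y = y.
Proof.
rewrite /dl lext_lext -[RHS]lext_id; apply: eq_lext => k; exact: counitl.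
Qed.

Lemma counit_lcop y : lext (fun k => (k.2 == mone)%:R *: bas k.1 : H) (lext cop y) = y.
Proof. by rewrite lext_lext -[RHS]lext_id; apply: eq_lext => k; exact: counitr. Qed.

Lemma coeff_dl h y g : (dl h y)@_g = (lext cop y)@_(h, g).
Proof.
rewrite coeff_lext -[in RHS](lext_id (lext cop y)) coeff_lext; apply: eq_lext => -[k l] /=.
by rewrite mcoeffZ !coeff_bas xpair_eqE; case: eqP => _; rewrite ?mul1r ?mul0r.
Qed.

Lemma coeff_dl1 h y : (dl h y)@_mone = y@_h.
Proof.
rewrite -[in RHS](counit_lcop y) !coeff_lext; apply: eq_lext => k.
by rewrite !mcoeffZ !coeff_bas mulrC.
Qed.

End PrimitiveGrafting.

(** * Independence and generation for iterated grafting products *)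

Section TopBasis.
Variables (R : realType) (A : finType).
Local Notation F := (forest A).
Local Notation H := {malg R[F]}.
Local Notation HH := {malg R[(F * F)%type]}.
Variable P : set H.
Hypothesis HP : primitive_basis P.
Implicit Types (h g : F) (x y p q : H) (w z : HH).
Local Notation cop := (@cop R A).

Lemma Pprim p : P p -> primitive p. Proof. by case: HP => -[+ _ _] _; exact. Qed.
Lemma Phom p : P p -> homogeneous p. Proof. by case: HP => _; exact. Qed.
Lemma P_mone p : P p -> p@_mone = 0. Proof. by move=> /Pprim[]. Qed.

Lemma Pfree (s : seq H) (c : H -> R) : uniq s -> (forall p, p \in s -> P p) ->
  \sum_(p <- s) c p *: p = 0 -> forall p, p \in s -> c p = 0.
Proof. by case: HP => -[_ + _] _; exact. Qed.

Lemma Pspan x : primitive x -> exists s (c : H -> R),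
  (forall p, p \in s -> P p) /\ x = \sum_(p <- s) c p *: p.
Proof. by case: HP => -[_ _ +] _; exact. Qed.

Lemma P_neq0 p : P p -> p != 0.
Proof.
move=> Pp; apply/eqP => p0.
have := @Pfree [:: p] (fun=> 1); rewrite big_seq1 p0 scaler0 /=.
have H1 : forall q : H, q \in [:: 0] -> P q by move=> q; rewrite inE => /eqP ->; rewrite -p0.
by move=> /(_ isT H1 erefl 0); rewrite mem_head => /(_ isT) /eqP; rewrite oner_eq0.
Qed.

Lemma cop_gt b h : primitive b ->
  lext cop (gt b h) = embl (gt b h) + lext (fun k => embr k.1 (gt b k.2)) (cop h).
Proof.
move=> /Pspan[s [c [sP ->]]]; rewrite gt_sum !linear_sum /=.
rewrite [X in _ = _ + X](eq_lext
  (g := fun k => \sum_(p <- s) c p *: embr k.1 (gt p k.2))); last first.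
  by move=> k; rewrite gt_sum linear_sum; apply: eq_bigr => p _; rewrite linearZ.
rewrite lext_sumf -big_split /=; apply: eq_big_seq => p ps.
by rewrite !linearZ /= -scalerDr cop_gt_homogeneous //; [exact/Pprim/sP|exact/Phom/sP].
Qed.

Lemma dl_gt b h k : primitive b ->
  dl h (gt b k) = (gt b k)@_h *: bas mone + lext (gt b) (dl h (bas k : H)).
Proof.
move=> Pb; rewrite /dl cop_gt // linearD /= dl_embl; congr (_ + _).
rewrite lextU !lext_lext; apply: eq_lext => l.
by rewrite dl_embr linearZ /= lextU.
Qed.

(** Apply h^* to the first factor of the coproduct of the relation, for h of the highest degree
    occurring in the x p. Up to multiples of the empty forest there remains the combination of the p
    with coefficients [(x p)@_h], so freeness of [P] removes the highest degree. *)
Lemma gt_free (s : seq H) (x : H -> H) : uniq s -> (forall p, p \in s -> P p) ->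
  \sum_(p <- s) lext (gt p) (x p) = 0 -> forall p, p \in s -> x p = 0.
Proof.
move=> us sP sum0.
suff main m : (forall p, p \in s -> on_supp (fun h => nodes h < m)%N (x p)) ->
    forall p, p \in s -> x p = 0.
  apply: (main (\max_(p <- s) hdeg (x p)).+1) => p ps h hx; rewrite ltnS.
  have le1 : (nodes h <= hdeg (x p))%N.
    by rewrite /hdeg (big_rem _ hx) /= leq_maxl.
  by apply: leq_trans le1 _; rewrite (big_rem _ ps) /= leq_maxl.
elim: m => [|m IH] xm.
  move=> p ps; apply/malgP => h; rewrite mcoeff0; apply: contraTeq isT.
  by rewrite mcoeff_neq0 => /(xm _ ps).
apply: IH => p ps h hx; rewrite ltn_neqAle -ltnS (xm _ ps) // andbT.
apply: contraTneq hx => hm; rewrite -mcoeff_neq0 negbK; apply/eqP.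
apply: (@Pfree s (fun p => (x p)@_h)) => //.
have /(congr1 (dl h)) := sum0; rewrite linear_sum linear0 /= => dl0; rewrite -[RHS]dl0.
have E q : q \in s -> dl h (lext (gt q) (x q)) =
    (lext (gt q) (x q))@_h *: bas mone + (x q)@_h *: q.
  move=> qs; rewrite lext_comp coeff_lext.
  transitivity (lext (fun k => ((gt q k)@_h : R^o) *: (bas mone : H)) (x q) +
      lext (fun k => (k == h)%:R *: q) (x q)).
    rewrite -lextDf; apply: eq_in_lext => k kx /=; rewrite dl_gt; last exact/Pprim/sP.
    congr (_ + _); rewrite dl_top; last by rewrite hm -ltnS; exact: (xm _ qs).
    by rewrite linearZ /= lextU gt_mone //; exact/P_mone/sP.
  by rewrite [X in _ + X]lext_delta lext_scalel.
transitivity (\sum_(q <- s) (lext (gt q) (x q))@_h *: (bas mone : H) +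
    \sum_(q <- s) (x q)@_h *: q); last by rewrite -big_split; apply/esym/eq_big_seq.
(* The multiples of the empty forest add up to the h-coefficient of the vanishing sum itself. *)
have sum0h : \sum_(q <- s) (lext (gt q) (x q))@_h = 0.
  by rewrite -(raddf_sum (mcoeff h)) sum0 raddf0.
have sum0m : \sum_(q <- s) (lext (gt q) (x q))@_h *: (bas mone : H) = 0.
  by rewrite -[LHS]scaler_suml sum0h scale0r.
by rewrite [X in _ = X + _]sum0m add0r.
Qed.

(** By coassociativity the coproduct of [dl h y] is h^* applied to the first factor of (Delta (x)
    id) Delta y. Left factors of Delta y with more nodes than h have an empty right factor by
    hypothesis, and contribute w (x) 1. Among the others only h itself contributes, by [dl_top], and
    yields 1 (x) [dl h y]. *)
Lemma dl_primitive y h :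
  (forall g, (nodes h < nodes g)%N -> dl g y = y@_g *: bas mone) ->
  primitive (dl h y - y@_h *: bas mone).
Proof.
move=> hy; apply/primitiveE.
set b := dl h y - _.
have b0 : b@_mone = 0 by rewrite mcoeffB mcoeffZ coeff_dl1 coeff_bas eqxx mulr1 subrr.
pose w : H := lext (fun k => (nodes h < nodes k.1)%:R *: dl h (bas k.1 : H)) (lext cop y).
have copd : lext cop (dl h y) = embl w + embr mone (dl h y).
  pose G (l : F * (F * F)) : HH := (l.1 == h)%:R *: bas l.2.
  transitivity (lext G (lext (@cop_r R A) (lext cop y))).
    rewrite /dl !lext_lext; apply: eq_lext => g; apply: eq_lext => k; rewrite linearZ /= lextU /cop_r lext_lext.
    by rewrite -[cop k.2]lext_id -lextZf lext_id; apply: eq_lext => l; rewrite lextU.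
  have -> : lext (@cop_r R A) (lext cop y) = lext (@cop_l R A) (lext cop y).
    by rewrite !lext_lext; apply: eq_lext => g; rewrite coassoc.
  rewrite /embr [dl h y]/dl !(lext_lext _ _ (lext cop y)).
  rewrite [embl w]/embl /w (lext_lext _ _ (lext cop y)) -lextDf.
  apply: eq_in_lext => k kz; rewrite !linearZ /= !lextU.
  have [hk|hk] := ltnP (nodes h) (nodes k.1).
    have k2 : k.2 = mone.
      have ck : (dl k.1 y)@_k.2 != 0 by rewrite coeff_dl -surjective_pairing mcoeff_neq0.
      apply/eqP; apply: contraNT ck => k2.
      by rewrite hy // mcoeffZ coeff_bas [mone == _]eq_sym (negPf k2) mulr0.
    have /negPf -> : k.1 != h by apply: contraTneq hk => ->; rewrite ltnn.
    rewrite scale0r addr0 scale1r /cop_l /dl !lextU !lext_lext.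
    apply: eq_lext => l; rewrite !lextU linearZ /= lextU k2 //.
  rewrite scale0r add0r /cop_l lext_lext.
  transitivity (lext (fun r => bas (r, k.2) : HH) (dl h (bas k.1))).
    by rewrite /dl lextU lext_lext; apply: eq_lext => l; rewrite !lextU linearZ /= lextU.
  by rewrite dl_top // linearZ /= lextU.
have copb : lext cop b = embl w + embr mone b.
  have c1 : lext cop (bas mone) = embr mone (bas mone : H).
    by rewrite lextU /embr lextU cop1 malg1E.
  rewrite /b [in LHS]linearB [in LHS]linearZ [in RHS]linearB.
  by rewrite [in RHS]linearZ /= c1 copd addrA.
(* The right counit applied to the coproduct of b returns b, and reads the right-hand side as w
   because b has no constant term. *)
suff wb : w = b by rewrite copb wb.
clear copd; clearbody w.
rewrite -[RHS]counit_lcop copb linearD /= /embl /embr !lext_lext.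
rewrite [X in _ = _ + X](eq_lext (g := fun k => (k == mone)%:R *: bas mone)); last first.
  by move=> k; rewrite lextU.
rewrite lext_delta b0 scale0r addr0 -[LHS]lext_id. apply: eq_lext => k.
by rewrite lextU eqxx scale1r.
Qed.

End TopBasis.

Section TopSpan.
Variables (R : realType) (A : finType).
Local Notation F := (forest A).
Local Notation H := {malg R[F]}.
Local Notation HH := {malg R[(F * F)%type]}.
Variable P : set H.
Hypothesis HP : primitive_basis P.
Implicit Types (h g : F) (x y p q rho sigma tau : H) (w z : HH).

Lemma forest_seq n : exists s : seq F, uniq s /\ forall h, (h \in s) = (nodes h <= n)%N.
Proof.
have [s sE] := (finite_seqP _).1 (@finite_forest_le A n).
exists (undup s); split=> [|h]; first exact: undup_uniq.
rewrite mem_undup; apply/idP/idP => hs.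
  by have : [set` s] h by []; rewrite -sE.
by have : forest_le n h by []; rewrite sE.
Qed.

(** Products with at most n - 1 factors. The recursion peels off the last factor, which is
    primitive, so that the formulas for [gt] apply. *)
Fixpoint Ptop_upto n : set H :=
  if n is n'.+1 then
    [set rho | rho = 1 \/ exists tau q, [/\ Ptop_upto n' tau, P q & rho = gtop tau q]]
  else set0.

Lemma Ptop_uptoS n rho : Ptop_upto n rho -> Ptop_upto n.+1 rho.
Proof.
elim: n rho => // n IH rho [->|[tau [q [/IH tn Pq ->]]]]; first by left.
by right; exists tau, q.
Qed.

Lemma Ptop_upto_le m n rho : (m <= n)%N -> Ptop_upto m rho -> Ptop_upto n rho.
Proof.
move=> /subnK <-; elim: (n - m)%N => // k IH /IH; exact: Ptop_uptoS.
Qed.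

Lemma gtop1p p : P p -> gtop 1 p = p.
Proof. by move=> Pp; rewrite gtopE malg1E lextU gt_mone //; exact: (P_mone HP). Qed.

Lemma PtopE rho : Ptop P rho <-> exists n, Ptop_upto n rho.
Proof.
split.
  case=> [->|[p [ps [Pp Pps ->]]]]; first by exists 1%N; left.
  elim/last_ind: ps Pps => [|ps q IH] Pps.
    exists 2%N; right; exists 1, p; split=> //=; first by left.
    by rewrite gtop1p.
  have [|n tn] := IH; first by move=> r rp; apply: Pps; rewrite mem_rcons inE rp orbT.
  exists n.+1; right; exists (foldl (@gtop R A) p ps), q; split=> //.
    by apply: Pps; rewrite mem_rcons mem_head.
  by rewrite foldl_rcons.
case=> n; elim: n rho => // n IH rho [->|[tau [q [/IH tt Pq ->]]]]; first by left.
right; case: tt => [->|[p [ps [Pp Pps ->]]]].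
  by exists q, [::]; split=> //; rewrite gtop1p.
exists p, (rcons ps q); split=> //; last by rewrite foldl_rcons.
by move=> r; rewrite mem_rcons inE => /orP[/eqP ->|/Pps].
Qed.

Lemma Ptop1 : Ptop P 1. Proof. by left. Qed.

Lemma Ptop_gtop tau q : Ptop P tau -> P q -> Ptop P (gtop tau q).
Proof.
move=> /PtopE[n tn] Pq; apply/PtopE; exists n.+1; right.
by exists tau, q.
Qed.

Lemma PtopP p : P p -> Ptop P p.
Proof. by move=> Pp; rewrite -(gtop1p Pp); apply: Ptop_gtop => //; exact: Ptop1. Qed.

Lemma Ptop_ind (Q : H -> Prop) : Q 1 ->
  (forall tau q, Ptop P tau -> P q -> Q tau -> Q (gtop tau q)) ->
  forall rho, Ptop P rho -> Q rho.
Proof.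
move=> Q1 QT rho /PtopE[n]; elim: n rho => // n IH rho [-> //|[tau [q [tn Pq ->]]]].
by apply: QT => //; [apply/PtopE; exists n|exact: IH].
Qed.

(** [{malg R[H]}] is free on the underlying set of [H]: its elements are formal combinations of
    elements of [H], and linear independence of [Ptop] becomes injectivity of [ev]. *)
Definition ev (c : {malg R[H]}) : H := lext (fun rho : H => rho : H) c.

Lemma ev_is_linear : linear ev.
Proof. by move=> a c d; rewrite /ev linearP. Qed.
HB.instance Definition _ := GRing.isLinear.Build R {malg R[H]} H _ ev ev_is_linear.

Definition span_Ptop y := exists2 c : {malg R[H]}, on_supp (Ptop P) c & y = ev c.

Lemma span_PtopD x y : span_Ptop x -> span_Ptop y -> span_Ptop (x + y).
Proof.
move=> [c cP ->] [d dP ->]; exists (c + d); first exact: on_suppD.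
by rewrite linearD.
Qed.

Lemma span_PtopZ a x : span_Ptop x -> span_Ptop (a *: x).
Proof.
move=> [c cP ->]; exists (a *: c); first exact: on_suppZ.
by rewrite linearZ.
Qed.

Lemma span_Ptop_elt rho : Ptop P rho -> span_Ptop rho.
Proof.
by move=> Pr; exists (bas rho); [exact: on_suppU|rewrite /ev lextU].
Qed.

Lemma span_Ptop_sum (I : eqType) (s : seq I) (f : I -> H) :
  (forall i, i \in s -> span_Ptop (f i)) -> span_Ptop (\sum_(i <- s) f i).
Proof.
elim: s => [|i s IH] fs.
  by rewrite big_nil; exists 0; [exact: on_supp0|rewrite linear0].
rewrite big_cons; apply: span_PtopD; first by apply: fs; rewrite mem_head.
by apply: IH => j js; apply: fs; rewrite inE js orbT.
Qed.

Lemma span_Ptop_lext (K : choiceType) (f : K -> H) (z : {malg R[K]}) :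
  (forall k, k \in msupp z -> span_Ptop (f k)) -> span_Ptop (lext f z).
Proof.
rewrite lext.unlock => fz; apply: span_Ptop_sum => k kz.
exact/span_PtopZ/fz.
Qed.

Lemma span_Ptop_gt b h : primitive b -> span_Ptop (bas h) -> span_Ptop (gt b h).
Proof.
move=> /(Pspan HP)[s [d [sP ->]]] [c cP hc]; rewrite gt_sum.
apply: span_Ptop_sum => p ps; apply: span_PtopZ.
have -> : gt p h = lext (gt p) (ev c) by rewrite -hc lextU.
rewrite /ev lext_lext; apply: span_Ptop_lext => tau ctau; rewrite -gtopE; apply: span_Ptop_elt.
by apply: Ptop_gtop; [exact: cP|exact: sP].
Qed.

(** From degree m on, all partial evaluations of y are constants. One degree below, the nonconstant
    parts b h of [dl h y] are primitive by [dl_primitive]; subtracting the sum of the h \top b h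
    cancels them and lowers the threshold. At threshold 0 the element y is itself a constant. *)
Lemma span_Ptop_step n y :
  (forall h, (nodes h < n)%N -> span_Ptop (bas h)) ->
  forall m, (m <= n)%N ->
  (forall h, (m <= nodes h)%N -> dl h y = y@_h *: bas mone) -> span_Ptop y.
Proof.
move=> spann m; elim: m y => [|m IH] y mn hy.
  rewrite -(dl_mone y) hy //; apply: span_PtopZ; rewrite -malg1E.
  exact/span_Ptop_elt/Ptop1.
pose b h := dl h y - y@_h *: bas mone.
have Pb h : nodes h = m -> primitive (b h).
  by move=> hm; rewrite /b; apply: dl_primitive => g; rewrite hm => /hy.
have [s [us sE]] := forest_seq m.
pose s' := [seq h <- s | nodes h == m].
have s'E h : (h \in s') = (nodes h == m).
  by rewrite mem_filter sE; case: eqP => // ->; rewrite leqnn.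
pose v := \sum_(h <- s') gt (b h) h.
have -> : y = (y - v) + v by rewrite subrK.
apply: span_PtopD; last first.
  apply: span_Ptop_sum => h; rewrite s'E => /eqP hm; apply: span_Ptop_gt; first exact: Pb.
  by apply: spann; rewrite hm.
apply: IH => [|k mk]; first exact: ltnW.
have dv : dl k v = v@_k *: bas mone + (nodes k == m)%:R *: b k.
  rewrite /v linear_sum raddf_sum scaler_suml.
  transitivity (\sum_(h <- s') ((gt (b h) h)@_k *: (bas mone : H) + (h == k)%:R *: b h)).
    apply: eq_big_seq => h; rewrite s'E => /eqP hm /=; rewrite (dl_gt HP); last exact: Pb.
    congr (_ + _); rewrite dl_top ?hm // linearZ /= lextU gt_mone //.
    by case: (Pb _ hm).
  rewrite big_split /=; congr (_ + _); rewrite -s'E.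
  have [ks|ks] := boolP (k \in s').
    rewrite (bigD1_seq k) ?filter_uniq //= eqxx big1 ?addr0 // => h /negPf ->.
    by rewrite scale0r.
  rewrite scale0r big_seq big1 // => h hs; case: eqVneq => [hk|_].
    by rewrite -hk hs in ks.
  by rewrite scale0r.
rewrite linearB /= dv; have [km|km] := eqVneq (nodes k) m.
  rewrite scale1r /b mcoeffB scalerBl.
  by move: (dl k y) (_ *: _) (_ *: _) => D a c; ring.
by rewrite scale0r addr0 mcoeffB scalerBl hy // ltn_neqAle eq_sym km mk.
Qed.

Lemma span_Ptop_bas h : span_Ptop (bas h).
Proof.
have [n hn] := ubnP (nodes h); elim: n h hn => // n IH h; rewrite ltnS => hn.
apply: (@span_Ptop_step (nodes h) _ _ (nodes h)) => // [g gh|k hk].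
  by apply: IH; apply: leq_trans hn.
by rewrite coeff_bas dl_top.
Qed.

End TopSpan.

Section TopFree.
Variables (R : realType) (A : finType).
Local Notation F := (forest A).
Local Notation H := {malg R[F]}.
Local Notation HH := {malg R[(F * F)%type]}.
Variable P : set H.
Hypothesis HP : primitive_basis P.
Implicit Types (h g : F) (x y p q rho sigma tau : H) (w z : HH).

Lemma hdeg_le x h : h \in msupp x -> (nodes h <= hdeg x)%N.
Proof. by move=> hx; rewrite /hdeg (big_rem _ hx) /= leq_maxl. Qed.

Lemma on_supp_hdeg n x : on_supp (fun h => nodes h = n) x -> x != 0 -> hdeg x = n.
Proof.
move=> xn x0; have [h hx] : exists h, h \in msupp x.
  apply: contrapT => nx; move/eqP: x0; apply; apply/malgP => h; rewrite mcoeff0.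
  by apply: mcoeff_outdom; apply/negP => hx; apply: nx; exists h.
apply/eqP; rewrite eqn_leq -{2}(xn _ hx) hdeg_le // andbT.
by apply/bigmax_leqP_seq => k kx _; rewrite (xn _ kx).
Qed.

Lemma on_supp_homogeneous n x : on_supp (fun h => nodes h = n) x -> homogeneous x.
Proof.
move=> xn h hx; rewrite (xn _ hx); apply/esym/on_supp_hdeg => //.
by apply: contraTneq hx => ->; rewrite msupp0.
Qed.

Lemma P_hdeg_gt0 p : P p -> (0 < hdeg p)%N.
Proof.
move=> Pp; rewrite lt0n; apply/eqP => p0; move: (P_neq0 HP Pp); apply/negP/negPn.
apply/eqP/malgP => h; rewrite mcoeff0; have [hp|] := boolP (h \in msupp p).
  have := Phom HP Pp hp; rewrite p0 => /eqP; rewrite nodes_eq0 => /eqP ->.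
  exact: (P_mone HP).
exact: mcoeff_outdom.
Qed.

Lemma gtop_mone tau q : P q -> (gtop tau q)@_mone = 0.
Proof.
move=> Pq; rewrite gtopE coeff_lext -[RHS](lext0f R^o tau); apply: eq_lext => h.
apply: mcoeff_outdom; apply/negP => /(gt_nodes (Phom HP Pq))/eqP.
by rewrite nodes1 eq_sym addn_eq0 (gtn_eqF (P_hdeg_gt0 Pq)) andbF.
Qed.

Lemma Ptop_mone rho : Ptop P rho -> rho@_mone = (rho == 1)%:R.
Proof.
elim/(Ptop_ind HP) => [|tau q _ Pq _]; first by rewrite eqxx malg1E coeff_bas eqxx.
rewrite gtop_mone //; case: eqP => // /(congr1 (mcoeff mone)).
rewrite gtop_mone // malg1E coeff_bas eqxx => /eqP.
by rewrite eq_sym oner_eq0.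
Qed.

Lemma Ptop_on_supp rho : Ptop P rho -> exists n, on_supp (fun h => nodes h = n) rho.
Proof.
elim/(Ptop_ind HP) => [|tau q _ Pq [n taun]].
  by exists 0%N; rewrite malg1E; apply: on_suppU; exact: nodes1.
exists (n + hdeg q)%N; rewrite gtopE; apply: (on_supp_lext taun) => h <-.
exact: gt_nodes (Phom HP Pq).
Qed.

Lemma Ptop_homogeneous rho : Ptop P rho -> homogeneous rho.
Proof. by move=> /Ptop_on_supp[n]; exact: on_supp_homogeneous. Qed.

(** Induction on the number of factors. Grouped by the last factor q, the relation says that a sum
    of x_q \top q vanishes; [gt_free] makes every x_q vanish, and x_q is a combination of products
    with one factor less. *)
Lemma ev_inj c : on_supp (Ptop P) c -> ev c = 0 -> c = 0.
Proof.
suff main n : forall c, on_supp (Ptop_upto P n) c -> ev c = 0 -> c = 0.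
  move=> cP evc.
  have /choice[d dP] : forall rho, exists n, rho \in msupp c -> Ptop_upto P n rho.
    move=> rho; have [/cP/(PtopE HP)[n rn]|_] := boolP (rho \in msupp c); first by exists n.
    by exists 0%N.
  apply: (main (\max_(rho <- msupp c) d rho)%N) => // rho rc.
  by apply: Ptop_upto_le (dP _ rc); rewrite (big_rem _ rc) /= leq_maxl.
elim: n => [|n IH] {}c cP evc.
  by apply/malgP => rho; rewrite mcoeff0; apply: mcoeff_outdom; apply/negP => /cP.
have PtopS rho : rho \in msupp c -> Ptop P rho.
  by move=> /cP rn; apply/(PtopE HP); exists n.+1.
(* All elements of [Ptop] other than 1 vanish on the empty forest. *)
have c1 : c@_1 = 0.
  have := congr1 (mcoeff mone) evc; rewrite /ev coeff_lext mcoeff0 => <-.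
  by rewrite -(lext_delta1 c 1); apply: eq_in_lext => rho /PtopS/Ptop_mone ->.
have /choice[f fP] : forall rho, exists tq : H * H, rho \in msupp c -> rho != 1 ->
    [/\ Ptop_upto P n tq.1, P tq.2 & rho = gtop tq.1 tq.2].
  move=> rho; have [/cP rn|_] := boolP (rho \in msupp c); last by exists (1, 1).
  case: rn => [->|[tau [q [tn Pq rE]]]]; first by exists (1, 1); rewrite eqxx.
  by exists (tau, q).
have neq1 rho : rho \in msupp c -> rho != 1.
  by apply: contraTneq => ->; rewrite -mcoeff_neq0 c1 eqxx.
pose y p : {malg R[H]} := lext (fun rho => ((f rho).2 == p)%:R *: bas (f rho).1) c.
have yP p : on_supp (Ptop_upto P n) (y p).
  rewrite /y; apply: (@on_supp_lext _ _ _ (fun rho => rho \in msupp c)) => [//|rho rc].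
  by apply: on_suppZ; apply: on_suppU; case: (fP _ rc (neq1 _ rc)).
pose s := undup [seq (f rho).2 | rho <- msupp c].
have sP p : p \in s -> P p.
  rewrite mem_undup => /mapP[rho rc ->]; by case: (fP _ rc (neq1 _ rc)).
have y0 p : p \in s -> y p = 0.
  move=> ps; apply: IH => //; apply: (gt_free HP (x := fun p => ev (y p)) (undup_uniq _) sP) ps.
  transitivity (\sum_(p <- s) 1 *: lext (fun rho => ((f rho).2 == p)%:R *: rho) c).
    apply: eq_big_seq => r rs; rewrite scale1r /ev /y !lext_lext.
    apply: eq_in_lext => rho rc; rewrite linearZ /= lextU.
    case: eqP => [<-|]; last by rewrite !scale0r.
    by rewrite -gtopE; case: (fP _ rc (neq1 _ rc)) => _ _ <-.
  rewrite -lext_sumf -[RHS]evc; apply: eq_in_lext => rho rc.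
  rewrite (bigD1_seq (f rho).2) ?undup_uniq //=; last first.
    by rewrite mem_undup; apply/mapP; exists rho.
  rewrite eqxx !scale1r [X in _ + X]big1 ?addr0 // => q /negPf pn.
  by rewrite eq_sym pn scale0r scaler0.
apply/malgP => rho; rewrite mcoeff0; have [rc|] := boolP (rho \in msupp c); last first.
  exact: mcoeff_outdom.
have /y0/(congr1 (mcoeff (f rho).1)) : (f rho).2 \in s.
  by rewrite mem_undup; apply/mapP; exists rho.
rewrite mcoeff0 /y coeff_lext => <-.
rewrite -(lext_delta1 c rho); apply: eq_in_lext => sigma sc; rewrite mcoeffZ coeff_bas.
case: eqVneq => [->|sr]; first by rewrite !eqxx mulr1.
case: eqVneq => [e2|]; last by rewrite mul0r.
case: eqVneq => [e1|]; last by rewrite mulr0.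
have [_ _ rE] := fP _ rc (neq1 _ rc); have [_ _ sE] := fP _ sc (neq1 _ sc).
by move/eqP: sr; case; rewrite sE e1 e2 -rE.
Qed.

Lemma Ptop_neq0 rho : Ptop P rho -> rho != 0.
Proof.
move=> Pr; apply/eqP => r0; have : bas rho = 0 :> {malg R[H]}.
  by apply: ev_inj; [exact: on_suppU|rewrite /ev lextU].
by move=> /(congr1 (mcoeff rho)) /eqP; rewrite coeff_bas eqxx mcoeff0 oner_eq0.
Qed.

End TopFree.

(** * The dual basis and the expansion of a functional *)

Section DualBasis.
Variables (R : realType) (A : finType).
Local Notation F := (forest A).
Local Notation H := {malg R[F]}.
Local Notation HH := {malg R[(F * F)%type]}.
Variable P : set H.
Hypothesis HP : primitive_basis P.
Implicit Types (h g : F) (x y p q rho sigma tau : H) (w z : HH).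
Local Notation cop := (@cop R A).

Definition coord h : {malg R[H]} := s2val (cid2 (span_Ptop_bas HP h)).

Lemma coord_Ptop h : on_supp (Ptop P) (coord h).
Proof. by rewrite /coord; case: cid2. Qed.

Lemma ev_coord h : ev (coord h) = bas h.
Proof. by rewrite /coord; case: cid2. Qed.

Lemma coord_elt rho : Ptop P rho -> lext coord rho = bas rho.
Proof.
move=> Pr; apply/eqP; rewrite -subr_eq0; apply/eqP/(ev_inj HP).
  apply: on_suppD; last by rewrite -scaleN1r; apply: on_suppZ; apply: on_suppU.
  apply: (@on_supp_lext _ _ _ xpredT) => [k|h _]; [by []|exact: coord_Ptop].
rewrite linearB /= /ev lext_lext lextU.
rewrite (eq_lext (g := bas)) ?lext_id ?subrr // => h; exact: ev_coord.
Qed.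

(** The basis is homogeneous, so discarding the coordinates of the wrong degree does not change the
    element they represent; coordinates being unique, nothing was discarded. *)
Lemma coord_hdeg h : on_supp (fun rho => hdeg rho = nodes h) (coord h).
Proof.
pose c : {malg R[H]} := lext (fun rho => (hdeg rho == nodes h)%:R *: bas rho) (coord h).
have cP : on_supp (fun rho => Ptop P rho /\ hdeg rho = nodes h) c.
  apply: (on_supp_lext (@coord_Ptop h)) => rho Pr; case: eqP => [rh|_].
    by apply: on_suppZ; apply: on_suppU.
  by rewrite scale0r; exact: on_supp0.
suff -> : coord h = c by move=> rho /cP[].
apply/eqP; rewrite -subr_eq0; apply/eqP/(ev_inj HP).
  apply: on_suppD; first exact: coord_Ptop.
  by rewrite -scaleN1r; apply: on_suppZ => rho /cP[].
pose pr : H -> H := lext (fun k => (nodes k == nodes h)%:R *: bas k : H).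
rewrite linearB /= ev_coord; apply/eqP; rewrite subr_eq0; apply/eqP.
transitivity (pr (ev (coord h))); first by rewrite ev_coord /pr lextU eqxx scale1r.
rewrite /pr /ev /c !lext_lext; apply: eq_in_lext => rho /coord_Ptop Pr.
rewrite linearZ /= lextU.
transitivity (lext (fun k => (hdeg rho == nodes h)%:R *: bas k : H) rho).
  by apply: eq_in_lext => k /(Ptop_homogeneous HP Pr) ->.
by rewrite lextZf lext_id.
Qed.

(** The specification in [dual_elt] has a solution in the span of forests, because only finitely
    many forests, those of the degree of rho, have a nonzero rho-coordinate. Any solution has the
    stated coefficients, because [Ptop] generates. *)
Lemma dual_eltE rho h : Ptop P rho -> (dual_elt P rho)@_h = (coord h)@_rho.
Proof.
move=> Pr; have [s [us sE]] := forest_seq A (hdeg rho).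
pose x0 : H := \sum_(k <- s) (coord k)@_rho *: bas k.
have x0E k : x0@_k = (coord k)@_rho.
  rewrite /x0 raddf_sum /=; have [ks|ks] := boolP (k \in s).
    rewrite (bigD1_seq k) //= big1 ?addr0.
      by rewrite mcoeffZ coeff_bas eqxx mulr1.
    by move=> l /negPf lk; rewrite mcoeffZ coeff_bas lk mulr0.
  rewrite big_seq big1 => [|l ls]; last first.
    rewrite mcoeffZ coeff_bas; case: eqVneq => [lk|]; last by rewrite mulr0.
    by rewrite -lk ls in ks.
  apply/esym/mcoeff_outdom/negP => /coord_hdeg dr.
  by rewrite sE -dr leqnn in ks.
have spec0 sigma : Ptop P sigma -> pairing (functional_of x0) sigma = (sigma == rho)%:R.
  move=> Ps; rewrite pairingE; transitivity ((lext coord sigma)@_rho).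
    by rewrite coeff_lext; apply: eq_lext => k; rewrite -x0E.
  by rewrite coord_elt // coeff_bas.
have : exists x, forall sigma, Ptop P sigma ->
  pairing (functional_of x) sigma = (sigma == rho)%:R by exists x0.
rewrite /dual_elt => /(xgetPex 0); set x := xget _ _ => xP.
transitivity (pairing (functional_of x) (ev (coord h))).
  by rewrite ev_coord pairingE lextU.
rewrite pairingE /ev lext_lext -lext_delta1; apply: eq_in_lext => sigma /coord_Ptop Ps.
by rewrite -pairingE xP.
Qed.

(** Expanding rho into forests and these into the basis must reproduce rho, so rho occurs among the
    coordinates of one of the finitely many forests with at most n nodes. *)
Lemma finite_Ptop_le n : finite_set [set rho | Ptop P rho /\ (hdeg rho <= n)%N].
Proof.
have [s [us sE]] := forest_seq A n.
apply: (@sub_finite_set _ _ [set` flatten [seq enum_fset (msupp (coord h)) | h <- s]]).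
  move=> rho [Pr rn] /=; apply/flatten_mapP.
  have E1 : (lext coord rho)@_rho = 1 by rewrite coord_elt // coeff_bas eqxx.
  apply: contrapT => nex; have /eqP : 1 = 0 :> R; last by rewrite oner_eq0.
  rewrite -E1 coeff_lext lext.unlock big_seq big1 // => h hr.
  rewrite [X in _ *: X]mcoeff_outdom ?scaler0 //; apply/negP => hc; apply: nex; exists h => //.
  by rewrite sE (leq_trans _ rn) // hdeg_le.
by apply/finite_seqP; eexists.
Qed.

Lemma finite_P_le n : finite_set [set p | P p /\ (hdeg p <= n)%N].
Proof.
by apply: sub_finite_set (finite_Ptop_le n) => p [/(PtopP HP)].
Qed.

(** Expanding h in the basis turns [gt q h] into a combination of elements tau \top q of the basis.
    Such an element is p = 1 \top p only if q = p and tau = 1, by [gt_free]. *)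
Lemma coord_gt p q h : P p -> P q ->
  (lext coord (gt q h))@_p = (h == mone)%:R * (q == p)%:R.
Proof.
move=> Pp Pq.
have E tau : Ptop P tau -> (gtop tau q == p) = (tau == 1) && (q == p).
  move=> Pt; apply/eqP/andP => [tq|[/eqP -> /eqP <-]]; last exact: (gtop1p HP).
  have [qp|qp] := eqVneq q p.
    split=> //; rewrite -subr_eq0; apply/eqP.
    apply: (gt_free HP (s := [:: q]) (x := fun=> tau - 1)) (mem_head _ _) => //.
      by move=> r; rewrite inE => /eqP ->.
    rewrite big_seq1 linearB /= -!gtopE (gtop1p HP) // tq qp; exact: subrr.
  have /eqP : (-1 : H) = 0.
    pose x r := if r == q then tau else (-1 : H).
    have := gt_free HP (s := [:: q; p]) (x := x); rewrite {1}/x /= inE qp.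
    move=> /(_ isT); have sP r : r \in [:: q; p] -> P r.
      by rewrite !inE => /orP[]/eqP ->.
    move=> /(_ sP); rewrite big_cons big_seq1 /x eqxx eq_sym (negPf qp).
    rewrite linearN /= -!gtopE (gtop1p HP) // tq subrr => /(_ erefl p).
    by rewrite !inE eqxx orbT eq_sym (negPf qp) => ->.
  by rewrite oppr_eq0 oner_eq0.
transitivity ((lext (fun tau => bas (gtop tau q)) (coord h))@_p).
  congr (_ @_ _); transitivity (lext coord (lext (gt q) (ev (coord h)))).
    by rewrite ev_coord lextU.
  rewrite /ev !lext_lext; apply: eq_in_lext => tau /coord_Ptop Pt.
  by rewrite -lext_lext -gtopE coord_elt //; exact: (Ptop_gtop HP).
transitivity ((coord h)@_1 * (q == p)%:R).
  rewrite coeff_lext -(lext_delta1 (coord h)) mulrC lext_scale.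
  apply: eq_in_lext => tau /coord_Ptop Pt.
  by rewrite coeff_bas E //; do 2!case: eqP => _; rewrite ?mulr0 ?mulr1.
congr (_ * _); have := congr1 (mcoeff mone) (ev_coord h).
rewrite coeff_bas /ev coeff_lext -(lext_delta1 (coord h)) => <-.
by apply: eq_in_lext => tau /coord_Ptop/(Ptop_mone HP) ->.
Qed.

Lemma Ptop_case rho : Ptop P rho ->
  rho = 1 \/ exists tau q, [/\ Ptop P tau, P q & rho = gtop tau q].
Proof.
move=> /(PtopE HP)[[|n]] // [->|[tau [q [tn Pq ->]]]]; [by left|right].
by exists tau, q; split=> //; apply/(PtopE HP); exists n.
Qed.

(** Turns the sum over [p] of the integrals against [X^p] into [X_{s,t} - 1]. *)
Lemma star_expansion (X : F -> R) n (s : seq H) h : X mone = 1 -> uniq s ->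
  (forall p, p \in s -> P p) -> (forall p, P p -> (hdeg p <= n)%N -> p \in s) ->
  (nodes h <= n)%N ->
  X h = counit R h +
    \sum_(p <- s) star (fun k => pairing X (gt p k)) (fun k => (coord k)@_p) h.
Proof.
move=> X1 us sP sall hn.
pose RHSf (k : F) : R^o := counit R k +
    \sum_(p <- s) star (fun k => pairing X (gt p k)) (fun k => (coord k)@_p) k.
transitivity (lext (X : F -> R^o) (ev (coord h))); first by rewrite ev_coord lextU.
transitivity (lext RHSf (ev (coord h))); last by rewrite ev_coord lextU.
rewrite /ev !lext_lext; apply: eq_in_lext => rho rc.
have Pr := coord_Ptop rc; have dr := coord_hdeg rc.
have starl y p : lext (fun k => star (fun k => pairing X (gt p k))
    (fun k => (coord k)@_p) k : R^o) y =
    lext (fun k => pairing X (gt p k.1) * (coord k.2)@_p : R^o) (lext cop y).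
  by rewrite lext_lext; apply: eq_lext => k; rewrite starE.
have RHSE y : lext RHSf y = y@_mone + \sum_(p <- s)
    lext (fun k => pairing X (gt p k.1) * (coord k.2)@_p : R^o) (lext cop y).
  rewrite /RHSf lextDf lext_delta1; congr (_ + _).
  transitivity (\sum_(p <- s) 1 *: lext (fun k => star (fun k => pairing X (gt p k))
    (fun k => (coord k)@_p) k : R^o) y).
    by rewrite -lext_sumf; apply: eq_lext => k; apply: eq_bigr => p _; rewrite scale1r.
  by apply: eq_bigr => p _; rewrite scale1r starl.
have coord1 p : P p -> (coord mone)@_p = 0.
  move=> Pp; apply: mcoeff_outdom; apply/negP => /coord_hdeg; rewrite nodes1.
  by move/eqP; rewrite (gtn_eqF (P_hdeg_gt0 HP Pp)).
(* The summand (. \top q) (x) 1 of the coproduct has an empty right factor, and p, of positive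
   degree, is not a coordinate of the empty forest. *)
have G0 p y : P p ->
    lext (fun k => pairing X (gt p k.1) * (coord k.2)@_p : R^o) (embl y) = 0.
  move=> Pp; rewrite lext_lext -[RHS](lext0f R^o y); apply: eq_lext => k.
  by rewrite lextU coord1 // mulr0.
rewrite RHSE; have [->|[tau [q [Pt Pq rE]]]] := Ptop_case Pr.
  rewrite malg1E !lextU coeff_bas eqxx X1 big_seq big1 ?addr0 // => p ps.
  by rewrite cop1 one_lext coord1 ?mulr0 //; exact: sP.
have qs : q \in s.
  apply: sall => //; apply: leq_trans hn; rewrite -dr.
  have /(on_supp_hdeg) -> : on_supp (fun k => nodes k = hdeg tau + hdeg q)%N rho.
  - rewrite rE gtopE; apply: (on_supp_lext (Ptop_homogeneous HP Pt)) => k <-.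
    exact: gt_nodes (Phom HP Pq).
  - exact: leq_addl.
  - exact: Ptop_neq0 HP _ Pr.
have -> : rho@_mone = 0 by rewrite rE (gtop_mone HP).
rewrite add0r; transitivity (\sum_(p <- s) (q == p)%:R * pairing X (gtop tau p)).
  rewrite (bigD1_seq q) //= eqxx mul1r big1 ?addr0 ?rE ?pairingE // => p /negPf.
  by rewrite eq_sym => ->; rewrite mul0r.
apply: eq_big_seq => p ps; have Pp := sP _ ps.
rewrite rE (gtopE tau p) (gtopE tau q) [lext cop _]lext_lext [RHS]lext_lext pairingE.
rewrite [lext X _]lext_lext lext_scale.
apply: eq_lext => k; rewrite (cop_gt HP); last exact: (Pprim HP).
rewrite [RHS]linearD /= G0 // add0r.
transitivity ((q == p)%:R * lext (fun r => lext (X : F -> R^o) (gt p r)) (bas k : H)).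
  by rewrite lextU.
(* Expanding k by the right counit writes both sides as sums over Delta k; [coord_gt] selects the
   same terms, those with empty right factor. *)
rewrite -counitr !lext_lext lext_scale; apply: eq_lext => l.
rewrite linearZ /= lextU /embr.
transitivity (lext (fun r => pairing X (gt p l.1) * (coord r)@_p : R^o) (gt q l.2)).
  rewrite -lext_scale -coeff_lext coord_gt // pairingE.
move: (lext X _) (_ == p) => a b.
  rewrite -[_ *: _]/(_%:R * a : R); ring.
by rewrite [RHS]lext_lext; apply: eq_lext => r; rewrite lextU.
Qed.

End DualBasis.

(** * Controlled paths and their remainders *)

(** Transpose of left multiplication by [phi]. *)
HB.lock Definition shift (R : realType) (A : finType) (phi : forest A -> R)
    (z : {malg R[forest A]}) : {malg R[forest A]} :=
  lext (fun k : forest A * forest A => phi k.1 *: bas k.2 : {malg R[forest A]})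
    (lext (@cop R A) z).

Section Shift.
Variables (R : realType) (A : finType).
Local Notation F := (forest A).
Local Notation H := {malg R[F]}.
Implicit Types (h g : F) (phi psi chi : F -> R) (w z : H).
Local Notation cop := (@cop R A).

Lemma shift_is_linear phi : linear (shift phi).
Proof. by move=> a x y; rewrite !shift.unlock !linearP. Qed.
HB.instance Definition _ phi := GRing.isLinear.Build R H H _ (shift phi) (shift_is_linear phi).

Lemma pairing_shift phi psi z : pairing psi (shift phi z) = pairing (star phi psi) z.
Proof.
rewrite shift.unlock !pairingE !lext_lext; apply: eq_lext => h; rewrite starE.
by apply: eq_lext => k; rewrite linearZ /= lextU.
Qed.

Definition dirac h : F -> R := functional_of << h >>.

Lemma diracE h g : dirac h g = (g == h)%:R.
Proof. by rewrite /dirac /functional_of basE coeff_bas eq_sym. Qed.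

Lemma pairing_dirac h z : pairing (dirac h) z = z@_h.
Proof. by rewrite pairingE -lext_delta1; apply: eq_lext => g; rewrite diracE. Qed.

Lemma coeff_shift phi h z : (shift phi z)@_h = pairing (star phi (dirac h)) z.
Proof. by rewrite -pairing_shift pairing_dirac. Qed.

Lemma shift_counit z : shift (counit R (A := A)) z = z.
Proof. by apply/malgP => h; rewrite coeff_shift star1f pairing_dirac. Qed.

Lemma shift_shift phi psi z : shift psi (shift phi z) = shift (star phi psi) z.
Proof.
by apply/malgP => h; rewrite !coeff_shift pairing_shift starA.
Qed.

Lemma pairingB phi z w : pairing phi (z - w) = pairing phi z - pairing phi w.
Proof. by rewrite !pairingE linearB. Qed.

Lemma pairingDf phi psi z : pairing (fun h => phi h + psi h) z = pairing phi z + pairing psi z.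
Proof. by rewrite !pairingE -lextDf. Qed.

Lemma pairingZf a phi z : pairing (fun h => a * phi h) z = a * pairing phi z.
Proof. by rewrite !pairingE lext_scale. Qed.

Lemma pairingBf phi psi z : pairing (fun h => phi h - psi h) z = pairing phi z - pairing psi z.
Proof.
rewrite pairingDf; congr (_ + _); rewrite -mulN1r -pairingZf.
by congr pairing; apply/funext => h; rewrite mulN1r.
Qed.

Lemma pairing_sumf (I : Type) (r : seq I) (f : I -> F -> R) z :
  pairing (fun h => \sum_(i <- r) f i h) z = \sum_(i <- r) pairing (f i) z.
Proof.
elim: r => [|i r IH].
  rewrite big_nil pairingE -[RHS](lext0f R^o z).
  by apply: eq_lext => h; rewrite big_nil.
by rewrite big_cons -IH -pairingDf; congr pairing; apply/funext => h; rewrite big_cons.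
Qed.

Lemma starDl phi phi' psi : star (fun h => phi h + phi' h) psi =
  fun h => star phi psi h + star phi' psi h.
Proof.
apply/funext => h; rewrite !starE -lextDf; apply: eq_lext => k; exact: mulrDl.
Qed.

Lemma starBl phi phi' psi : star (fun h => phi h - phi' h) psi =
  fun h => star phi psi h - star phi' psi h.
Proof.
rewrite starDl; apply/funext => h; congr (_ + _).
rewrite !starE -mulN1r lext_scale; apply: eq_lext => k; by rewrite mulN1r mulNr.
Qed.

Lemma star_sumZl (I : Type) (r : seq I) (c : I -> R) (f : I -> F -> R) psi :
  star (fun h => \sum_(i <- r) c i * f i h) psi =
  fun h => \sum_(i <- r) c i * star (f i) psi h.
Proof.
apply/funext => h; rewrite starE.
transitivity (lext (fun k => \sum_(i <- r) c i *: (f i k.1 * psi k.2 : R^o)) (cop h)).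
  apply: eq_lext => k; rewrite mulr_suml; apply: eq_bigr => i _; exact: esym (mulrA _ _ _).
by rewrite lext_sumf; apply: eq_bigr => i _; rewrite starE.
Qed.

Definition fhom n psi : Prop := forall h, nodes h != n -> psi h = 0.

Lemma fhom_dirac h : fhom (nodes h) (dirac h).
Proof. by move=> g gh; rewrite diracE; case: eqP => // gE; rewrite gE eqxx in gh. Qed.

Lemma fhom_star m n phi psi : fhom m phi -> fhom n psi -> fhom (m + n)%N (star phi psi).
Proof.
move=> hphi hpsi h hn; rewrite starE -[RHS](lext0f R^o (cop h)).
apply: eq_in_lext => k /cop_nodes kh.
have [k1|/hphi -> //] := eqVneq (nodes k.1) m; last by rewrite mul0r.
rewrite hpsi ?mulr0 //; apply: contraNneq hn => k2; by rewrite -kh k1 k2.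
Qed.

Lemma eq_starl n phi phi' psi g : fhom n psi ->
  (forall k, (nodes k + n = nodes g)%N -> phi k = phi' k) ->
  star phi psi g = star phi' psi g.
Proof.
move=> hpsi e; rewrite !starE; apply: eq_in_lext => k /cop_nodes kg.
have [k2|] := eqVneq (nodes k.2) n; first by rewrite e // -k2.
by move/hpsi => ->; rewrite !mulr0.
Qed.

Lemma star_low n phi psi g : fhom n psi -> (nodes g < n)%N -> star phi psi g = 0.
Proof.
move=> hpsi gn; rewrite (@eq_starl n _ (fun=> 0) _ _ hpsi).
  by rewrite starE -[RHS](lext0f R^o (cop g)); apply: eq_lext => k; rewrite mul0r.
by move=> k kg; move: gn; rewrite -kg ltnNge leq_addl.
Qed.

Lemma eq_in_pairing phi psi z : (forall h, h \in msupp z -> phi h = psi h) ->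
  pairing phi z = pairing psi z.
Proof. by move=> e; rewrite !pairingE; apply: eq_in_lext. Qed.

(** Since phi is idempotent, phi * (phi - 1) = 0, whereas in the lowest degree where phi - 1 could
    be nonzero this product equals phi - 1. Chen's relation on the diagonal thus gives X_{s,s} =
    1. *)
Lemma star_idem phi : phi mone = 1 -> star phi phi = phi -> phi = counit R (A := A).
Proof.
move=> phi1 idem; pose d h := phi h - counit R h.
suff d0 : forall n h, (nodes h < n)%N -> d h = 0.
  by apply/funext => h; apply/eqP; rewrite -subr_eq0; apply/eqP/(d0 (nodes h).+1).
elim=> // n IH h; rewrite ltnS => hn.
have d1 : d mone = 0 by rewrite /d phi1 /counit eqxx subrr.
have phiE : phi = fun h => counit R h + d h by apply/funext => k; rewrite /d addrC subrK.
(* In d * d, a left factor with fewer than n nodes is killed by induction; otherwise the right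
   factor is empty, where d vanishes. *)
have : star phi d h = 0 + d h.
  rewrite {1}phiE starDl star1f addrC; congr (_ + _).
  rewrite starE -[RHS](lext0f R^o (cop h)); apply: eq_in_lext => k /cop_nodes kh.
  have [k1|k1] := ltnP (nodes k.1) n; first by rewrite IH // mul0r.
  have /eqP : nodes k.2 == 0%N by rewrite -leqn0 -(leq_add2l n) addn0 (leq_trans _ hn) // -kh leq_add2r.
  by move/eqP; rewrite nodes_eq0 => /eqP ->; rewrite d1 mulr0.
have -> : star phi d h = 0.
  have -> : d = fun h => phi h - counit R h by [].
  transitivity (star phi phi h - star phi (counit R (A:=A)) h).
    rewrite !starE -[X in _ - X]mul1r -mulNr lext_scale -lextDf.
    by apply: eq_lext => k; rewrite mulrBr mulN1r.
  by rewrite idem starf1 subrr.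
by rewrite add0r.
Qed.

End Shift.

(** * Germs of the integrals and their additivity defects *)

Section RoughAlgebra.
Variables (R : realType) (A : finType) (T : {posnum R}) (alpha : R).
Local Notation F := (forest A).
Local Notation H := {malg R[F]}.
Local Notation I := (time T).
Local Notation cop := (@cop R A).
Local Notation N := (Nlevel alpha).
Variable P : set H.
Hypothesis HP : primitive_basis P.
Hypothesis HN : (0 < N)%N.
Implicit Types (X Y : rough_path A T alpha) (h g : F) (s t u a b : I) (z : H) (Z : I -> H).

Lemma rp_mone X s t : rp X s t mone = 1.
Proof.
by have [+ _] := rp_character X s t; rewrite malg1E pairingE lextU.
Qed.

Lemma rp_diag X s : rp X s s = counit R (A := A).
Proof. by apply: star_idem; [exact: rp_mone|exact: rp_chen]. Qed.

Definition rem X Z s t : H := Z t - shift (rp X s t) (Z s).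

Lemma remainderE X Z h s t : remainder X Z h s t = (rem X Z s t)@_h.
Proof. by rewrite /remainder /rem mcoeffB coeff_shift. Qed.

(** The germ of the sum over [p] of the integrals against [X^p]. *)
Definition germ X Z h s t : R := (shift (rp X s t) (Z s) - Z s)@_h.

Lemma remE X Z h s t : (rem X Z s t)@_h = (Z t)@_h - (Z s)@_h - germ X Z h s t.
Proof. by rewrite /rem /germ !mcoeffB opprB addrA subrK. Qed.

Lemma rem_diag X Z s : rem X Z s s = 0.
Proof. by rewrite /rem rp_diag shift_counit subrr. Qed.

Lemma germE X Z h s t :
  germ X Z h s t = pairing (star (fun k => rp X s t k - counit R k) (dirac R h)) (Z s).
Proof.
by rewrite /germ mcoeffB coeff_shift starBl star1f pairingBf pairing_dirac.
Qed.

(** Chen's relation moves the expansion from s to u, so the additivity defect only sees how far Z_u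
    is from the transport of Z_s, that is, the remainder. *)
Lemma germ_chen X Z h s u t :
  germ X Z h s t - germ X Z h s u - germ X Z h u t =
  - pairing (star (fun k => rp X u t k - counit R k) (dirac R h)) (rem X Z s u).
Proof.
rewrite starBl star1f pairingBf pairing_dirac -coeff_shift.
have -> : shift (rp X u t) (rem X Z s u) =
    shift (rp X u t) (Z u) - shift (rp X s t) (Z s).
  by rewrite /rem linearB /= shift_shift rp_chen.
rewrite /germ /rem !mcoeffB.
move: (shift (rp X s t) _)@_h (shift (rp X s u) _)@_h (shift (rp X u t) _)@_h.
by move: (Z s)@_h (Z u)@_h => x1 x2 x3 x4 x5; ring.
Qed.

(** X^(k \top p)_{s,t} as a functional of k. *)
Definition rpt X (p : H) s t : F -> R := fun k => pairing (rp X s t) (gt p k).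

(** Pair X_{s,u} (x) X_{u,t} with the coproduct of k \top p. Primitivity of p splits off (k \top p)
    (x) 1, which gives the first term. *)
Lemma rpt_chen X p s u t : P p -> rpt X p s t =
  fun k => rpt X p s u k + star (rp X s u) (rpt X p u t) k.
Proof.
move=> Pp; apply/funext => k; rewrite /rpt -[in LHS](rp_chen X s u t).
transitivity (lext (fun l => rp X s u l.1 * rp X u t l.2 : R^o) (lext cop (gt p k))).
  by rewrite pairingE [RHS]lext_lext; apply: eq_lext => l; rewrite starE.
rewrite (cop_gt HP); last exact: (Pprim HP).
rewrite [LHS]linearD /=; congr (_ + _).
  by rewrite lext_lext pairingE; apply: eq_lext => l; rewrite lextU rp_mone mulr1.
rewrite lext_lext starE; apply: eq_lext => l.
by rewrite /embr lext_lext pairingE lext_scale; apply: eq_lext => r; rewrite lextU.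
Qed.

Definition pdual (p : H) : F -> R := functional_of (dual_elt P p).

Lemma pdualE p k : P p -> pdual p k = (coord HP k)@_p.
Proof. by move=> Pp; rewrite /pdual /functional_of (dual_eltE HP) //; exact: PtopP. Qed.

Lemma fhom_dual rho : Ptop P rho -> fhom (hdeg rho) (functional_of (dual_elt P rho)).
Proof.
move=> Pr h; rewrite /functional_of (dual_eltE HP) // => hr.
by apply: mcoeff_outdom; apply: contra hr => /coord_hdeg ->.
Qed.

Definition pgerm X Z h p s t : R :=
  pairing (star (rpt X p s t) (star (pdual p) (dirac R h))) (Z s).

Lemma pgerm_chen X Z h p s u t : P p ->
  pgerm X Z h p s t - pgerm X Z h p s u - pgerm X Z h p u t =
  - pairing (star (rpt X p u t) (star (pdual p) (dirac R h))) (rem X Z s u).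
Proof.
move=> Pp; rewrite /pgerm (rpt_chen X s u t Pp) starDl pairingDf.
rewrite -starA -(pairing_shift (rp X s u)) /rem pairingB.
move: (pairing _ (Z u)) (pairing _ (shift _ _)) (pairing _ (Z s)) => x1 x2 x3; ring.
Qed.

(** The truncation of the sum over rho loses nothing: the product of the dual elements of rho and p
    with h has degree |rho| + |p| + |h|, and Z has no components of degree N or more. *)
Lemma local_integralE X Z h p a b : P p -> span_valued alpha Z ->
  local_integral P X Z h p a b = pgerm X Z h p a b.
Proof.
move=> Pp spanZ; rewrite /local_integral.
set D := [set rho | _].
have finD : finite_set D.
  by apply: sub_finite_set (finite_Ptop_le HP (N - nodes h - hdeg p)%N) => rho [Pr /ltnW].
rewrite fsbig_finite //=.
have Dmem rho : rho \in fset_set D -> D rho by rewrite in_fset_set // inE.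
rewrite /pgerm.
transitivity (pairing (star (fun k => \sum_(rho <- fset_set D)
    pairing (rp X a b) (gtop rho p) * functional_of (dual_elt P rho) k)
    (star (pdual p) (dirac R h))) (Z a)).
  rewrite star_sumZl pairing_sumf; apply: eq_bigr => rho _.
  by rewrite pairingZf mulrC.
apply: eq_in_pairing => g /spanZ gN.
apply: (eq_starl (n := (hdeg p + nodes h)%N)).
  apply: fhom_star; last exact: fhom_dirac.
  exact/fhom_dual/PtopP.
move=> k kg; rewrite /rpt -[gt p k]/(gt p k).
transitivity (lext (rp X a b : F -> R^o) (lext (gt p) (ev (coord HP k)))); last first.
  by rewrite ev_coord lextU pairingE.
rewrite /ev !lext_lext.
have sub : fsubset (msupp (coord HP k)) (fset_set D).
  apply/fsubsetP => rho rk; rewrite in_fset_set // inE; split.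
    exact: coord_Ptop rk.
  rewrite (coord_hdeg rk); move: gN; rewrite /forest_le /= -kg.
  by move: HN; clear; move: (Nlevel _); lia.
rewrite (lextEw _ sub); apply: eq_big_seq => rho /Dmem[Pr _].
rewrite -[in RHS]lext_lext -gtopE -pairingE /functional_of (dual_eltE HP) //.
by rewrite mulrC.
Qed.

(** This is [star_expansion] multiplied by h. It is used up to degree N - 1 - |h|, beyond which Z
    has no component to pair with. *)
Lemma sum_pgerm X Z h a b : forest_le N.-1 h -> span_valued alpha Z ->
  \sum_(p \in [set p : H | P p /\ (hdeg p < N - nodes h)%N]) pgerm X Z h p a b =
  germ X Z h a b.
Proof.
move=> hN spanZ; set D := [set p | _].
have finD : finite_set D.
  by apply: sub_finite_set (finite_P_le HP (N - nodes h)%N) => rho [Pr /ltnW].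
rewrite fsbig_finite //= /pgerm.
have Dmem p : p \in fset_set D -> D p by rewrite in_fset_set // inE.
transitivity (pairing (star (fun k => \sum_(p <- fset_set D)
   star (rpt X p a b) (pdual p) k) (dirac R h)) (Z a)).
  transitivity (pairing (star (fun k => \sum_(p <- fset_set D)
   1 * star (rpt X p a b) (pdual p) k) (dirac R h)) (Z a)).
    rewrite star_sumZl pairing_sumf; apply: eq_bigr => p _.
    by rewrite pairingZf mul1r starA.
  congr (pairing (star _ _) _); apply/funext => k; apply: eq_bigr => p _; exact: mul1r.
rewrite germE; apply: eq_in_pairing => g /spanZ gN.
apply: (eq_starl (n := nodes h)) => [|k kg]; first exact: fhom_dirac.
rewrite (@star_expansion _ _ _ HP (rp X a b) (N.-1 - nodes h) (fset_set D)).
- rewrite addrC addKr; apply: eq_big_seq => p /Dmem[Pp _].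
  have -> : pdual p = fun l => (coord HP l)@_p by apply/funext => l; exact: pdualE.
  by [].
- exact: rp_mone.
- exact: fset_uniq.
- by move=> p /Dmem[].
- move=> p Pp hp; rewrite in_fset_set // inE; split=> //.
  by move: HN hp hN; rewrite /forest_le /=; clear; move: (Nlevel _); lia.
- by move: kg gN hN; rewrite /forest_le /=; clear; lia.
Qed.

End RoughAlgebra.

(** * Sewing *)

Section Sewing.
Variables (R : realType) (T : {posnum R}).
Local Notation I := (time T).
Implicit Types (s t u : I) (X : I -> I -> R) (th : R).

Definition tdist s t : R := `|\val t - \val s|.

Lemma tdist_ge0 s t : 0 <= tdist s t. Proof. exact: normr_ge0. Qed.
Lemma tdistxx s : tdist s s = 0. Proof. by rewrite /tdist subrr normr0. Qed.
Lemma tdistC s t : tdist s t = tdist t s. Proof. exact: distrC. Qed.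

Lemma tdist_le s t : \val s <= \val t -> tdist s t = \val t - \val s.
Proof. by move=> st; rewrite /tdist ger0_norm // subr_ge0. Qed.

Lemma val_time s : 0 <= \val s <= T%:num. Proof. exact: (valP s). Qed.

Lemma tdist_leT s t : tdist s t <= T%:num.
Proof.
have := val_time s; have := val_time t => /andP[t0 tT] /andP[s0 sT].
rewrite ler_norml; apply/andP; split; lra.
Qed.

Lemma tdist_eq0 s t : tdist s t = 0 -> s = t.
Proof. by move/eqP; rewrite normr_eq0 subr_eq0 => /eqP/val_inj. Qed.

Definition mkt (x : R) : I := insubd (time0 T) x.

Lemma val_mkt x : 0 <= x <= T%:num -> \val (mkt x) = x.
Proof. by move=> xT; rewrite /mkt val_insubd xT. Qed.

Lemma le_powR_base (a b th : R) : 0 <= th -> 0 <= a -> a <= b -> a `^ th <= b `^ th.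
Proof.
by move=> th0 a0 ab; apply: ge0_ler_powR; rewrite ?nnegrE // (le_trans a0).
Qed.

Definition half th : R := 2^-1 `^ th.

Lemma half_gt0 th : 0 < half th. Proof. by apply: powR_gt0; rewrite invr_gt0. Qed.

Lemma half_lt th : 1 < th -> 2 * half th < 1.
Proof.
move=> th1; rewrite /half -[X in _ * X]mulr_powRB1; [|by rewrite invr_ge0|lra].
rewrite mulrA mulfV ?mul1r; last by rewrite pnatr_eq0.
rewrite /powR invr_eq0 pnatr_eq0 /= expR_lt1 pmulr_rlt0; last lra.
by apply: ln_lt0; rewrite invr_gt0 ltr0n /= invf_lt1 // ltr1n.
Qed.

Lemma powR_half x th : 0 <= x -> (x / 2) `^ th = half th * x `^ th.
Proof. by move=> x0; rewrite mulrC powRM // invr_ge0. Qed.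

(** The solution of K = 2 * 2^(-th) * K + 2: two pieces of at most half the length, and two
    additivity defects. *)
Definition sewing_const th : R := 2 / (1 - 2 * half th).

Lemma sewing_const_gt0 th : 1 < th -> 0 < sewing_const th.
Proof. by move=> /half_lt h1; rewrite divr_gt0 // subr_gt0. Qed.

Lemma sewing_constE th : 1 < th -> 2 * half th * sewing_const th + 2 = sewing_const th.
Proof. by move=> /half_lt h1; rewrite /sewing_const; field; rewrite gt_eqF // subr_gt0. Qed.

Fixpoint psum X s (l : seq I) : R := if l is t :: l' then X s t + psum X t l' else 0.

Lemma psumE X s l : psum X s l = \sum_(ab <- zip (s :: l) l) X ab.1 ab.2.
Proof.
elim: l s => [|t l IH] s; first by rewrite big_nil.
by rewrite big_cons /= IH.
Qed.

Lemma psum_cat X s l1 l2 : psum X s (l1 ++ l2) = psum X s l1 + psum X (last s l1) l2.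
Proof. by elim: l1 s => [|t l1 IH] s /=; rewrite ?add0r // IH addrA. Qed.

Definition tle : rel I := fun s t => \val s <= \val t.

Lemma tle_trans : transitive tle. Proof. by move=> t s u; exact: le_trans. Qed.
Lemma tle_total : total tle. Proof. by move=> s t; exact: le_total. Qed.

Lemma path_last_le s l : path tle s l -> tle s (last s l).
Proof.
elim: l s => [|t l IH] s /=; first by rewrite /tle.
by move=> /andP[st /IH tl]; exact: tle_trans tl.
Qed.

Lemma split_at_mid m s (l : seq I) : \val s <= m -> (\val (last s l) <= m) \/
  exists l1 v l2, [/\ l = l1 ++ v :: l2, \val (last s l1) <= m & m < \val v].
Proof.
elim: l s => [|t l IH] s sm /=; first by left.
have [tm|mt] := leP (\val t) m; last by right; exists [::], t, l.
have [|[l1 [v [l2 [-> lm mv]]]]] := IH _ tm; first by left.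
by right; exists (t :: l1), v, l2.
Qed.

Section MaximalInequality.
Variables (X : I -> I -> R) (C th : R).
Hypotheses (th1 : 1 < th) (C0 : 0 <= C)
  (HX : forall s u t, `|X s t - X s u - X u t| <= C * (tdist s u + tdist u t) `^ th).

Let th0 : 0 <= th. Proof. exact: ltW (lt_trans ltr01 th1). Qed.

Lemma sew_diag s : X s s = 0.
Proof.
have := HX s s s; rewrite tdistxx addr0 powR0; last by rewrite (gt_eqF (lt_trans ltr01 th1)).
rewrite mulr0 normr_le0 => /eqP; move: (X s s) => x; lra.
Qed.

(** Bisection by length, so that the bound does not depend on the number of points. The midpoint
    lies between two successive points u and v; the parts of the partition before u and after v have
    at most half the length, and inserting u and then v costs one defect each. *)
Lemma psum_max s l : path tle s l ->
  `|psum X s l - X s (last s l)| <= sewing_const th * C * tdist s (last s l) `^ th.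
Proof.
have [n] := ubnP (size l); elim: n s l => // n IH s l; rewrite ltnS => ln pl.
have sl := path_last_le pl; set e := last s l in sl *.
have K0 := ltW (sewing_const_gt0 th1).
have [L0|L0] := eqVneq (tdist s e) 0.
  have se := tdist_eq0 L0.
  have -> : psum X s l = 0.
    rewrite {}/e in se sl L0; elim: l s se {ln L0 sl} pl => //= t l IHl s se /andP[st pl].
    have tl := path_last_le pl.
    have ts : s = t.
      by apply: val_inj; apply/le_anti/andP; split; [exact: st|rewrite se; exact: tl].
    by rewrite -{1}ts sew_diag add0r IHl // -se.
  by rewrite -se sew_diag subrr normr0 mulr_ge0 ?powR_ge0 // mulr_ge0.
have Lgt : 0 < tdist s e by rewrite lt_def L0 tdist_ge0.
have LE := tdist_le sl.
pose m := \val s + tdist s e / 2.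
have sm : \val s <= m by rewrite /m lerDl divr_ge0 // ltW.
have [em|[l1 [v [l2 [lE um mv]]]]] := split_at_mid l sm.
  by move: em; rewrite -/e /m; lra.
move: pl; rewrite lE cat_path /= => /and3P[p1 uv p2].
have eE : e = last v l2 by rewrite /e lE last_cat.
set u := last s l1 in um uv.
have su : tle s u := path_last_le p1.
have ve : tle v e by rewrite eE; exact: path_last_le.
have sz : size l = (size l1 + (size l2).+1)%N by rewrite lE size_cat.
have B1 := IH s l1; rewrite -/u in B1.
have {}B1 : `|psum X s l1 - X s u| <= sewing_const th * C * tdist s u `^ th.
  by apply: B1 => //; apply: leq_trans ln; rewrite sz addnS ltnS leq_addr.
have B2 : `|psum X v l2 - X v e| <= sewing_const th * C * tdist v e `^ th.
  by rewrite eE; apply: IH => //; apply: leq_trans ln; rewrite sz addnS ltnS leq_addl.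
have pe := powR_half th (ltW Lgt).
have le1 : tdist s u `^ th <= half th * tdist s e `^ th.
  rewrite -pe; apply: le_powR_base => //; first exact: tdist_ge0.
  by rewrite (tdist_le su); move: um; rewrite /m; lra.
have le2 : tdist v e `^ th <= half th * tdist s e `^ th.
  rewrite -pe; apply: le_powR_base => //; first exact: tdist_ge0.
  by rewrite (tdist_le ve); move: mv; rewrite /m; lra.
have B3 := HX s u e; have B4 := HX u v e.
rewrite /tle in su uv ve.
rewrite (tdist_le su) (tdist_le (le_trans uv ve)) in B3.
rewrite (tdist_le uv) (tdist_le ve) in B4.
have {}B3 : `|X s e - X s u - X u e| <= C * tdist s e `^ th.
  apply: le_trans B3 _; rewrite LE; apply: ler_wpM2l => //; apply: le_powR_base => //; clear -su uv ve; lra.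
have {}B4 : `|X u e - X u v - X v e| <= C * tdist s e `^ th.
  apply: le_trans B4 _; rewrite LE; apply: ler_wpM2l => //; apply: le_powR_base => //; clear -su uv ve; lra.
rewrite psum_cat /= -/u.
have -> : psum X s l1 + (X u v + psum X v l2) - X s e = (psum X s l1 - X s u) +
  (psum X v l2 - X v e) - (X s e - X s u - X u e) - (X u e - X u v - X v e) by ring.
apply: le_trans (ler_normB _ _) _.
apply: (@le_trans _ _ (`|psum X s l1 - X s u| + `|psum X v l2 - X v e| +
  `|X s e - X s u - X u e| + `|X u e - X u v - X v e|)).
  rewrite lerD2r; apply: le_trans (ler_normB _ _) _; rewrite lerD2r; exact: ler_normD.
rewrite -[X in X * C * _](sewing_constE th1).
have h1 : sewing_const th * C * tdist s u `^ th <=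
    sewing_const th * C * (half th * tdist s e `^ th) by apply: ler_wpM2l => //; exact: mulr_ge0.
have h2 : sewing_const th * C * tdist v e `^ th <=
    sewing_const th * C * (half th * tdist s e `^ th) by apply: ler_wpM2l => //; exact: mulr_ge0.
lra.
Qed.

End MaximalInequality.
End Sewing.

Section UltraLimit.
Variable R : realType.

(** Compactness of the segment takes the place of a Cauchy argument: the image of an ultrafilter is
    again an ultrafilter. *)
Lemma ultra_bounded_cvg (V : Type) (U : set_system V) (f : V -> R) M :
  UltraFilter U -> (forall x, `|f x| <= M) -> exists l : R, f @ U --> l.
Proof.
move=> UU fM.
have FU : UltraFilter (f @ U).
  split; first exact: fmap_proper_filter.
  move=> G GP UG; apply/seteqP; split; last exact: UG.
  move=> B GB; have [//|UnB] := in_ultra_setVsetC (f @^-1` B) UU.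
  have GnB : G (~` B) by apply: UG.
  have [x []] : (B `&` ~` B) !=set0 by apply: (@filter_ex _ G _); exact: filterI.
  by [].
have := @segment_compact R (- M) M; rewrite compact_ultra => /(_ _ FU)[|l [_ fl]].
  rewrite /fmap /=; apply: (filterS (P := setT)) => [x _|]; last exact: filterT.
  by rewrite /= in_itv /= -ler_norml.
by exists l.
Qed.

End UltraLimit.

Section SewnPath.
Variables (R : realType) (T : {posnum R}).
Local Notation I := (time T).
Implicit Types (s t u : I) (X : I -> I -> R).

Section Existence.
Variables (X : I -> I -> R) (C th : R).
Hypotheses (th1 : 1 < th) (C0 : 0 <= C)
  (HX : forall s u t, `|X s t - X s u - X u t| <= C * (tdist s u + tdist u t) `^ th).

Let K := sewing_const th * C.

(** Finite sets of times directed by inclusion: any finitely many prescribed times eventually belong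
    to the set. *)
Definition finer : set_system (seq I) :=
  [set Q : set (seq I) | exists D : seq I, forall E : seq I, {subset D <= E} -> Q E].

Lemma finer_proper : ProperFilter finer.
Proof.
split; first by move=> [D /(_ D)]; apply.
split; first by exists [::].
- move=> P Q [D PD] [E QE]; exists (D ++ E) => G sub; split.
    by apply: PD => x xD; apply: sub; rewrite mem_cat xD.
  by apply: QE => x xE; apply: sub; rewrite mem_cat xE orbT.
- by move=> P Q PQ [D PD]; exists D => E /PD /PQ.
Qed.

Definition upto (E : seq I) t := [seq s <- sort (@tle R T) E | tle s t].
Definition subset_sum (E : seq I) t := psum X (time0 T) (upto E t).

Lemma upto_path E t : path (@tle R T) (time0 T) (upto E t).
Proof.
rewrite path_min_sorted; last first.
  apply/allP => s _; rewrite /tle /=; by case/andP: (val_time s).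
exact: sorted_filter (@tle_trans R T) _ _ (sort_sorted (@tle_total R T) _).
Qed.

Lemma last_upto E t : t \in E -> last (time0 T) (upto E t) = t.
Proof.
move=> tE; have tU : t \in upto E t by rewrite mem_filter mem_sort tE /tle lexx.
apply: val_inj; apply/le_anti/andP; split.
  have : last (time0 T) (upto E t) \in time0 T :: upto E t by exact: mem_last.
  rewrite inE => /orP[/eqP ->|]; first by case/andP: (val_time t).
  by rewrite mem_filter => /andP[].
have := upto_path E t; move: tU; move: (upto E t) => l.
move=> /path.splitPr[l1 l2]; rewrite cat_path last_cat /= => /and3P[_ _].
exact: path_last_le.
Qed.

Lemma upto_cat E s t : tle s t ->
  upto E t = upto E s ++ [seq u <- upto E t | ~~ tle u s].
Proof.
move=> st; rewrite /upto -!filter_predI.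
have : sorted (@tle R T) (sort (@tle R T) E) by exact: sort_sorted (@tle_total R T) _.
elim: (sort _ E) => //= u l IH ul.
have sl : sorted (@tle R T) l by exact: path_sorted ul.
have [us|us] := boolP (tle u s).
  by rewrite (tle_trans us st) /= -IH.
have -> : [seq x <- l | tle x s] = [::].
  apply/eqP; rewrite -[_ == _]negbK -has_filter; apply/hasPn => x xl.
  apply: contra us => xs; apply: tle_trans xs.
  by have /allP/(_ _ xl) := order_path_min (@tle_trans R T) ul.
have El : [seq x <- l | tle x t] = [seq x <- l | ~~ tle x s && tle x t].
  apply: eq_in_filter => x xl; rewrite (_ : tle x s = false) //.
  apply: contraNF us => xs; apply: tle_trans xs.
  by have /allP/(_ _ xl) := order_path_min (@tle_trans R T) ul.
by rewrite /= El.
Qed.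

Lemma subset_sum_bound E s t : tle s t -> s \in E -> t \in E ->
  `|subset_sum E t - subset_sum E s - X s t| <= K * tdist s t `^ th.
Proof.
move=> st sE tE; rewrite /subset_sum (upto_cat E st) psum_cat last_upto // [X in X - _ - _]addrC addrK.
have ls : last s [seq u <- upto E t | ~~ tle u s] = t.
  by have := last_upto tE; rewrite {1}(upto_cat E st) last_cat last_upto.
have := psum_max th1 C0 HX (s := s) (l := [seq u <- upto E t | ~~ tle u s]).
rewrite ls; apply.
have := upto_path E t; rewrite {1}(upto_cat E st) cat_path => /andP[_].
by rewrite last_upto.
Qed.

(** J t is the limit of the sums over the points of E up to t, along one ultrafilter common to all
    t. For any E containing s and t, the two sums differ by a sum over a partition of [s, t], to
    which [psum_max] applies, and the bound passes to the limit. *)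
Lemma sewing_exists : exists J : I -> R, J (time0 T) = 0 /\
  exists B, 0 <= B /\ forall s t, `|J t - J s - X s t| <= B * tdist s t `^ th.
Proof.
have th0 : 0 <= th by exact: ltW (lt_trans ltr01 th1).
have K0 : 0 <= K by rewrite mulr_ge0 // ltW // sewing_const_gt0.
have [U [UU fU]] := ultraFilterLemma finer_proper.
(* The value 0 is a default for the sets that miss 0 or t, which the ultrafilter eventually
   avoids. *)
pose f t (E : seq I) := if (time0 T \in E) && (t \in E) then subset_sum E t else 0.
have fb t : forall E, `|f t E| <= `|X (time0 T) t| + K * tdist (time0 T) t `^ th.
  move=> E; rewrite /f; case: ifP => [/andP[zE tE]|_]; last first.
    by rewrite normr0 addr_ge0 // mulr_ge0 // powR_ge0.
  have z0 : tle (time0 T) t by case/andP: (val_time t).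
  have := subset_sum_bound z0 zE tE.
  have -> : subset_sum E (time0 T) = 0.
    rewrite /subset_sum; have := upto_path E (time0 T).
    have : all (fun s => tle s (time0 T)) (upto E (time0 T)) by rewrite filter_all.
    move: (upto _ _) => l; elim: l => //= x l IH /andP[x0 l0] /andP[zx pl].
    have E0 : x = time0 T by apply: val_inj; apply/le_anti/andP.
    by rewrite E0 (sew_diag th1 HX) add0r IH // -[X in path _ X]E0.
  rewrite subr0; move: (subset_sum E t) (X _ t) => a b ab.
  by rewrite -[a](subrK b) (le_trans (ler_normD _ _)) // addrC lerD2l.
pose J t := sval (cid (ultra_bounded_cvg UU (fb t))).
have JP t : f t @ U --> J t by rewrite /J; case: cid.
have mono s t : tle s t -> `|J t - J s - X s t| <= K * tdist s t `^ th.
  move=> st; apply/ler_addgt0Pr => e e0; have e2 : 0 < e / 2 by rewrite divr_gt0.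
  have Ut : \forall E \near U, `|J t - f t E| <= e / 2.
    by have /cvgrPdist_le := JP t; apply.
  have Us : \forall E \near U, `|J s - f s E| <= e / 2.
    by have /cvgrPdist_le := JP s; apply.
  have UE : U [set E : seq I | [&& time0 T \in E, s \in E & t \in E]].
    apply: fU; exists [:: time0 T; s; t] => E sub.
    by apply/and3P; split; apply: sub; rewrite !inE eqxx ?orbT.
  have [E [[Et Es] /and3P[zE sE tE]]] := filter_ex (filterI (filterI Ut Us) UE).
  rewrite /= /f zE sE tE /= in Et Es.
  have := subset_sum_bound st sE tE; move: Et Es.
  move: (subset_sum E t) (subset_sum E s) (J t) (J s) (X s t) (K * _) => a b c d x k.
  rewrite !ler_norml => /andP[? ?] /andP[? ?] /andP[? ?]; apply/andP; split; lra.
exists (fun t => J t - J (time0 T)); split; first by rewrite subrr.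
(* The second term serves t < s: then X s t is compared with - X t s, through the defect over s, t,
   s of total length 2 |t - s|. *)
exists (K + C * 2 `^ th); split; first by rewrite addr_ge0 // mulr_ge0 // powR_ge0.
move=> s t; rewrite opprB addrA subrK mulrDl.
have p0 : 0 <= C * 2 `^ th * tdist s t `^ th by rewrite !mulr_ge0 // powR_ge0.
have [st|ts] := boolP (tle s t); first by apply: le_trans (mono _ _ st) _; rewrite lerDl.
have {ts} ts : tle t s by have := tle_total s t; rewrite (negPf ts).
have := mono _ _ ts; have := HX s t s; rewrite (sew_diag th1 HX) (tdistC t s).
have -> : tdist s t + tdist s t = 2 * tdist s t by rewrite mulr_natl mulr2n.
rewrite powRM ?tdist_ge0 // mulrA.
move: (J s) (J t) (X s t) (X t s) (C * _ * _) (K * _) => a b x y k l.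
rewrite !ler_norml => /andP[? ?] /andP[? ?]; apply/andP; split; lra.
Qed.

End Existence.
End SewnPath.

(** * Limits over partitions and the a priori estimate *)

Section MeshLimit.
Variables (R : realType) (T : {posnum R}).
Local Notation I := (time T).
Implicit Types (s t u : I) (X : I -> I -> R).

Lemma powR_split (x th : R) : 0 <= x -> 1 < th -> x `^ th = x * x `^ (th - 1).
Proof. by move=> x0 th1; rewrite mulr_powRB1 // (lt_trans ltr01). Qed.

Definition small_cells (d : R) s (l : seq I) :=
  forall ab, ab \in zip (s :: l) l -> \val ab.2 - \val ab.1 < d.

(** Makes the filter [mesh_to_0] proper, so that a limit along it is unique. Steps of length d / 2
    keep the cells strictly shorter than d. *)
Lemma fine_partition (d : R) s t : 0 < d -> tle s t -> exists l : seq I,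
  [/\ itv_partition (\val s) (\val t) (map \val l) & small_cells d s l].
Proof.
move=> d0 st; have [n] : exists n, \val t - \val s < n%:R * (d / 2).
  exists (Num.bound ((\val t - \val s) / (d / 2))).
  rewrite -ltr_pdivrMr ?divr_gt0 //; apply: le_lt_trans (ler_norm _) _.
  by rewrite ger0_norm ?archi_boundP // divr_ge0 ?subr_ge0 // divr_ge0 // ltW.
elim: n s st => [|n IH] s st tn.
  by move: st; rewrite /tle leNgt; move: tn; rewrite mul0r subr_lt0 => ->.
have [ts|ts] := eqVneq s t.
  by exists [::]; split=> //=; rewrite ts; split.
have slt : \val s < \val t.
  rewrite lt_neqAle (_ : (\val s <= \val t) = true) // andbT.
  by apply: contraNneq ts => /val_inj ->.
have [small|big] := ltP (\val t - \val s) d.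
  exists [:: t]; split; first by split; rewrite /= ?slt.
  by move=> ab; rewrite inE => /eqP ->.
pose m : I := mkt T (\val s + d / 2).
have mE : \val m = \val s + d / 2.
  rewrite val_mkt //; have /andP[s0 _] := val_time s; have /andP[_ tT] := val_time t.
  apply/andP; split; lra.
have mt : tle m t by rewrite /tle mE; lra.
have [|l [[pl ll] sl]] := IH m mt.
  by rewrite mE; move: tn; rewrite -natr1 mulrDl mul1r; lra.
exists (m :: l); split.
  by split=> //=; rewrite pl andbT mE ltrDl divr_gt0.
move=> ab; rewrite /= inE => /orP[/eqP ->|]; last exact: sl.
by rewrite /= mE addrAC subrr add0r ltr_pdivrMr // ltr_pMr // ltr1n.
Qed.

Instance mesh_to_0_proper t : ProperFilter (@mesh_to_0 R T t).
Proof.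
split.
  move=> [d d0 /(_ _ _ _)] H0; have z : tle (time0 T) t by case/andP: (val_time t).
  by have [l [pl sl]] := fine_partition d0 z; apply: (H0 l).
split.
- by exists 1.
- move=> P Q [d d0 Pd] [e e0 Qe]; exists (Num.min d e); first by rewrite lt_min d0.
  move=> l pl sl; split.
    by apply: Pd => // ab /sl; rewrite lt_min => /andP[].
  by apply: Qe => // ab /sl; rewrite lt_min => /andP[].
- by move=> P Q PQ [d d0 Pd]; exists d => // l pl sl; apply/PQ/Pd.
Qed.

(** On a cell of length x < d the error is of order x^th <= d^(th - 1) x, and the lengths add up. *)
Lemma psum_approx X (J : I -> R) (B th d : R) s (l : seq I) : 1 < th -> 0 <= B -> 0 < d ->
  (forall u v, tle u v -> `|J v - J u - X u v| <= B * tdist u v `^ th) ->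
  path (@tle R T) s l -> small_cells d s l ->
  `|J (last s l) - J s - psum X s l| <= B * d `^ (th - 1) * (\val (last s l) - \val s).
Proof.
move=> th1 B0 d0 JX; elim: l s => [|t l IH] s /=.
  by move=> _ _; rewrite !subrr normr0 mulr0.
move=> /andP[st pl] sl.
have slt : small_cells d t l by move=> ab abl; apply: sl; rewrite /= inE abl orbT.
have ds : \val t - \val s < d by apply: (sl (s, t)); rewrite /= mem_head.
have := IH t pl slt; have := JX _ _ st; set e := last t l.
have -> : J e - J s - (X s t + psum X t l) = (J t - J s - X s t) + (J e - J t - psum X t l).
  by ring.
move=> h1 h2; apply: le_trans (ler_normD _ _) _.
have -> : \val e - \val s = (\val t - \val s) + (\val e - \val t) by ring.
rewrite mulrDr; apply: lerD => //; apply: le_trans h1 _.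
rewrite (tdist_le st) powR_split ?subr_ge0 // -mulrA; apply: ler_wpM2l => //.
rewrite mulrC; apply: ler_wpM2r; first by rewrite subr_ge0.
by apply: le_powR_base; rewrite ?subr_ge0 // ltW.
Qed.

Lemma mesh_limitE X (J : I -> R) (B th : R) t : 1 < th -> 0 <= B ->
  (forall u v, tle u v -> `|J v - J u - X u v| <= B * tdist u v `^ th) ->
  J (time0 T) = 0 -> mesh_limit X t = J t.
Proof.
move=> th1 B0 JX J0; rewrite /mesh_limit; apply: cvg_lim => //.
apply/cvgrPdist_le => e e0.
pose c := B * T%:num + 1.
have c0 : 0 < c by rewrite ltr_wpDl // mulr_ge0.
(* Solves d^(th - 1) = e / c, where c exceeds B times the length of the interval. *)
pose d := (e / c) `^ (th - 1)^-1.
have d0 : 0 < d by apply: powR_gt0; rewrite divr_gt0.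
have dE : d `^ (th - 1) = e / c.
  rewrite /d -powRrM mulVf ?powRr1 //; first by rewrite ltW // divr_gt0.
  by rewrite gt_eqF // subr_gt0.
exists d => // l [pl ll] sl.
rewrite -psumE.
have pl' : path (@tle R T) (time0 T) l.
  move: pl; rewrite -[0]/(\val (time0 T)) path_map; apply: sub_path => u v /= uv; exact: ltW.
have lt : last (time0 T) l = t by apply: val_inj; rewrite -(last_map \val); exact/eqP.
have := psum_approx th1 B0 d0 JX pl' sl; rewrite lt J0 subr0 /= subr0 dE.
move=> /le_trans; apply; have /andP[t0 tT] := val_time t.
rewrite [leLHS](_ : _ = e * (B * \val t / c)); last by rewrite /=; ring.
rewrite -[leRHS]mulr1; apply: ler_wpM2l; first exact: ltW.
rewrite ler_pdivrMr // mul1r /c.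
have : B * \val t <= B * T%:num by apply: ler_wpM2l.
by move=> H; rewrite (le_trans H) // lerDl.
Qed.

Definition midpt s t : I := mkt T ((\val s + \val t) / 2).

Lemma val_midpt s t : \val (midpt s t) = (\val s + \val t) / 2.
Proof.
rewrite val_mkt //; have /andP[s0 sT] := val_time s; have /andP[t0 tT] := val_time t.
apply/andP; split; lra.
Qed.

Lemma tdist_midptl s t : tdist s (midpt s t) = tdist s t / 2.
Proof.
rewrite /tdist val_midpt -[2^-1 in RHS]ger0_norm ?invr_ge0 // -normrM; congr `|_|; lra.
Qed.

Lemma tdist_midptr s t : tdist (midpt s t) t = tdist s t / 2.
Proof.
rewrite /tdist val_midpt -[2^-1 in RHS]ger0_norm ?invr_ge0 // -normrM; congr `|_|; lra.
Qed.

(** The solution of K = 2 * 2^(-th) * K + 1: the two halves of a bisection and a single defect. *)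
Definition apriori_const (th : R) : R := (1 - 2 * half th)^-1.

(** Sewing estimate without construction: iterate the bisection and let the
    qualitative bound, of order [th0 > 1], absorb the remainder. *)
Lemma sewing_apriori (G : I -> I -> R) (S : set I) (B C th th0 : R) s t :
  1 < th -> 1 < th0 -> 0 <= B -> 0 <= C ->
  (forall u v, S u -> S v -> S (midpt u v)) -> S s -> S t ->
  (forall u v, S u -> S v -> `|G u v| <= B * tdist u v `^ th0) ->
  (forall u v, S u -> S v ->
    `|G u v - G u (midpt u v) - G (midpt u v) v| <= C * tdist u v `^ th) ->
  `|G s t| <= apriori_const th * C * tdist s t `^ th.
Proof.
move=> th1 th01 B0 C0 Smid Ss St GB GC.
have h1 := half_lt th1; have h10 := half_lt th01.
have K0 : 0 < apriori_const th by rewrite invr_gt0 subr_gt0.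
have KE : 2 * half th * apriori_const th + 1 = apriori_const th.
  by rewrite /apriori_const; field; rewrite gt_eqF // subr_gt0.
have main n : forall u v, S u -> S v -> `|G u v| <= apriori_const th * C * tdist u v `^ th +
    B * (2 * half th0) ^+ n * tdist u v `^ th0.
  elim: n => [|n IH] u v Su Sv.
    rewrite expr0 mulr1; apply: le_trans (GB _ _ Su Sv) _; rewrite lerDr.
    by rewrite mulr_ge0 ?powR_ge0 // mulr_ge0 // ltW.
  set m := midpt u v; have Sm : S m by exact: Smid.
  have := IH _ _ Su Sm; have := IH _ _ Sm Sv; have := GC _ _ Su Sv; rewrite -/m.
  rewrite tdist_midptl tdist_midptr !powR_half ?tdist_ge0 // => g0 g1 g2.
  have -> : G u v = (G u v - G u m - G m v) + G u m + G m v by ring.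
  apply: le_trans (ler_normD _ _) _; apply: (le_trans (lerD (ler_normD _ _) (lexx _))).
  rewrite -{1}KE exprS; move: g0 g1 g2; set q := 2 * half th0.
  move: (tdist u v `^ th) (tdist u v `^ th0) => x y g0 g1 g2.
  apply: le_trans (lerD (lerD g0 g2) g1) _; rewrite /q.
  by rewrite le_eqVlt; apply/orP; left; apply/eqP; ring.
apply/ler_addgt0Pr => e e0.
set x := tdist s t `^ th0 in main *.
have x0 : 0 <= x by exact: powR_ge0.
have q0 : 0 <= 2 * half th0 by rewrite mulr_ge0 // ltW // half_gt0.
have : geometric (B * x) (2 * half th0) @ \oo --> (0 : R).
  by apply: cvg_geometric; rewrite ger0_norm.
move=> /cvgrPdist_le/(_ e e0)[n _ /(_ n (leqnn n))] /=.
rewrite sub0r normrN => Hn; apply: le_trans (main n _ _ Ss St) _; rewrite lerD2l.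
by rewrite mulrAC (le_trans (ler_norm _)).
Qed.

End MeshLimit.

(** * The remainder of a section *)

Section HoelderNorm.
Variables (R : realType) (T : {posnum R}).
Local Notation I := (time T).
Implicit Types (s t u : I) (F G : I -> I -> R) (g : R).

Lemma tdist_gt0 s t : s <> t -> 0 < tdist s t.
Proof.
move=> st; rewrite lt_def tdist_ge0 andbT; apply: contra_notN st => /eqP.
exact: tdist_eq0.
Qed.

Lemma hoelder_le g F C : (forall s t, s <> t -> `|F s t| <= C * tdist s t `^ g) ->
  (hoelder g F <= C%:E)%E.
Proof.
move=> FC; apply: ge_ereal_sup => _ [[s t] /= st <-].
by rewrite lee_fin ler_pdivrMr ?powR_gt0 ?tdist_gt0 //; exact: FC.
Qed.

Lemma hoelder_ge g F C s t : (hoelder g F <= C%:E)%E -> s <> t ->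
  `|F s t| <= C * tdist s t `^ g.
Proof.
move=> FC st; have := le_trans (ereal_sup_ubound _) FC.
move=> /(_ (`|F s t| / tdist s t `^ g)%:E); rewrite lee_fin ler_pdivrMr ?powR_gt0 ?tdist_gt0 //.
by apply; exists (s, t).
Qed.

Lemma hoelder_ge0 g F : (0 <= hoelder g F)%E.
Proof.
have T01 : time0 T <> mkt T T%:num.
  move=> /(congr1 \val); rewrite val_mkt; last by rewrite lexx andbT.
  by move=> /esym/eqP; rewrite /= gt_eqF.
apply: le_trans (ereal_sup_ubound _); last by exists (time0 T, mkt T T%:num).
by rewrite lee_fin divr_ge0 // powR_ge0.
Qed.

Lemma hoelder_fin g F : (hoelder g F < +oo)%E -> exists2 C, 0 <= C & (hoelder g F <= C%:E)%E.
Proof.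
move=> Ffin; exists (fine (hoelder g F)); first exact/fine_ge0/hoelder_ge0.
by rewrite fineK // ge0_fin_numE // hoelder_ge0.
Qed.

Lemma hoelderD g F G :
  (hoelder g (fun s t => F s t + G s t)%R <= hoelder g F + hoelder g G)%E.
Proof.
have [Ff|] := boolP (hoelder g F < +oo)%E; last first.
  rewrite -leNgt leye_eq => /eqP ->; rewrite addye ?leey //.
  by rewrite gt_eqF // (lt_le_trans _ (hoelder_ge0 _ _)) // ltNy0.
have [Gf|] := boolP (hoelder g G < +oo)%E; last first.
  rewrite -leNgt leye_eq => /eqP ->; rewrite addey ?leey //.
  by rewrite gt_eqF // (lt_le_trans _ (hoelder_ge0 _ _)) // ltNy0.
have fF : hoelder g F \is a fin_num by rewrite ge0_fin_numE ?hoelder_ge0.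
have fG : hoelder g G \is a fin_num by rewrite ge0_fin_numE ?hoelder_ge0.
rewrite -(fineK fF) -(fineK fG) -EFinD; apply: hoelder_le => s t st.
apply: le_trans (ler_normD _ _) _; rewrite mulrDl; apply: lerD.
  by apply: hoelder_ge st; rewrite fineK.
by apply: hoelder_ge st; rewrite fineK.
Qed.

(** The constant depends only on a bound D for the difference of the exponents; the base 1 + T is at
    least 1, so its powers increase with the exponent. *)
Lemma powR_le_exp (x a b D : R) : 0 <= x <= T%:num -> 0 <= a -> a <= b -> b <= a + D ->
  (0 < a \/ a = b) -> x `^ b <= (1 + T%:num) `^ D * x `^ a.
Proof.
move=> /andP[x0 xT] a0 ab bD apos.
have c1 : 1 <= (1 + T%:num) `^ D.
  apply: (@le_trans _ _ ((1 + T%:num) `^ 0)); first by rewrite powRr0.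
  by apply: ler_powR; [rewrite lerDl|lra].
have [x00|x00] := eqVneq x 0.
  case: apos => [a1|<-]; last by rewrite ler_peMl // powR_ge0.
  rewrite x00 powR0; last by rewrite gt_eqF // (lt_le_trans a1).
  by rewrite mulr_ge0 // powR_ge0.
have -> : b = a + (b - a) by rewrite addrC subrK.
rewrite powRD; last by rewrite x00 implybT.
rewrite mulrC; apply: ler_wpM2r; first exact: powR_ge0.
apply: (@le_trans _ _ ((1 + T%:num) `^ (b - a))).
  apply: le_powR_base => //; first by rewrite subr_ge0.
  by rewrite (le_trans xT) // lerDr.
by apply: ler_powR; [rewrite lerDl|lra].
Qed.

End HoelderNorm.

Section Bounds.
Variables (R : realType) (A : finType) (T : {posnum R}) (alpha : R).
Local Notation F := (forest A).
Local Notation H := {malg R[F]}.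
Local Notation I := (time T).
Local Notation cop := (@cop R A).
Local Notation N := (Nlevel alpha).
Implicit Types (X Y : rough_path A T alpha) (h g : F) (s t u a b : I) (z : H) (Z : I -> H).

Definition FL : {fset F} := fset_set (@forest_le A N.-1).

Lemma in_FL h : (h \in FL) = (nodes h <= N.-1)%N.
Proof.
rewrite /FL in_fset_set; last exact: finite_forest_le.
by apply/idP/idP; rewrite inE.
Qed.

Lemma pairing_FL phi z : on_supp (forest_le N.-1) z ->
  pairing phi z = \sum_(g <- FL) z@_g * phi g.
Proof.
move=> zF; rewrite pairingE (@lextEw _ _ _ _ FL) //.
by apply/fsubsetP => g /zF gN; rewrite in_FL.
Qed.

Definition norm1 z : R := \sum_(k <- msupp z) `|z@_k|.

Lemma norm1_ge0 z : 0 <= norm1 z. Proof. by apply: sumr_ge0 => k _; exact: normr_ge0. Qed.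

Lemma pairing_bound phi z (b : R) : (forall k, k \in msupp z -> `|phi k| <= b) ->
  `|pairing phi z| <= norm1 z * b.
Proof.
move=> phib; rewrite /pairing /norm1 mulr_suml; apply: le_trans (ler_norm_sum _ _ _) _.
rewrite !big_seq; apply: ler_sum => k kz; rewrite normrM; apply: ler_wpM2l => //.
exact: phib.
Qed.

(** The left factors of the terms of Delta g whose right factor is h: the value of X * h at g is
    that of X at [sk h g]. *)
Definition sk h g : H := lext (fun k => (k.2 == h)%:R *: bas k.1 : H) (cop g).

Lemma star_sk phi h g : star phi (dirac R h) g = pairing phi (sk h g).
Proof.
rewrite starE pairingE lext_lext; apply: eq_lext => k.
by rewrite diracE linearZ /= lextU mulrC.
Qed.

Lemma sk_nodes h g : on_supp (fun k => nodes k + nodes h = nodes g)%N (sk h g).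
Proof.
apply: (on_supp_lext (@cop_nodes R A g)) => k kg; case: eqP => [kh|_].
  by rewrite scale1r; apply: on_suppU; rewrite -kh.
by rewrite scale0r; exact: on_supp0.
Qed.

Definition csk : R := \sum_(h <- FL) \sum_(g <- FL) norm1 (sk h g).

Lemma le_fsum (K : choiceType) (S : {fset K}) (f : K -> R) k : (forall l, 0 <= f l) ->
  k \in S -> f k <= \sum_(l <- S) f l.
Proof.
move=> f0 kS; rewrite (big_fsetD1 k) //= lerDl.
by apply: sumr_ge0 => l _; exact: f0.
Qed.

Lemma norm1_sk h g : h \in FL -> g \in FL -> norm1 (sk h g) <= csk.
Proof.
move=> hF gF; apply: (@le_trans _ _ (\sum_(g <- FL) norm1 (sk h g))).
  by apply: (le_fsum (f := fun g => norm1 (sk h g))) => // l; exact: norm1_ge0.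
apply: (le_fsum (f := fun h => \sum_(g <- FL) norm1 (sk h g))) => // l.
by apply: sumr_ge0 => k _; exact: norm1_ge0.
Qed.

Lemma csk_ge0 : 0 <= csk.
Proof. by do 2!apply: sumr_ge0 => ? _; exact: norm1_ge0. Qed.

Definition bdd X (M : R) := forall h, (nodes h <= N)%N -> forall s t,
  `|rp X s t h| <= M * tdist s t `^ (alpha *+ nodes h).

Definition close X Y (d : R) := forall h, (nodes h <= N)%N -> forall s t,
  `|rp X s t h - rp Y s t h| <= d * tdist s t `^ (alpha *+ nodes h).

(** The functional (X_{s,t} - 1) * h, whose value at Z_s is the germ. *)
Definition chi X h s t : F -> R := star (fun k => rp X s t k - counit R k) (dirac R h).

Lemma chi_low X h s t g : (nodes g <= nodes h)%N -> chi X h s t g = 0.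
Proof.
move=> gh; rewrite /chi star_sk pairingE -[RHS](lext0f R^o (sk h g)).
apply: eq_in_lext => k /sk_nodes kg.
have /eqP : nodes k = 0%N by apply/eqP; rewrite -leqn0 -(leq_add2r (nodes h)) kg.
by rewrite nodes_eq0 => /eqP ->; rewrite rp_mone /counit eqxx subrr.
Qed.

Lemma FL_leN g : g \in FL -> (nodes g <= N)%N.
Proof. by rewrite in_FL => /leq_trans; apply; exact: leq_pred. Qed.

Lemma sk_bound (phi : F -> R) (M : R) h s t g : 0 <= M -> h \in FL -> g \in FL ->
  (forall k, (nodes k <= N)%N -> (nodes k + nodes h = nodes g)%N ->
    `|phi k| <= M * tdist s t `^ (alpha *+ nodes k)) ->
  `|star phi (dirac R h) g| <= csk * M * tdist s t `^ (alpha *+ (nodes g - nodes h)).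
Proof.
move=> M0 hF gF phiM; rewrite star_sk -mulrA.
have x0 : 0 <= M * tdist s t `^ (alpha *+ (nodes g - nodes h)).
  by rewrite mulr_ge0 // powR_ge0.
apply: le_trans (@pairing_bound _ _ (M * tdist s t `^ (alpha *+ (nodes g - nodes h))) _) _.
  move=> k /sk_nodes kg; have := phiM k _ kg; rewrite -kg addnK; apply.
  by apply: leq_trans (FL_leN gF); rewrite -kg leq_addr.
by apply: ler_wpM2r => //; exact: norm1_sk.
Qed.

Lemma chi_bound X M h s t g : bdd X M -> 0 <= M -> h \in FL -> g \in FL ->
  `|chi X h s t g| <= csk * M * tdist s t `^ (alpha *+ (nodes g - nodes h)).
Proof.
move=> XM M0 hF gF; have [gh|gh] := leqP (nodes g) (nodes h).
  by rewrite chi_low // normr0 mulr_ge0 ?powR_ge0 // mulr_ge0 // csk_ge0.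
apply: sk_bound => // k kN kg; rewrite /counit.
have /negPf -> : k != mone.
  by apply: contraTneq gh => k1; rewrite -kg k1 nodes1 ltnn.
by rewrite subr0; exact: XM.
Qed.

Lemma chi_close X Y d h s t g : close X Y d -> 0 <= d -> h \in FL -> g \in FL ->
  `|chi X h s t g - chi Y h s t g| <=
    csk * d * tdist s t `^ (alpha *+ (nodes g - nodes h)).
Proof.
move=> XY d0 hF gF; have -> : chi X h s t g - chi Y h s t g =
    star (fun k => rp X s t k - rp Y s t k) (dirac R h) g.
  by rewrite /chi !starBl opprB addrA subrK.
by apply: sk_bound => // k kN _; exact: XY.
Qed.

Lemma star_bound X M h s t g : bdd X M -> 0 <= M -> h \in FL -> g \in FL ->
  `|star (rp X s t) (dirac R h) g| <= csk * M * tdist s t `^ (alpha *+ (nodes g - nodes h)).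
Proof. by move=> XM M0 hF gF; apply: sk_bound => // k kN _; exact: XM. Qed.

Lemma rough_bound X : 0 < alpha -> exists2 M, 1 <= M & bdd X M.
Proof.
move=> a0; have /choice[C CP] : forall h, exists C, 0 <= C /\
    forall s t, `|rp X s t h| <= C * tdist s t `^ (alpha *+ nodes h).
  move=> h; have [C C0 HC] := hoelder_fin (rp_hoelder X h).
  (* The Hoelder seminorm ignores s = t; the added 1 covers the empty forest there, where X is 1 and
     the power is 0^0 = 1. *)
  exists (C + 1); split=> [|s t]; first by rewrite addr_ge0.
  have [->|/eqP st] := eqVneq s t; last first.
    by apply: le_trans (hoelder_ge HC st) _; rewrite mulrDl lerDl mul1r powR_ge0.
  rewrite rp_diag tdistxx /counit; case: eqVneq => [->|h1].
    by rewrite nodes1 mulr0n powRr0 mulr1 normr1 lerDr.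
  by rewrite normr0 mulr_ge0 ?powR_ge0 // addr_ge0.
pose S := fset_set (@forest_le A N).
have inS h : (h \in S) = (nodes h <= N)%N.
  rewrite in_fset_set; last exact: finite_forest_le.
  by apply/idP/idP; rewrite inE.
exists (1 + \sum_(h <- S) C h).
  by rewrite lerDl; apply: sumr_ge0 => h _; case: (CP h).
move=> h hN s t; have [C0 HC] := CP h; apply: le_trans (HC s t) _.
apply: ler_wpM2r; first exact: powR_ge0.
apply: (@le_trans _ _ (\sum_(k <- S) C k)); last by rewrite lerDr.
by apply: le_fsum => [k|]; [case: (CP k)|rewrite inS].
Qed.

Lemma rough_dist_close X Y d : 0 < alpha -> 0 < d -> (rough_dist X Y < d%:E)%E -> close X Y d.
Proof.
move=> a0 d0 XY h hN s t; have [->|h1] := eqVneq h mone.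
  by rewrite !rp_mone subrr normr0 mulr_ge0 ?powR_ge0 // ltW.
have [->|/eqP st] := eqVneq s t.
  by rewrite !rp_diag subrr normr0 mulr_ge0 ?powR_ge0 // ltW.
have := hoelder_ge (F := fun s t => rp X s t h - rp Y s t h) _ st; apply.
apply: le_trans (ltW XY); apply: ereal_sup_ubound.
by exists h => //; split=> //; exact/eqP.
Qed.

Lemma close_bdd X Y M d : 0 <= d -> bdd X M -> close X Y d -> bdd Y (M + d).
Proof.
move=> d0 XM XY h hN s t; rewrite mulrDl -[rp Y s t h](subKr (rp X s t h)).
apply: le_trans (ler_normB _ _) _; apply: lerD; [exact: XM|exact: XY].
Qed.

End Bounds.

(** * Existence: the sections satisfy their characterisation *)

Section GammaSewing.
Variables (R : realType) (A : finType) (T : {posnum R}) (alpha eps : R).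
Local Notation F := (forest A).
Local Notation H := {malg R[F]}.
Local Notation I := (time T).
Local Notation N := (Nlevel alpha).
Local Notation FL := (@FL R A alpha).
Variable P : set H.
Hypothesis HP : primitive_basis P.
Hypothesis Ha : 0 < alpha < 1.
Hypothesis Heps : 0 < eps < 1 - N%:R * alpha.
Implicit Types (X Y : rough_path A T alpha) (h g : F) (s t u a b : I) (z : H) (Z : I -> H).

(** The order of an additivity defect: 1 - eps from a remainder and alpha from an increment of X. *)
Let th : R := 1 - eps + alpha.

Lemma N_gt0 : (0 < N)%N.
Proof.
case/andP: Ha => a0 a1; rewrite /Nlevel truncn_gt0 -[leLHS]invr1.
by rewrite lef_pV2 ?posrE // ltW.
Qed.

Lemma N1alpha : 1 < N.+1%:R * alpha.
Proof.
case/andP: Ha => a0 a1; rewrite -ltr_pdivrMr // div1r /Nlevel.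
exact: truncnS_gt.
Qed.

Lemma th_gt1 : 1 < th.
Proof.
have := N1alpha; case/andP: Heps => e0 e1; rewrite -natr1 mulrDl mul1r /th.
by move: (N%:R * alpha) e1 => x; lra.
Qed.

Lemma gam_gtN : N%:R * alpha < 1 - eps.
Proof. by case/andP: Heps => e0; lra. Qed.

Lemma alpha_le_N n : (0 < n)%N -> alpha <= alpha *+ n.
Proof.
by case/andP: Ha => a0 _; case: n => // n _; rewrite mulrS lerDl mulrn_wge0 // ltW.
Qed.

Lemma gam_gt0 : 0 < 1 - eps.
Proof.
apply: lt_trans gam_gtN; case/andP: Ha => a0 _.
by rewrite mulr_gt0 // ltr0n N_gt0.
Qed.

Lemma coeff_fsum (D : set F) (c : F -> R) g : finite_set D ->
  (\sum_(h \in D) << c h *g h >>)@_g = if g \in D then c g else 0.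
Proof.
move=> finD; rewrite fsbig_finite //= raddf_sum /=.
case: ifPn => gD.
  rewrite (big_fsetD1 g) /=; last by rewrite in_fset_set.
  rewrite mcoeffUU big1_fset ?addr0 // => h; rewrite !inE => /andP[/negPf hg _] _.
  by rewrite mcoeffU hg.
rewrite big1_fset // => h; rewrite in_fset_set // => hD _; rewrite mcoeffU.
by case: eqP => // hg; rewrite -hg hD in gD.
Qed.

Lemma finite_level n : finite_set [set h : F | nodes h = n].
Proof. by apply: sub_finite_set (@finite_forest_le A n) => h hn; rewrite /forest_le /= hn. Qed.

Lemma in_level n h : (h \in [set h : F | nodes h = n]) = (nodes h == n).
Proof. by apply/idP/eqP; rewrite inE. Qed.

Variable f : F -> I -> R.
Local Notation Gu := (@Gamma_upto R A T alpha P).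

Lemma Gamma_upto_coeff X k t h :
  (Gu X f k.+1 t)@_h = (Gu X f k t)@_h +
    (if nodes h == (N.-1 - k.+1)%N then integral_sum P X (Gu X f k) h t + f h t else 0).
Proof.
rewrite /= mcoeffD coeff_fsum; last exact: finite_level.
by rewrite in_level.
Qed.

Lemma Gamma_upto_supp X k t : (k <= N.-1)%N ->
  on_supp (fun h => N.-1 - k <= nodes h <= N.-1)%N (Gu X f k t).
Proof.
elim: k => [|k IH] kN h; rewrite -mcoeff_neq0.
  rewrite /= coeff_fsum; last exact: finite_level.
  rewrite in_level; case: (eqVneq (nodes h) N.-1) => [->|]; last by rewrite eqxx.
  by rewrite subn0 leqnn.
rewrite Gamma_upto_coeff; case: (eqVneq (nodes h) (N.-1 - k.+1)%N) => [-> _|_].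
  by rewrite leqnn leq_subr.
rewrite addr0 mcoeff_neq0 => /(IH (ltnW kN))/andP[h1 h2].
by rewrite h2 andbT (leq_trans _ h1) // leq_sub2l.
Qed.

Lemma Gamma_upto_span X k : (k <= N.-1)%N -> span_valued alpha (Gu X f k).
Proof. by move=> kN t h /(Gamma_upto_supp kN)/andP[]. Qed.

Lemma shift_supp phi z n : on_supp (fun h => nodes h <= n)%N z ->
  on_supp (fun h => nodes h <= n)%N (shift phi z).
Proof.
move=> zn; rewrite shift.unlock lext_lext; apply: (on_supp_lext zn) => h hn.
apply: (on_supp_lext (@cop_nodes R A h)) => k kh; apply: on_suppZ; apply: on_suppU.
by apply: leq_trans hn; rewrite -kh leq_addl.
Qed.

Lemma rem_supp X Z s t : span_valued alpha Z -> on_supp (forest_le N.-1) (rem X Z s t).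
Proof.
move=> spanZ; rewrite /rem -scaleN1r; apply: on_suppD; first exact: spanZ.
by apply: on_suppZ; apply: shift_supp; exact: spanZ.
Qed.

(** X - 1 vanishes on the empty forest, so the germ at h only involves components of degree above
    |h|. This is what makes the decreasing recursion of [Gamma_upto] compatible with germs of the
    complete path. *)
Lemma germ_eq X Z Z' h s t :
  (forall g, (nodes h < nodes g)%N -> (Z s)@_g = (Z' s)@_g) ->
  germ X Z h s t = germ X Z' h s t.
Proof.
move=> ZZ'; apply/eqP; rewrite -subr_eq0 !germE -pairingB pairingE; apply/eqP.
rewrite -[RHS](lext0f R^o (Z s - Z' s)); apply: eq_in_lext => g.
rewrite -mcoeff_neq0 mcoeffB; have [gh|gh] := ltnP (nodes h) (nodes g).
  by rewrite ZZ' // subrr eqxx.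
by move=> _; exact: chi_low.
Qed.

Definition dominated (phi : I -> I -> F -> R) k := exists2 B, 0 <= B &
  forall s t, `|phi s t k| <= B * tdist s t `^ alpha.

Lemma dominated_sum (K : choiceType) (phi : I -> I -> K -> R) (z : {malg R[K]}) :
  (forall k, k \in msupp z -> exists2 B, 0 <= B &
     forall s t, `|phi s t k| <= B * tdist s t `^ alpha) ->
  exists2 B, 0 <= B & forall s t, `|pairing (phi s t) z| <= B * tdist s t `^ alpha.
Proof.
rewrite /pairing => dom; have {dom} : forall k, k \in enum_fset (msupp z) ->
  exists2 B, 0 <= B & forall s t, `|phi s t k| <= B * tdist s t `^ alpha by [].
elim: (enum_fset (msupp z)) => [|k l IH] dom.
  by exists 0 => // s t; rewrite big_nil normr0 mul0r.
have [B B0 HB] := IH (fun j jl => dom j (@mem_behead _ (k :: l) _ jl)).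
have [C C0 HC] := dom k (mem_head _ _).
exists (`|z@_k| * C + B); first by rewrite addr_ge0 // mulr_ge0.
move=> s t; rewrite big_cons mulrDl; apply: le_trans (ler_normD _ _) _.
apply: lerD; last exact: HB.
by rewrite normrM -mulrA; apply: ler_wpM2l => //; exact: HC.
Qed.

(** All forests of k \top p are nonempty because p has positive degree, so the order is at least
    alpha. *)
Lemma rpt_dominated X p k : P p -> dominated (rpt X p) k.
Proof.
move=> Pp; rewrite /dominated /rpt; apply: dominated_sum => l.
move=> /(gt_nodes (Phom HP Pp)) ln; have l0 : (0 < nodes l)%N.
  by rewrite ln addn_gt0 (P_hdeg_gt0 HP Pp) orbT.
have [C C0 HC] := hoelder_fin (rp_hoelder X l).
case/andP: Ha => a0 a1.
exists (C * (1 + T%:num) `^ (alpha *+ nodes l)); first by rewrite mulr_ge0 // powR_ge0.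
move=> s t; have [->|/eqP st] := eqVneq s t.
  rewrite rp_diag /counit (_ : (l == mone) = false); first by rewrite normr0 mulr_ge0 ?powR_ge0 // mulr_ge0 // powR_ge0.
  by rewrite -nodes_eq0 gtn_eqF.
apply: le_trans (hoelder_ge HC st) _; rewrite -mulrA; apply: ler_wpM2l => //.
apply: powR_le_exp; rewrite ?tdist_ge0 ?tdist_leT ?alpha_le_N //; last by left.
  exact: ltW.
by rewrite lerDr ltW.
Qed.

Lemma star_dominated phi psi g : (forall k, dominated phi k) ->
  dominated (fun s t => star (phi s t) psi) g.
Proof.
move=> dom; rewrite /dominated /star; apply: (dominated_sum
  (phi := fun s t (k : F * F) => phi s t k.1 * psi k.2)) => k _.
have [B B0 HB] := dom k.1; exists (B * `|psi k.2|); first by rewrite mulr_ge0.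
move=> s t; rewrite normrM mulrAC; apply: ler_wpM2r => //; exact: HB.
Qed.

Lemma prod_powR_le (x y c d : R) : 0 <= x -> 0 <= y -> 0 < c -> 0 < d ->
  x `^ c * y `^ d <= (x + y) `^ (c + d).
Proof.
move=> x0 y0 c0 d0; rewrite powRD; last by rewrite gt_eqF ?addr_gt0.
by apply: ler_pM; rewrite ?powR_ge0 //; apply: le_powR_base => //;
  rewrite ?(ltW c0) ?(ltW d0) // ?lerDl ?lerDr.
Qed.

(** The characterisation of Gamma_X f at the single component h, to be propagated downwards in
    degree. The constant B is qualitative: no uniformity is claimed for it. *)
Definition gamma_at X Z h := (Z (time0 T))@_h = f h (time0 T) /\
  exists2 B, 0 <= B &
    forall s t, `|(rem X Z s t)@_h - (f h t - f h s)| <= B * tdist s t `^ th.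

Hypothesis f_hoelder : forall h, h \in FL -> exists2 B, 0 <= B &
  forall s t, `|f h t - f h s| <= B * tdist s t `^ (1 - eps).

Lemma gamma_at_rem X Z h : h \in FL -> gamma_at X Z h -> exists2 B, 0 <= B &
  forall s t, `|(rem X Z s t)@_h| <= B * tdist s t `^ (1 - eps).
Proof.
move=> hF [_ [B B0 HB]]; have [C C0 HC] := f_hoelder hF; case/andP: Ha => a0 a1.
exists (B * (1 + T%:num) `^ alpha + C).
  by rewrite addr_ge0 // mulr_ge0 // powR_ge0.
move=> s t; rewrite -[(rem X Z s t)@_h](subrK (f h t - f h s)).
apply: le_trans (ler_normD _ _) _; rewrite mulrDl; apply: lerD => //.
apply: le_trans (HB s t) _; rewrite -mulrA; apply: ler_wpM2l => //.
apply: powR_le_exp; rewrite ?tdist_ge0 ?tdist_leT //.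
- exact/ltW/gam_gt0.
- by rewrite /th lerDl ltW.
- by left; exact: gam_gt0.
Qed.

(** By [pgerm_chen] the defect is a sum of products of a remainder, of order 1 - eps, and an
    increment of X^(. \top p), of order alpha. Only remainders at g with |g| >= |p| + |h| enter, and
    |p| > 0 puts them above the degree of h. *)
Lemma pgerm_sewing X Z h p : P p -> span_valued alpha Z ->
  (forall g, g \in FL -> (nodes h < nodes g)%N -> exists2 B, 0 <= B &
     forall s t, `|(rem X Z s t)@_g| <= B * tdist s t `^ (1 - eps)) ->
  exists J : I -> R, [/\ J (time0 T) = 0, forall t, mesh_limit (pgerm P X Z h p) t = J t
    & exists2 B, 0 <= B &
      forall s t, `|J t - J s - pgerm P X Z h p s t| <= B * tdist s t `^ th].
Proof.
move=> Pp spanZ Zrem; case/andP: Ha => a0 a1.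
pose psi := star (pdual P p) (dirac R h).
have psih : fhom (hdeg p + nodes h)%N psi.
  by apply: fhom_star; [exact/(fhom_dual HP)/PtopP|exact: fhom_dirac].
have /choice[C CP] : forall g, exists C, 0 <= C /\ (g \in FL -> forall s u t,
    `|(rem X Z s u)@_g * star (rpt X p u t) psi g| <= C * (tdist s u + tdist u t) `^ th).
  move=> g; have [gF|] := boolP (g \in FL); last by exists 0.
  have [gh|gh] := ltnP (nodes g) (hdeg p + nodes h).
    exists 0; split=> // _ s u t; by rewrite (star_low _ psih gh) mulr0 normr0 mul0r.
  have hg : (nodes h < nodes g)%N.
    by apply: leq_trans gh; rewrite -addn1 addnC leq_add2r (P_hdeg_gt0 HP Pp).
  have [B B0 HB] := Zrem _ gF hg.
  have [D D0 HD] := @star_dominated _ psi g (fun k => @rpt_dominated X p k Pp).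
  exists (B * D); split=> [|_ s u t]; first exact: mulr_ge0.
  rewrite normrM; apply: le_trans (ler_pM (normr_ge0 _) (normr_ge0 _) (HB s u) (HD u t)) _.
  rewrite mulrACA; apply: ler_wpM2l; first exact: mulr_ge0.
  by apply: prod_powR_le; rewrite ?tdist_ge0 // gam_gt0.
have C0 : 0 <= \sum_(g <- FL) C g by apply: sumr_ge0 => g _; case: (CP g).
have chen s u t : `|pgerm P X Z h p s t - pgerm P X Z h p s u - pgerm P X Z h p u t| <=
    (\sum_(g <- FL) C g) * (tdist s u + tdist u t) `^ th.
  rewrite (pgerm_chen HP) // normrN (pairing_FL (alpha := alpha)); last exact: rem_supp.
  apply: le_trans (ler_norm_sum _ _ _) _; rewrite mulr_suml big_seq [leRHS]big_seq.
  by apply: ler_sum => g gF; have [_] := CP g; apply.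
have [J [J0 [B [B0 HJ]]]] := sewing_exists th_gt1 C0 chen.
exists J; split=> //; last by exists B.
by move=> t; apply: (@mesh_limitE _ _ _ J B th) => [||u v _|//]; [exact: th_gt1|exact: B0|exact: HJ].
Qed.

Lemma germ_sewing X Z h : h \in FL -> span_valued alpha Z ->
  (forall g, g \in FL -> (nodes h < nodes g)%N -> exists2 B, 0 <= B &
     forall s t, `|(rem X Z s t)@_g| <= B * tdist s t `^ (1 - eps)) ->
  integral_sum P X Z h (time0 T) = 0 /\ exists2 B, 0 <= B &
    forall s t, `|integral_sum P X Z h t - integral_sum P X Z h s - germ X Z h s t| <=
      B * tdist s t `^ th.
Proof.
move=> hF spanZ Zrem; rewrite /integral_sum.
pose D := [set p : H | P p /\ (hdeg p < N - nodes h)%N].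
have finD : finite_set D.
  by apply: sub_finite_set (finite_P_le HP (N - nodes h)%N) => rho [Pr /ltnW].
have Dmem p : p \in fset_set D -> P p by rewrite in_fset_set // inE => -[].
have /choice[J JP] : forall p, exists J : I -> R, P p ->
   [/\ J (time0 T) = 0, forall t, mesh_limit (pgerm P X Z h p) t = J t
    & exists2 B, 0 <= B &
      forall s t, `|J t - J s - pgerm P X Z h p s t| <= B * tdist s t `^ th].
  move=> p; have [Pp|nP] := pselect (P p); last by exists (fun=> 0).
  by have [J HJ] := pgerm_sewing Pp spanZ Zrem; exists J.
have intE t : \sum_(p \in D) mesh_limit (local_integral P X Z h p) t =
    \sum_(p <- fset_set D) J p t.
  rewrite fsbig_finite //=; apply: eq_big_seq => p /Dmem Pp.
  have [_ <- _] := JP _ Pp; congr mesh_limit.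
  by apply/funext => a; apply/funext => b; exact: (local_integralE HP N_gt0).
rewrite -/D; split.
  by rewrite intE big_seq big1 // => p /Dmem/JP[].
have /choice[B BP] : forall p, exists B, 0 <= B /\ (P p -> forall s t,
    `|J p t - J p s - pgerm P X Z h p s t| <= B * tdist s t `^ th).
  move=> p; have [/JP[_ _ [B B0 HB]]|nP] := pselect (P p); last by exists 0.
  by exists B.
exists (\sum_(p <- fset_set D) B p).
  by apply: sumr_ge0 => p _; case: (BP p).
move=> s t; rewrite !intE -(sum_pgerm HP N_gt0 X) //; last first.
  by move: hF; rewrite in_FL.
rewrite -/D fsbig_finite //= -!sumrB mulr_suml; apply: le_trans (ler_norm_sum _ _ _) _.
rewrite big_seq [leRHS]big_seq; apply: ler_sum => p /Dmem Pp.
by have [_] := BP p; apply.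
Qed.

Lemma gamma_at_ext X Z Z' h :
  (forall g, (nodes h <= nodes g)%N -> forall t, (Z' t)@_g = (Z t)@_g) ->
  gamma_at X Z h -> gamma_at X Z' h.
Proof.
move=> ZZ' [h0 [B B0 HB]]; split; first by rewrite ZZ'.
exists B => // s t; rewrite remE !ZZ' // (@germ_eq X Z' Z) -?remE //.
by move=> g hg; rewrite ZZ' // ltnW.
Qed.

Lemma gamma_at_step X Z Z' h : h \in FL -> span_valued alpha Z ->
  (forall g, (nodes h < nodes g)%N -> forall t, (Z' t)@_g = (Z t)@_g) ->
  (forall t, (Z' t)@_h = integral_sum P X Z h t + f h t) ->
  (forall g, g \in FL -> (nodes h < nodes g)%N -> gamma_at X Z g) ->
  gamma_at X Z' h.
Proof.
move=> hF spanZ high coefh Zat.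
have [|I0 [B B0 HB]] := @germ_sewing X Z h hF spanZ.
  by move=> g gF hg; apply: gamma_at_rem => //; exact: Zat.
split; first by rewrite coefh I0 add0r.
exists B => // s t; rewrite remE !coefh (@germ_eq X Z' Z); last first.
  by move=> g hg; rewrite high.
move: (integral_sum _ _ _ _ t) (integral_sum _ _ _ _ s) (germ _ _ _ _ _) (HB s t).
move=> x y c; rewrite (_ : x + f h t - (y + f h s) - c - (f h t - f h s) = x - y - c) //.
ring.
Qed.

Lemma Gamma_upto_at X k h : (k <= N.-1)%N -> h \in FL -> (N.-1 - k <= nodes h)%N ->
  gamma_at X (Gu X f k) h.
Proof.
elim: k h => [|k IH] h kN hF hk.
  have hN : nodes h = N.-1.
    by apply/eqP; move: hF; rewrite in_FL eqn_leq => ->; rewrite subn0 in hk.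
  have coefh t : (Gu X f 0 t)@_h = f h t.
    rewrite /= coeff_fsum; last exact: finite_level.
    by rewrite in_level hN eqxx.
  (* In the top degree there is no higher component for the germ to involve, and the remainder is
     the increment of f. *)
  have germ0 s t : germ X (Gu X f 0) h s t = 0.
    rewrite (@germ_eq X _ (fun=> 0)) => [|g hg].
      by rewrite /germ linear0 subrr mcoeff0.
    rewrite mcoeff0; apply: mcoeff_outdom; apply/negP.
    by move=> /(Gamma_upto_supp (leq0n _))/andP[_]; rewrite leqNgt -hN hg.
  split; first exact: coefh.
  exists 0 => // s t; rewrite remE !coefh germ0.
  by rewrite subr0 subrr normr0 mul0r.
have spank := @Gamma_upto_span X k (ltnW kN).
have high g : (N.-1 - k.+1 < nodes g)%N ->
    forall t, (Gu X f k.+1 t)@_g = (Gu X f k t)@_g.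
  by move=> hg t; rewrite Gamma_upto_coeff gtn_eqF // addr0.
have low g : nodes g = (N.-1 - k.+1)%N ->
    forall t, (Gu X f k.+1 t)@_g = integral_sum P X (Gu X f k) g t + f g t.
  move=> hg t; rewrite Gamma_upto_coeff hg eqxx mcoeff_outdom ?add0r //; apply/negP.
  move=> /(Gamma_upto_supp (ltnW kN))/andP[+ _]; rewrite hg leqNgt.
  by rewrite ltn_sub2l.
have {}IH g : g \in FL -> (N.-1 - k.+1 < nodes g)%N -> gamma_at X (Gu X f k) g.
  by move=> gF hg; apply: IH => //; [exact: ltnW|rewrite subnS in hg; lia].
have [hl|hh] := eqVneq (nodes h) (N.-1 - k.+1)%N; last first.
  have hhk : (N.-1 - k.+1 < nodes h)%N by rewrite ltn_neqAle eq_sym hh.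
  apply: gamma_at_ext (IH _ hF hhk) => g hg; apply: high.
  exact: leq_trans hg.
apply: (gamma_at_step hF spank) => [g hg||g gF hg].
- by apply: high; rewrite -hl.
- exact: low.
- by apply: IH; rewrite -?hl.
Qed.

Lemma Gamma_path_at X h : h \in FL -> gamma_at X (Gamma_path P f X) h.
Proof. by move=> hF; apply: Gamma_upto_at => //; rewrite subnn. Qed.

Lemma Gamma_path_span X : span_valued alpha (Gamma_path P f X).
Proof. exact: Gamma_upto_span. Qed.

End GammaSewing.

(** * Bounds for the remainders, uniform over bounded rough paths *)

Section Quantitative.
Variables (R : realType) (A : finType) (T : {posnum R}) (alpha eps : R).
Local Notation F := (forest A).
Local Notation H := {malg R[F]}.
Local Notation I := (time T).
Local Notation N := (Nlevel alpha).
Local Notation FL := (@FL R A alpha).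
Hypothesis Ha : 0 < alpha < 1.
Hypothesis Heps : 0 < eps < 1 - N%:R * alpha.
Implicit Types (X Y : rough_path A T alpha) (h g : F) (s t u a b : I) (z : H) (Z W : I -> H).
Implicit Types (f : F -> I -> R).

Local Notation th := (1 - eps + alpha).
Local Notation gam := (1 - eps).
Local Notation gamma_at f := (gamma_at eps f).

Let nF : R := \sum_(g <- FL) 1.
Let TN : R := (1 + T%:num) `^ (alpha *+ N).
Let cK : R := nF * (csk A alpha * TN).

Lemma cK_ge0 : 0 <= cK.
Proof.
rewrite mulr_ge0 //; first by apply: sumr_ge0.
by rewrite mulr_ge0 ?powR_ge0 ?csk_ge0.
Qed.

(** Increments of f are additive and drop out; what is left is the defect of the germ, up to
    sign. *)
Lemma rem_increment X Z f h s u t :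
  let G s t := (rem X Z s t)@_h - (f h t - f h s) in
  G s t - G s u - G u t = pairing (chi X h u t) (rem X Z s u).
Proof.
rewrite /= [RHS](_ : _ = - (germ X Z h s t - germ X Z h s u - germ X Z h u t)).
  rewrite !remE; move: (Z s)@_h (Z u)@_h (Z t)@_h (germ _ _ _ s t) (germ _ _ _ s u).
  by move: (germ _ _ _ u t) => x1 x2 x3 x4 x5 x6; ring.
by rewrite germ_chen opprK.
Qed.

Lemma powR_level n (x : R) : 0 <= x <= T%:num -> (0 < n <= N)%N ->
  x `^ (alpha *+ n) <= TN * x `^ alpha.
Proof.
case/andP: Ha => a0 a1 xT /andP[n0 nN]; apply: powR_le_exp => //.
- exact: ltW.
- exact: alpha_le_N.
- apply: (@le_trans _ _ (alpha *+ N)); last by rewrite lerDr ltW.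
  by apply: ler_wpMn2l => //; exact: ltW.
- by left.
Qed.

Lemma tdist_itv s t : 0 <= tdist s t <= T%:num.
Proof. by rewrite tdist_ge0 tdist_leT. Qed.

Lemma pairing_chi_bound (phi : F -> R) h s t w (b m : R) :
  on_supp (forest_le N.-1) w -> 0 <= m ->
  (forall g, g \in FL -> (nodes g <= nodes h)%N -> phi g = 0) ->
  (forall g, g \in FL ->
    `|phi g| <= csk A alpha * m * tdist s t `^ (alpha *+ (nodes g - nodes h))) ->
  (forall g, g \in FL -> (nodes h < nodes g)%N -> `|w@_g| <= b) -> 0 <= b ->
  `|pairing phi w| <= cK * (b * m) * tdist s t `^ alpha.
Proof.
move=> wF m0 phi0 phiM wb b0; rewrite (pairing_FL (alpha := alpha)) //.
apply: le_trans (ler_norm_sum _ _ _) _; rewrite /cK /nF -!mulrA mulr_suml.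
rewrite big_seq [leRHS]big_seq; apply: ler_sum => g gF; rewrite mul1r.
have [gh|hg] := leqP (nodes g) (nodes h).
  rewrite phi0 // mulr0 normr0.
  by do ?rewrite mulr_ge0 ?powR_ge0 ?csk_ge0.
rewrite normrM; apply: le_trans (ler_pM (normr_ge0 _) (normr_ge0 _) (wb g gF hg) (phiM g gF)) _.
have /(powR_level (tdist_itv s t)) le1 : (0 < nodes g - nodes h <= N)%N.
  rewrite subn_gt0 hg /=; apply: leq_trans (leq_subr _ _) _; exact: FL_leN gF.
have c0 : 0 <= csk A alpha * m * b by rewrite !mulr_ge0 // csk_ge0.
have := ler_wpM2l c0 le1; move: (tdist s t `^ _) (tdist s t `^ _) => x y.
by congr (_ <= _); ring.
Qed.

Lemma mid_powR_le s t : tdist s (midpt s t) `^ gam * tdist (midpt s t) t `^ alpha <=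
  tdist s t `^ th.
Proof.
case/andP: Ha => a0 a1; have g0 := gam_gt0 Ha Heps.
have hd : tdist s t / 2 + tdist s t / 2 = tdist s t by lra.
rewrite tdist_midptl tdist_midptr -[in leRHS]hd.
by apply: prod_powR_le => //; rewrite divr_ge0 // tdist_ge0.
Qed.

Let Tal : R := (1 + T%:num) `^ alpha.
Let Kth : R := apriori_const th.

Lemma Kth_ge0 : 0 <= Kth.
Proof. by rewrite invr_ge0 subr_ge0 ltW // half_lt // th_gt1. Qed.

Lemma KT_ge0 : 0 <= Kth * Tal.
Proof. exact: mulr_ge0 Kth_ge0 (powR_ge0 _ _). Qed.

(** B does not enter the conclusion. The order th given by sewing is lowered to 1 - eps on [0, T],
    at the price of (1 + T)^alpha, so that the result can be used as input in the next lower
    degree. *)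
Lemma apriori_global (G : I -> I -> R) (B C : R) s t : 0 <= B -> 0 <= C ->
  (forall u v, `|G u v| <= B * tdist u v `^ th) ->
  (forall u v, `|G u v - G u (midpt u v) - G (midpt u v) v| <=
    C * (tdist u (midpt u v) `^ gam * tdist (midpt u v) v `^ alpha)) ->
  `|G s t| <= Kth * Tal * C * tdist s t `^ gam.
Proof.
move=> B0 C0 GB GC; have th1 := th_gt1 Ha Heps; case/andP: Ha => a0 a1.
have := @sewing_apriori R T G setT B C th th s t th1 th1 B0 C0 (fun _ _ _ _ => Logic.I)
  Logic.I Logic.I (fun u v _ _ => GB u v).
have hC u v : `|G u v - G u (midpt u v) - G (midpt u v) v| <= C * tdist u v `^ th.
  apply: le_trans (GC u v) _; apply: ler_wpM2l => //; exact: mid_powR_le.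
move=> /(_ (fun u v _ _ => hC u v)) /le_trans; apply.
have le1 : tdist s t `^ th <= Tal * tdist s t `^ gam.
  apply: powR_le_exp; rewrite ?tdist_itv //.
  - exact/ltW/(gam_gt0 Ha Heps).
  - by rewrite lerDl ltW.
  - by left; exact: (gam_gt0 Ha Heps).
have := ler_wpM2l (mulr_ge0 Kth_ge0 C0) le1.
by congr (_ <= _); rewrite /Kth; ring.
Qed.

Lemma level_lt k m n : (N - k.+1 <= m)%N -> (m < n)%N -> (N - k <= n)%N.
Proof. clear; lia. Qed.

(** C is fixed before X, f and Z and is thus uniform over the rough paths bounded by M. The constant
    of [gamma_at] only starts the a priori estimate and disappears from the result; the defect at h
    is bounded through the remainders of higher degree, already treated. *)
Lemma gamma_bound (M : R) : 0 <= M -> forall k, exists2 C, 0 <= C & forall X f Z B,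
  bdd X M -> 0 <= B -> span_valued alpha Z ->
  (forall h, h \in FL -> (N - k <= nodes h)%N -> gamma_at f X Z h /\
    forall s t, `|f h t - f h s| <= B * tdist s t `^ gam) ->
  forall h, h \in FL -> (N - k <= nodes h)%N -> forall s t,
    `|(rem X Z s t)@_h| <= C * B * tdist s t `^ gam.
Proof.
move=> M0; elim=> [|k [C C0 IH]].
  (* Vacuous: the forests of [FL] have at most N - 1 nodes. *)
  exists 0 => // X f Z B _ _ _ _ h; rewrite in_FL subn0 => hN Nh.
  by have := N_gt0 Ha; rewrite -ltnS prednK ?N_gt0 // ltnNge Nh in hN.
exists (Kth * Tal * (cK * (C * M)) + 1).
  by rewrite addr_ge0 // mulr_ge0 ?KT_ge0 // mulr_ge0 ?cK_ge0 // mulr_ge0.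
move=> X f Z B XM B0 spanZ Zat h hF hk s t.
have {IH} rb g : g \in FL -> (nodes h < nodes g)%N -> forall s t,
    `|(rem X Z s t)@_g| <= C * B * tdist s t `^ gam.
  move=> gF hg u v; apply: (IH X f) => //; last exact: level_lt hg.
  by move=> l lF lk; apply: Zat => //; apply: leq_trans lk; rewrite leq_sub2l.
have [[_ [B' B'0 HB']] fB] := Zat h hF hk.
pose G s t := (rem X Z s t)@_h - (f h t - f h s).
have Gb : `|G s t| <= Kth * Tal * (cK * (C * B * M)) * tdist s t `^ gam.
  apply: (@apriori_global G B') => //; first by rewrite mulr_ge0 ?cK_ge0 // !mulr_ge0.
  move=> u v; rewrite rem_increment.
  have := @pairing_chi_bound (chi X h (midpt u v) v) h (midpt u v) v
    (rem X Z u (midpt u v)) (C * B * tdist u (midpt u v) `^ gam) M.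
  have b0 : 0 <= C * B * tdist u (midpt u v) `^ gam by rewrite !mulr_ge0 ?powR_ge0.
  move=> /(_ (@rem_supp _ _ _ _ _ _ _ _ spanZ) M0 _ _ _ b0); move=> HH.
  apply: le_trans (HH _ _ _) _.
  - by move=> g _; exact: chi_low.
  - by move=> g gF; exact: chi_bound.
  - by move=> g gF hg; exact: rb.
  - by rewrite le_eqVlt; apply/orP; left; apply/eqP; ring.
rewrite -[(rem X Z s t)@_h](subrK (f h t - f h s)).
apply: le_trans (ler_normD _ _) _; apply: le_trans (lerD Gb (fB s t)) _.
by rewrite le_eqVlt; apply/orP; left; apply/eqP; ring.
Qed.

Definition is_gamma f X Z := span_valued alpha Z /\ forall h, h \in FL -> gamma_at f X Z h.

Lemma gamma_rem_bound (M : R) : 0 <= M -> exists2 C, 0 <= C & forall X f Z B,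
  bdd X M -> 0 <= B -> is_gamma f X Z ->
  (forall h, h \in FL -> forall s t, `|f h t - f h s| <= B * tdist s t `^ gam) ->
  forall h, h \in FL -> forall s t, `|(rem X Z s t)@_h| <= C * B * tdist s t `^ gam.
Proof.
move=> M0; have [C C0 HC] := gamma_bound M0 N; exists C => // X f Z B XM B0 [spanZ Zat] fB.
move=> h hF s t; apply: HC XM B0 spanZ _ _ hF _ s t; last by rewrite subnn.
by move=> g gF _; split; [exact: Zat|exact: fB].
Qed.

(** Both paths have the same f, so the difference of the remainders is itself of order th and the a
    priori estimate applies to it. *)
Lemma gamma_rem_close (M : R) : 0 <= M -> exists2 C, 0 <= C & forall X Y f Z W B d,
  bdd X M -> bdd Y M -> close X Y d -> 0 <= d -> 0 <= B ->
  is_gamma f X Z -> is_gamma f Y W ->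
  (forall h, h \in FL -> forall s t, `|f h t - f h s| <= B * tdist s t `^ gam) ->
  forall h, h \in FL -> forall s t,
    `|(rem X Z s t)@_h - (rem Y W s t)@_h| <= C * (B * d) * tdist s t `^ gam.
Proof.
move=> M0; have [C1 C10 HC1] := gamma_rem_bound M0.
suff main k : exists2 C, 0 <= C & forall X Y f Z W B d,
  bdd X M -> bdd Y M -> close X Y d -> 0 <= d -> 0 <= B ->
  is_gamma f X Z -> is_gamma f Y W ->
  (forall h, h \in FL -> forall s t, `|f h t - f h s| <= B * tdist s t `^ gam) ->
  forall h, h \in FL -> (N - k <= nodes h)%N -> forall s t,
    `|(rem X Z s t)@_h - (rem Y W s t)@_h| <= C * (B * d) * tdist s t `^ gam.
  have [C C0 HC] := main N; exists C => // X Y f Z W B d b1 b2 b3 b4 b5 b6 b7 b8 h hF s t.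
  by apply: (HC _ _ _ _ _ _ _ b1 b2 b3 b4 b5 b6 b7 b8) => //; rewrite subnn.
elim: k => [|k [C C0 IH]].
  exists 0 => // X Y f Z W B d _ _ _ _ _ _ _ _ h; rewrite in_FL subn0 => hN Nh.
  by have := N_gt0 Ha; rewrite -ltnS prednK ?N_gt0 // ltnNge Nh in hN.
exists (Kth * Tal * (cK * (C * M) + cK * C1)).
  by rewrite mulr_ge0 ?KT_ge0 // addr_ge0 // mulr_ge0 ?cK_ge0 // mulr_ge0.
move=> X Y f Z W B d XM YM XYd d0 B0 Zg Wg fB h hF hk s t.
have [spanZ Zat] := Zg; have [spanW Wat] := Wg.
have rd g : g \in FL -> (nodes h < nodes g)%N -> forall s t,
    `|(rem X Z s t)@_g - (rem Y W s t)@_g| <= C * (B * d) * tdist s t `^ gam.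
  by move=> gF hg; apply: (IH _ _ _ _ _ _ _ XM YM XYd d0 B0 Zg Wg fB) => //; exact: level_lt hg.
have rW := HC1 _ _ _ _ YM B0 Wg fB.
have [_ [BZ BZ0 HBZ]] := Zat h hF; have [_ [BW BW0 HBW]] := Wat h hF.
pose G1 s t := (rem X Z s t)@_h - (f h t - f h s).
pose G2 s t := (rem Y W s t)@_h - (f h t - f h s).
pose G s t := G1 s t - G2 s t.
have GE u v : G u v = (rem X Z u v)@_h - (rem Y W u v)@_h.
  by rewrite /G /G1 /G2; move: (_@_h) (_@_h) => x y; ring.
have Gb : `|G s t| <= Kth * Tal * (cK * (C * (B * d) * M) + cK * (C1 * B * d)) * tdist s t `^ gam.
  apply: (@apriori_global G (BZ + BW)).
  - exact: addr_ge0.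
  - by rewrite addr_ge0 // mulr_ge0 ?cK_ge0 // !mulr_ge0.
  - move=> u v; rewrite mulrDl; apply: le_trans (ler_normB _ _) _.
    by apply: lerD; [exact: HBZ|exact: HBW].
  - move=> u v; set m := midpt u v.
    have -> : G u v - G u m - G m v = (G1 u v - G1 u m - G1 m v) - (G2 u v - G2 u m - G2 m v).
      by rewrite /G; ring.
    rewrite !rem_increment.
    (* A product rule: the first term contains the difference of the remainders in higher degree,
       the second the difference of X and Y against a remainder bounded by [gamma_rem_bound]. *)
    have -> : pairing (chi X h m v) (rem X Z u m) - pairing (chi Y h m v) (rem Y W u m) =
      pairing (chi X h m v) (rem X Z u m - rem Y W u m) +
      pairing (fun g => chi X h m v g - chi Y h m v g) (rem Y W u m).
      by rewrite pairingB pairingBf addrA subrK.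
    apply: le_trans (ler_normD _ _) _.
    have sZ := @rem_supp _ _ _ _ X _ u m spanZ; have sW := @rem_supp _ _ _ _ Y _ u m spanW.
    have sZW : on_supp (forest_le N.-1) (rem X Z u m - rem Y W u m).
      by apply: on_suppD => //; rewrite -scaleN1r; exact: on_suppZ.
    have h1 := @pairing_chi_bound (chi X h m v) h m v _ (C * (B * d) * tdist u m `^ gam) M sZW M0.
    have h2 := @pairing_chi_bound (fun g => chi X h m v g - chi Y h m v g) h m v _
      (C1 * B * tdist u m `^ gam) d sW d0.
    rewrite mulrDl; apply: lerD.
      apply: le_trans (h1 _ _ _ _) _.
      + by move=> g _; exact: chi_low.
      + by move=> g gF; exact: chi_bound.
      + by move=> g gF hg; rewrite mcoeffB; exact: rd.
      + by rewrite !mulr_ge0 ?powR_ge0.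
      + by rewrite le_eqVlt; apply/orP; left; apply/eqP; ring.
    apply: le_trans (h2 _ _ _ _) _.
    + by move=> g _ gh; rewrite !chi_low // subrr.
    + by move=> g gF; exact: chi_close.
    + by move=> g gF hg; exact: rW.
    + by rewrite !mulr_ge0 ?powR_ge0.
    + by rewrite le_eqVlt; apply/orP; left; apply/eqP; ring.
rewrite -GE; apply: le_trans Gb _.
by rewrite le_eqVlt; apply/orP; left; apply/eqP; ring.
Qed.

End Quantitative.

(** * Uniqueness and linearity *)

Section GammaLinear.
Variables (R : realType) (A : finType) (T : {posnum R}) (alpha eps : R).
Local Notation F := (forest A).
Local Notation H := {malg R[F]}.
Local Notation I := (time T).
Local Notation N := (Nlevel alpha).
Local Notation FL := (@FL R A alpha).
Hypothesis Ha : 0 < alpha < 1.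
Hypothesis Heps : 0 < eps < 1 - N%:R * alpha.
Implicit Types (X Y : rough_path A T alpha) (h g : F) (s t u a b : I) (z : H) (Z W : I -> H).
Implicit Types (f : F -> I -> R).

Local Notation gam := (1 - eps).
Local Notation is_gamma := (@is_gamma R A T alpha eps).

Lemma rem_linear X (c : R) Z W s t :
  rem X (c *: Z + W) s t = c *: rem X Z s t + rem X W s t.
Proof.
by rewrite /rem /= linearP /= scalerBr opprD addrACA.
Qed.

Lemma is_gammaP X (c : R) f f' Z W : is_gamma f X Z -> is_gamma f' X W ->
  is_gamma (fun h t => c * f h t + f' h t) X (c *: Z + W).
Proof.
move=> [spanZ Zat] [spanW Wat]; split.
  by move=> t; apply: on_suppD; [apply: on_suppZ; exact: spanZ|exact: spanW].
move=> h hF; have [Z0 [B B0 HB]] := Zat h hF; have [W0 [C C0 HC]] := Wat h hF.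
split; first by rewrite /= mcoeffD mcoeffZ Z0 W0.
exists (`|c| * B + C); first by rewrite addr_ge0 // mulr_ge0.
move=> s t; rewrite rem_linear mcoeffD mcoeffZ.
have -> : c * (rem X Z s t)@_h + (rem X W s t)@_h - (c * f h t + f' h t - (c * f h s + f' h s)) =
  c * ((rem X Z s t)@_h - (f h t - f h s)) + ((rem X W s t)@_h - (f' h t - f' h s)) by ring.
rewrite mulrDl; apply: le_trans (ler_normD _ _) _; apply: lerD => //.
by rewrite normrM -mulrA; apply: ler_wpM2l.
Qed.

Lemma is_gamma_ext X f f' Z : (forall h, h \in FL -> f h = f' h) ->
  is_gamma f X Z -> is_gamma f' X Z.
Proof.
move=> ff' [spanZ Zat]; split=> // h hF.
by have [Z0 [B B0 HB]] := Zat h hF; split; [rewrite -ff'|exists B => // s t; rewrite -ff'].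
Qed.

(** The bound on the remainders is proportional to the Hoelder constant of f, which is 0 here. Hence
    all remainders vanish and Z_t is the transport of Z_0 = 0. *)
Lemma is_gamma0 X Z : is_gamma (fun _ _ => 0) X Z -> Z = 0.
Proof.
move=> Zg; have [a0 _] := andP Ha; have [M M1 XM] := rough_bound X a0.
have [C C0 HC] := gamma_rem_bound A T Ha Heps (le_trans ler01 M1).
have [spanZ Zat] := Zg.
have Z0 : Z (time0 T) = 0.
  apply/malgP => h; rewrite mcoeff0; have [hF|hF] := boolP (h \in FL).
    by case: (Zat h hF).
  apply: mcoeff_outdom; apply: contra hF => /spanZ; by rewrite in_FL.
have rem0 s t : rem X Z s t = 0.
  apply/malgP => h; rewrite mcoeff0; have [hF|hF] := boolP (h \in FL).
    have := HC X (fun _ _ => 0) Z 0 XM (lexx 0) Zg _ h hF s t.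
    rewrite mulr0 mul0r normr_le0 => H0; apply/eqP; apply: H0 => g _ u v.
    by rewrite subrr normr0 mul0r.
  apply: mcoeff_outdom; apply: contra hF => /(rem_supp spanZ); by rewrite in_FL.
apply/funext => t; have := rem0 (time0 T) t.
by rewrite /rem Z0 linear0 subr0.
Qed.

Lemma is_gamma_uniq X f Z W : is_gamma f X Z -> is_gamma f X W -> Z = W.
Proof.
move=> Zg Wg; have := is_gammaP (-1) Zg Wg.
move=> /(is_gamma_ext (f' := fun _ _ => 0)) ZW; apply/eqP; rewrite -subr_eq0 -oppr_eq0 opprB.
rewrite addrC -scaleN1r; apply/eqP; apply: is_gamma0; apply: ZW => h _.
by apply/funext => t; rewrite mulN1r addNr.
Qed.

Variable P : set H.
Hypothesis HP : primitive_basis P.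

Definition hoelder_coeffs f := forall h, h \in FL -> exists2 B, 0 <= B &
  forall s t, `|f h t - f h s| <= B * tdist s t `^ gam.

Lemma Gamma_is_gamma X f : hoelder_coeffs f -> is_gamma f X (Gamma_path P f X).
Proof.
move=> fH; split; first exact: Gamma_path_span.
by move=> h; apply: Gamma_path_at.
Qed.

Lemma hoelder_coeffsP (c : R) f f' : hoelder_coeffs f -> hoelder_coeffs f' ->
  hoelder_coeffs (fun h t => c * f h t + f' h t).
Proof.
move=> fH fH' h hF; have [B B0 HB] := fH h hF; have [C C0 HC] := fH' h hF.
exists (`|c| * B + C); first by rewrite addr_ge0 // mulr_ge0.
move=> s t; have -> : c * f h t + f' h t - (c * f h s + f' h s) =
  c * (f h t - f h s) + (f' h t - f' h s) by ring.
rewrite mulrDl; apply: le_trans (ler_normD _ _) _; apply: lerD => //.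
by rewrite normrM -mulrA; apply: ler_wpM2l.
Qed.

Lemma Gamma_linear X (c : R) f f' : hoelder_coeffs f -> hoelder_coeffs f' ->
  Gamma_path P (fun h t => c * f h t + f' h t) X =
  c *: Gamma_path P f X + Gamma_path P f' X.
Proof.
move=> fH fH'; apply: is_gamma_uniq; first exact/Gamma_is_gamma/hoelder_coeffsP.
by apply: is_gammaP; exact: Gamma_is_gamma.
Qed.

Lemma Gamma_path0 X : Gamma_path P (fun _ _ => 0) X = 0.
Proof.
apply: (@is_gamma0 X); apply: Gamma_is_gamma => h _; exists 0 => // s t.
by rewrite subrr normr0 mul0r.
Qed.

End GammaLinear.

(** * The controlled norm through coefficientwise bounds *)

Section ControlledNorm.
Variables (R : realType) (A : finType) (T : {posnum R}) (alpha : R).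
Local Notation F := (forest A).
Local Notation H := {malg R[F]}.
Local Notation I := (time T).
Local Notation N := (Nlevel alpha).
Local Notation FL := (@FL R A alpha).
Hypothesis Ha : 0 < alpha < 1.
Implicit Types (X Y : rough_path A T alpha) (h g : F) (s t u a b : I) (z : H) (Z W : I -> H).

Lemma ctrl_normE X (g : R) Z : ctrl_norm X g Z =
  (\sum_(h <- FL) (`|(Z (time0 T))@_h|%:E +
    hoelder (g *+ (N - nodes h)) (fun s t => (rem X Z s t)@_h)))%E.
Proof.
rewrite /ctrl_norm fsbig_finite /=; last exact: finite_forest_le.
apply: eq_bigr => h _; congr (_ + hoelder _ _)%E.
by apply/funext => s; apply/funext => t; rewrite remainderE.
Qed.

Definition nFL : R := \sum_(g <- FL) 1.

Lemma nFL_ge0 : 0 <= nFL. Proof. exact: sumr_ge0. Qed.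

Lemma ctrl_norm_le X (g b c : R) Z :
  (forall h, h \in FL -> `|(Z (time0 T))@_h| <= b) ->
  (forall h, h \in FL -> forall s t, s <> t ->
    `|(rem X Z s t)@_h| <= c * tdist s t `^ (g *+ (N - nodes h))) ->
  (ctrl_norm X g Z <= (nFL * (b + c))%:E)%E.
Proof.
move=> Zb Zc; rewrite ctrl_normE /nFL mulr_suml.
have -> : (\sum_(h <- FL) 1 * (b + c))%:E = (\sum_(h <- FL) (b + c)%:E)%E.
  by rewrite sumEFin; congr EFin; apply: eq_bigr => h _; rewrite mul1r.
rewrite big_seq [leRHS]big_seq; apply: lee_sum => h hF; rewrite EFinD.
by apply: leeD; [rewrite lee_fin Zb|apply: hoelder_le; exact: Zc].
Qed.

Lemma ctrl_normD X (g : R) Z W : (ctrl_norm X g (Z + W)%R <= ctrl_norm X g Z + ctrl_norm X g W)%E.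
Proof.
rewrite !ctrl_normE -big_split /=; apply: lee_sum => h _.
rewrite addeACA; apply: leeD; first by rewrite -EFinD lee_fin mcoeffD ler_normD.
apply: le_trans (hoelderD _ _ _).
rewrite (_ : (fun s t => (rem X (Z + W) s t)@_h) =
  (fun s t => (rem X Z s t)@_h + (rem X W s t)@_h)) //.
apply/funext => s; apply/funext => t.
by rewrite -[Z]scale1r rem_linear mcoeffD mcoeffZ scale1r mul1r.
Qed.

Lemma ctrl_term_ge0 X (g : R) Z h :
  (0 <= `|(Z (time0 T))@_h|%:E + hoelder (g *+ (N - nodes h)) (fun s t => (rem X Z s t)@_h))%E.
Proof. by rewrite adde_ge0 ?hoelder_ge0 // lee_fin. Qed.

Lemma ctrl_norm_ge0 X (g : R) Z : (0 <= ctrl_norm X g Z)%E.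
Proof. by rewrite ctrl_normE; apply: sume_ge0 => h _; exact: ctrl_term_ge0. Qed.

Lemma ctrl_norm_rem X (g c : R) Z h : (ctrl_norm X g Z <= c%:E)%E -> h \in FL ->
  (`|(Z (time0 T))@_h| <= c) /\ forall s t, s <> t ->
    `|(rem X Z s t)@_h| <= c * tdist s t `^ (g *+ (N - nodes h)).
Proof.
rewrite ctrl_normE => Zc hF.
have le_h : (`|(Z (time0 T))@_h|%:E +
    hoelder (g *+ (N - nodes h)) (fun s t => (rem X Z s t)@_h) <= c%:E)%E.
  apply: le_trans Zc; rewrite (big_fsetD1 h) //=; apply: leeDl.
  by apply: sume_ge0 => k _; exact: ctrl_term_ge0.
split; first by rewrite -lee_fin (le_trans _ le_h) // leeDl // hoelder_ge0.
move=> s t st; apply: (hoelder_ge (F := fun s t => (rem X Z s t)@_h)) st.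
by apply: le_trans le_h; apply: leeDr; rewrite lee_fin.
Qed.

End ControlledNorm.

(** * Approximation by smooth functions *)

Section LittleHoelder.
Variables (R : realType) (T : {posnum R}) (gam : R).
Local Notation I := (time T).
Hypothesis gam01 : 0 < gam < 1.
Implicit Types (s t u : I) (f k : I -> R) (e : R).

(** Real-valued inequalities, valid also at s = t, that are equivalent to smallness of
    [hoelder_norm] up to a factor. *)
Definition hoelder_close f k e :=
  (forall t, `|f t - k t| <= e) /\
  (forall s t, `|(f t - k t) - (f s - k s)| <= e * tdist s t `^ gam).

Lemma hoelder_norm_close f k e : (hoelder_norm gam (f - k)%R < e%:E)%E -> hoelder_close f k e.
Proof.
rewrite /hoelder_norm => /ltW fke.
have sup0 : (0 <= ereal_sup [set `|(f - k) t|%:E | t in [set: I]])%E.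
  apply: (@le_trans _ _ `|(f - k) (time0 T)|%:E); first by rewrite lee_fin.
  by apply: ereal_sup_ubound; exists (time0 T).
have b1 t : `|f t - k t| <= e.
  rewrite -lee_fin (le_trans _ fke) // -[leLHS]adde0; apply: leeD; last exact: hoelder_ge0.
  by apply: ereal_sup_ubound; exists t.
split=> // s t; have [->|/eqP st] := eqVneq s t.
  by rewrite subrr normr0 mulr_ge0 ?powR_ge0 // (le_trans _ (b1 t)).
apply: (hoelder_ge (F := fun s t => (f - k) t - (f - k) s)) st.
by apply: le_trans fke; rewrite -[leLHS]add0e; apply: leeD.
Qed.

Lemma close_hoelder_norm f k e : hoelder_close f k e ->
  (hoelder_norm gam (f - k)%R <= (e + e)%:E)%E.
Proof.
move=> [fk1 fk2]; rewrite /hoelder_norm EFinD; apply: leeD.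
  by apply: ge_ereal_sup => _ [t _ <-]; rewrite lee_fin; exact: fk1.
by apply: hoelder_le => s t _; exact: fk2.
Qed.

Lemma little_hoelderP f : little_hoelder gam f <->
  forall e, 0 < e -> exists2 k, smooth k & hoelder_close f k e.
Proof.
split=> fl e e0.
  by have [k ks kf] := fl e e0; exists k => //; exact: hoelder_norm_close.
have e4 : 0 < e / 4 by rewrite divr_gt0.
have [k ks kf] := fl _ e4.
exists k => //; apply: le_lt_trans (close_hoelder_norm kf) _.
rewrite lte_fin; lra.
Qed.

(** Smoothness is handled through an explicit sequence of successive derivatives, which linear
    combinations and the softplus possess in closed form. *)
Lemma smooth_family (G : nat -> R -> R) :
  (forall n (x : R), is_derive x 1 (G n) (G n.+1 x)) -> smooth (fun t : I => G 0%N (\val t)).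
Proof.
move=> GD; exists (G 0%N); split=> //.
have GE n : derive1n n (G 0%N) = G n.
  elim: n => [//|n IHn]; rewrite derive1nS IHn; apply/funext => x; rewrite derive1E.
  exact: derive_val.
by move=> n x; rewrite GE; have [] := GD n x.
Qed.

Lemma smooth_derivatives k : smooth k -> exists G : nat -> R -> R,
  (forall n (x : R), is_derive x 1 (G n) (G n.+1 x)) /\ forall t, k t = G 0%N (\val t).
Proof.
move=> [g [gD kg]]; exists (fun n => derive1n n g); split; last exact: kg.
move=> n x; apply: DeriveDef; first exact: gD.
by rewrite derive1nS derive1E.
Qed.

Lemma smoothP (c : R) k k' : smooth k -> smooth k' -> smooth (fun t => c * k t + k' t).
Proof.
move=> /smooth_derivatives[G [GD kG]] /smooth_derivatives[G' [GD' kG']].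
have -> : (fun t => c * k t + k' t) = (fun t => c * G 0%N (\val t) + G' 0%N (\val t)).
  by apply/funext => t; rewrite kG kG'.
have := @smooth_family (fun n x => c * G n x + G' n x); apply.
Qed.

Lemma smooth_cst c : smooth (fun _ : I => c).
Proof.
have := @smooth_family (fun n _ => if n is 0%N then c else 0); exact.
Qed.

Lemma smooth_lipschitz k : smooth k -> exists2 B, 0 <= B & forall s t, `|k t - k s| <= B * tdist s t.
Proof.
move=> /smooth_derivatives[G [GD kG]].
have Gc n : {within `[0, T%:num], continuous (G n)}.
  by apply: derivable_within_continuous => x _; have [] := GD n x.
have T0 : 0 <= T%:num by [].
have [c1 _ max1] := EVT_max T0 (Gc 1%N); have [c2 _ min1] := EVT_min T0 (Gc 1%N).
exists (`|G 1%N c1| + `|G 1%N c2|); first by rewrite addr_ge0.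
suff lip s t : \val s <= \val t -> `|k t - k s| <= (`|G 1%N c1| + `|G 1%N c2|) * tdist s t.
  move=> s t; have [/lip //|/ltW/lip] := leP (\val s) (\val t).
  by rewrite distrC tdistC.
move=> st; have [s0 sT] := andP (val_time s); have [t0 tT] := andP (val_time t).
have [|c] := @MVT_segment _ (G 0%N) (G 1%N) _ _ st.
  by apply: derivable_within_continuous => x _; have [] := GD 0%N x.
rewrite in_itv /= => /andP[sc ct]; rewrite !kG => ->; rewrite (tdist_le st) normrM.
rewrite [X in _ * X <= _]ger0_norm ?subr_ge0 //; apply: ler_wpM2r; first by rewrite subr_ge0.
have cT : c \in `[0, T%:num] by rewrite in_itv /= (le_trans s0 sc) (le_trans ct tT).
have := max1 c cT; have := min1 c cT.
have := ler_norm (G 1%N c1); have := ler_norm (- G 1%N c2); rewrite normrN.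
have := normr_ge0 (G 1%N c1); have := normr_ge0 (G 1%N c2).
by rewrite ler_norml => *; apply/andP; split; lra.
Qed.

Lemma little_hoelder_bound f : little_hoelder gam f ->
  exists2 B, 0 <= B & forall s t, `|f t - f s| <= B * tdist s t `^ gam.
Proof.
have [g0 g1] := andP gam01; move=> /little_hoelderP /(_ 1 ltr01)[k ks [_ kf]].
have [B B0 HB] := smooth_lipschitz ks.
exists (1 + B * (1 + T%:num) `^ (1 - gam)).
  by rewrite addr_ge0 // mulr_ge0 // powR_ge0.
move=> s t; have -> : f t - f s = (f t - k t - (f s - k s)) + (k t - k s) by ring.
apply: le_trans (ler_normD _ _) _; rewrite mulrDl; apply: lerD => //.
apply: le_trans (HB s t) _; rewrite -mulrA; apply: ler_wpM2l => //.
rewrite -[X in X <= _]powRr1 ?tdist_ge0 //; apply: powR_le_exp; [by rewrite tdist_ge0 tdist_leT|lra|lra|lra|by left].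
Qed.

Lemma little_hoelderlP (c : R) f f' : little_hoelder gam f -> little_hoelder gam f' ->
  little_hoelder gam (fun t => c * f t + f' t).
Proof.
move=> /little_hoelderP fl /little_hoelderP fl'; apply/little_hoelderP => e e0.
have d0 : 0 < e / (`|c| + 1) by rewrite divr_gt0 // ltr_wpDl.
have [k ks [kf1 kf2]] := fl _ d0; have [k' ks' [kf1' kf2']] := fl' _ d0.
exists (fun t => c * k t + k' t); first exact: smoothP.
have eE : e = `|c| * (e / (`|c| + 1)) + e / (`|c| + 1).
  by rewrite -[X in _ + X]mul1r -mulrDl mulrC divfK // gt_eqF // ltr_wpDl.
split=> [t|s t]; rewrite [X in _ <= X]eE || rewrite [X in _ <= X * _]eE.
  have -> : c * f t + f' t - (c * k t + k' t) = c * (f t - k t) + (f' t - k' t) by ring.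
  apply: le_trans (ler_normD _ _) _; apply: lerD => //.
  by rewrite normrM; apply: ler_wpM2l.
have -> : c * f t + f' t - (c * k t + k' t) - (c * f s + f' s - (c * k s + k' s)) =
  c * (f t - k t - (f s - k s)) + (f' t - k' t - (f' s - k' s)) by ring.
apply: le_trans (ler_normD _ _) _; rewrite mulrDl; apply: lerD => //.
by rewrite normrM -mulrA; apply: ler_wpM2l.
Qed.

Section Softplus.
Variables (a d : R).
Hypothesis d_gt0 : 0 < d.

Definition softplus (x : R) := d * ln (1 + expR ((x - a) / d)).

Definition sigmoid (x : R) := expR ((x - a) / d) / (1 + expR ((x - a) / d)).

Lemma expR1_gt0 (x : R) : 0 < 1 + expR x.
Proof. by rewrite addr_gt0 // expR_gt0. Qed.

Lemma is_derive_expR1 (x : R) :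
  is_derive x 1 (fun y => 1 + expR ((y - a) / d)) (expR ((x - a) / d) / d).
Proof.
have D1 : is_derive x 1 (fun y : R => (y - a) / d) d^-1.
  have := is_deriveZ d^-1 (is_deriveB (is_derive_id x 1) (is_derive_cst a x 1)).
  rewrite subr0 [X in is_derive _ _ _ X -> _]mulr1 => D.
  rewrite (_ : (fun y => _) = (d^-1 \*: (id - cst a))) //.
  by apply/funext => y; rewrite mulrC.
have := is_deriveD (is_derive_cst (1 : R) x 1) (is_derive1_comp (is_derive_expR _) D1).
by rewrite add0r.
Qed.

Lemma is_derive_softplus (x : R) : is_derive x 1 softplus (sigmoid x).
Proof.
have := is_deriveZ d (is_derive1_comp (f := @ln R) (g := fun y => 1 + expR ((y - a) / d))
  (is_derive1_ln (expR1_gt0 ((x - a) / d))) (is_derive_expR1 x)).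
rewrite (_ : d *: _ = sigmoid x) //.
rewrite /sigmoid /GRing.scale /=; field.
by rewrite !gt_eqF // expR1_gt0.
Qed.

Lemma is_derive_sigmoid (x : R) :
  is_derive x 1 sigmoid (d^-1 * (sigmoid x * (1 - sigmoid x))).
Proof.
have n0 y : 1 + expR ((y - a) / d) != 0 by rewrite gt_eqF // expR1_gt0.
have sE : sigmoid = (fun y => 1 - (1 + expR ((y - a) / d))^-1).
  by apply/funext => y; rewrite /sigmoid; field; exact: n0.
have := is_deriveB (is_derive_cst (1 : R) x 1)
  (is_deriveV (f := fun y => 1 + expR ((y - a) / d)) (n0 x) (is_derive_expR1 x)).
rewrite sub0r -scaleNr opprK (_ : _ *: _ = d^-1 * (sigmoid x * (1 - sigmoid x))).
  by rewrite sE.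
rewrite /sigmoid /GRing.scale /=; field.
by rewrite n0 gt_eqF.
Qed.

(* [sigmoid] solves a logistic equation, so that all the derivatives of [softplus] are
   polynomials in [sigmoid]. *)
Fixpoint sigmoid_poly (n : nat) : {poly R} :=
  if n is m.+1 then d^-1 *: ((sigmoid_poly m)^`() * ('X * (1 - 'X))) else 'X.

Lemma softplus_smooth : smooth (fun t : I => softplus (\val t)).
Proof.
have := @smooth_family (fun n x => if n is m.+1 then (sigmoid_poly m).[sigmoid x] else softplus x).
apply=> -[|n] x; first by rewrite /= hornerX; exact: is_derive_softplus.
have := is_derive1_comp (is_derive_poly (sigmoid_poly n) (sigmoid x)) (is_derive_sigmoid x).
rewrite (_ : _ * _ = (sigmoid_poly n.+1).[sigmoid x]) //.
by rewrite [in RHS]/= hornerZ !hornerM hornerD hornerN hornerX hornerC; ring.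
Qed.

Lemma softplus_bound x : `|softplus x - Num.max (x - a) 0| <= d.
Proof.
pose y := (x - a) / d.
have -> : Num.max (x - a) 0 = d * Num.max y 0.
  by rewrite maxr_pMr ?ltW // mulr0 /y mulrC divfK // gt_eqF.
rewrite /softplus -/y -mulrBr normrM (gtr0_norm d_gt0) ger_pMr //.
have l1 : Num.max y 0 <= ln (1 + expR y).
  rewrite -[X in X <= _]expRK ler_ln ?posrE ?expR_gt0 ?expR1_gt0 //.
  have := expR_gt0 y; case: (leP y 0) => _; rewrite ?expR0; lra.
(* Since e >= 2, one has 1 + e^y <= e^(max(y, 0) + 1). *)
have l2 : ln (1 + expR y) <= Num.max y 0 + 1.
  rewrite -[X in _ <= X]expRK ler_ln ?posrE ?expR_gt0 ?expR1_gt0 //.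
  rewrite expRD; have := @expR_ge1Dx R 1; have := expR_gt0 y.
  case: (leP y 0) => [y0|/ltW y0]; rewrite ?expR0.
    have : expR y <= 1 by rewrite -[leRHS]expR0 ler_expR.
    lra.
  have : 1 <= expR y by rewrite -[leLHS]expR0 ler_expR.
  nra.
by rewrite ger0_norm ?subr_ge0 // lerBlDl.
Qed.

Lemma sigmoid01 x : 0 <= sigmoid x <= 1.
Proof.
rewrite /sigmoid divr_ge0 ?expR_ge0 ?ltW ?expR1_gt0 //=.
by rewrite ltr_pdivrMr ?expR1_gt0 // mul1r ltrDr.
Qed.

Lemma softplus_lip x y : `|softplus y - softplus x| <= `|y - x|.
Proof.
wlog xy : x y / x <= y.
  by move=> W; have [/W //|/ltW/W] := leP x y; rewrite distrC [X in _ <= X]distrC.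
have [||c _] := @MVT_segment _ softplus sigmoid _ _ xy.
- by move=> z _; exact: is_derive_softplus.
- by apply: derivable_within_continuous => z _; have [] := is_derive_softplus z.
move=> ->; rewrite normrM ler_piMl //; have /andP[s0 s1] := sigmoid01 c.
by rewrite ger0_norm.
Qed.

End Softplus.

Definition ramp (a : R) t := Num.max (\val t - a) 0.

(** Ramp and softplus are both 1-Lipschitz and differ by at most d, so the increments of their
    difference are at most 2 min(|t - s|, d). Writing the minimum as the product of its powers gam
    and 1 - gam leaves a small second factor because gam < 1. *)
Lemma ramp_little_hoelder a : little_hoelder gam (ramp a).
Proof.
have [g0 g1] := andP gam01; apply/little_hoelderP => e e0.
(* Makes both d and d^(1 - gam) at most e / 2. *)
pose d := Num.min (e / 2) ((e / 2) `^ (1 - gam)^-1).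
have d0 : 0 < d by rewrite lt_min divr_gt0 // powR_gt0 // divr_gt0.
exists (fun t => softplus a d (\val t)); first exact: softplus_smooth.
have b1 t : `|ramp a t - softplus a d (\val t)| <= d by rewrite distrC softplus_bound.
have de : d <= e / 2 by rewrite ge_min lexx.
have dge : d `^ (1 - gam) <= e / 2.
  apply: (@le_trans _ _ (((e / 2) `^ (1 - gam)^-1) `^ (1 - gam))).
    by apply: le_powR_base; [lra|exact: ltW|rewrite ge_min lexx orbT].
  by rewrite -powRrM mulVf ?powRr1 //; lra.
split=> [t|s t]; first by apply: le_trans (b1 t) _; lra.
have ramp_lip : `|ramp a t - ramp a s| <= tdist s t.
  rewrite /tdist -/(\val s) -/(\val t) /ramp.
  wlog st : s t / \val s <= \val t.
    by move=> W; have [/W //|/ltW/W] := leP (\val s) (\val t); rewrite distrC [leRHS]distrC.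
  rewrite [leRHS]ger0_norm ?subr_ge0 //; case: (leP (\val s - a) 0) => s1.
    case: (leP (\val t - a) 0) => t1; first by rewrite subrr normr0 subr_ge0.
    rewrite subr0 ger0_norm ?(ltW t1) //; lra.
  by rewrite max_l ?ger0_norm; lra.
have sp_lip := softplus_lip a d0 (\val s) (\val t).
have E : ramp a t - softplus a d (\val t) - (ramp a s - softplus a d (\val s)) =
  (ramp a t - ramp a s) - (softplus a d (\val t) - softplus a d (\val s)) by ring.
have x0 := tdist_ge0 s t.
have lip : `|ramp a t - softplus a d (\val t) - (ramp a s - softplus a d (\val s))| <=
    2 * Num.min (tdist s t) d.
  rewrite minr_pMr // le_min; apply/andP; split.
    rewrite E; apply: le_trans (ler_normB _ _) _.
    by rewrite mulr_natl mulr2n; apply: lerD.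
  apply: le_trans (ler_normB _ _) _; rewrite mulr_natl mulr2n; exact: lerD.
apply: le_trans lip _.
have m0 : 0 <= Num.min (tdist s t) d by rewrite le_min x0 ltW.
rewrite -[Num.min _ _](powRr1 m0) (_ : 1 = gam + (1 - gam)); last by ring.
rewrite powRD; last by rewrite addrC subrK oner_eq0.
have m1 : Num.min (tdist s t) d `^ gam <= tdist s t `^ gam.
  by apply: le_powR_base; rewrite ?ge_min ?lexx // ltW.
have m2 : Num.min (tdist s t) d `^ (1 - gam) <= e / 2.
  apply: le_trans dge; apply: le_powR_base => //; first by rewrite subr_ge0 ltW.
  by rewrite ge_min lexx orbT.
have := ler_pM (powR_ge0 _ _) (powR_ge0 _ _) m1 m2; lra.
Qed.

(** * Piecewise affine interpolation on a uniform grid *)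

Section Interpolation.
Variable n : nat.
Hypothesis n_gt0 : (0 < n)%N.
Implicit Types (i j : nat) (phi : I -> R).

Definition width : R := T%:num / n%:R.
Local Notation d := width.

Lemma width_gt0 : 0 < d. Proof. by rewrite divr_gt0 ?ltr0n. Qed.

Definition grid i : I := mkt T (i%:R * d).

Lemma val_grid i : (i <= n)%N -> \val (grid i) = i%:R * d.
Proof.
move=> i_n; rewrite val_mkt // mulr_ge0 ?(ltW width_gt0) //=.
rewrite /width mulrA ler_pdivrMr ?ltr0n // mulrC; apply: ler_wpM2l => //.
by rewrite ler_nat.
Qed.

Definition cell j : set I := [set t | j%:R * d <= \val t <= j.+1%:R * d].

Lemma cell_midpt j s t : cell j s -> cell j t -> cell j (midpt s t).
Proof.
rewrite /cell /mkset val_midpt.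
move: (\val s) (\val t) (j%:R * d) (j.+1%:R * d) => x y a b.
by move=> /andP[s1 s2] /andP[t1 t2]; apply/andP; split; lra.
Qed.

Lemma cell_dist j s t : cell j s -> cell j t -> tdist s t <= d.
Proof.
rewrite /cell /mkset /tdist => /andP[s1 s2] /andP[t1 t2].
move: s1 s2 t1 t2; rewrite -natr1 mulrDl mul1r => *.
by rewrite ler_norml; apply/andP; split; lra.
Qed.

Lemma grid_celll j : (j < n)%N -> cell j (grid j).
Proof.
move=> jn; rewrite /cell /mkset val_grid ?(ltnW jn) // lexx /=.
by rewrite ler_wpM2r ?(ltW width_gt0) // ler_nat.
Qed.

Lemma grid_cellr j : (j < n)%N -> cell j (grid j.+1).
Proof.
move=> jn; rewrite /cell /mkset val_grid // lexx andbT.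
by rewrite ler_wpM2r ?(ltW width_gt0) // ler_nat.
Qed.

Lemma in_cell t : exists2 j, (j < n)%N & cell j t.
Proof.
have /andP[t0 tT] := val_time t; have d0 := width_gt0.
have td0 : 0 <= \val t / d by rewrite divr_ge0 // ltW.
have /andP[l1 l2] := truncn_itv td0.
have [jn|nj] := ltnP (Num.truncn (\val t / d)) n.
  exists (Num.truncn (\val t / d)) => //; rewrite /cell /mkset.
  by rewrite -ler_pdivlMr // l1 /= -ler_pdivrMr // ltW.
(* Only t = T is left; it is the right end of the last cell, cells being closed. *)
exists n.-1; first by rewrite prednK.
have nd : n%:R * d = T%:num by rewrite mulrC divfK // pnatr_eq0 -lt0n.
have tE : \val t = T%:num.
  apply/le_anti; rewrite tT /=; apply: (@le_trans _ _ (n%:R * d)); first by rewrite nd.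
  by rewrite -ler_pdivlMr //; apply: le_trans l1; rewrite ler_nat.
have : n.-1%:R * d <= n%:R * d by rewrite ler_wpM2r ?(ltW d0) // ler_nat leq_pred.
by rewrite /cell /mkset prednK // tE nd => ->; rewrite lexx.
Qed.

(** A difference of successive ramps is 0 before its cell, affine on it and constant, equal to the
    width, after it. The sum is therefore the interpolation of phi on the grid, presented as a
    combination of ramps so that [ramp_little_hoelder] applies. *)
Definition interp phi t := phi (grid 0) +
  \sum_(0 <= i < n) (phi (grid i.+1) - phi (grid i)) / d *
    (ramp (i%:R * d) t - ramp (i.+1%:R * d) t).

Lemma interp_cellE phi j t : (j < n)%N -> cell j t ->
  interp phi t = phi (grid j) + (phi (grid j.+1) - phi (grid j)) / d * (\val t - j%:R * d).
Proof.
move=> jn /andP[t1 t2]; have d0 := width_gt0.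
have le_d a b : (a <= b)%N -> a%:R * d <= b%:R * d.
  by move=> ab; rewrite ler_wpM2r ?(ltW d0) // ler_nat.
rewrite /interp (big_cat_nat (n := j)) //=; last exact: ltnW.
rewrite [in X in _ + X](big_ltn jn) /=.
rewrite [X in _ + (_ + (_ + X))]big_nat_cond [X in _ + (_ + (_ + X))]big1 ?addr0; last first.
  move=> i /andP[/andP[ji _] _]; rewrite /ramp !max_r ?subrr ?mulr0 //.
    rewrite subr_le0; apply: le_trans t2 _; apply: le_d; exact: leqW.
  by rewrite subr_le0; apply: le_trans t2 _; apply: le_d.
rewrite addrA; congr (_ + _ * _); last first.
  by rewrite /ramp max_l ?subr_ge0 // max_r ?subr0 // subr_le0.
rewrite big_nat (eq_bigr (fun i => phi (grid i.+1) - phi (grid i))).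
  by rewrite -big_nat telescope_sumr // addrC subrK.
move=> i /andP[_ ij]; rewrite /ramp !max_l.
- by rewrite -(natr1 i); field; rewrite gt_eqF.
- by rewrite subr_ge0; apply: le_trans t1; apply: le_d.
- by rewrite subr_ge0; apply: le_trans t1; apply: le_d; exact: ltnW.
Qed.

Lemma interp_cell phi j s t : (j < n)%N -> cell j s -> cell j t ->
  interp phi t - interp phi s = (phi (grid j.+1) - phi (grid j)) / d * (\val t - \val s).
Proof.
by move=> jn sj tj; rewrite (interp_cellE _ jn sj) (interp_cellE _ jn tj); ring.
Qed.

Lemma interp_grid phi i : (i <= n)%N -> interp phi (grid i) = phi (grid i).
Proof.
rewrite leq_eqVlt => /orP[/eqP ->|ilt]; last first.
  by rewrite (interp_cellE _ ilt (grid_celll ilt)) val_grid ?(ltnW ilt) // subrr mulr0 addr0.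
(* No cell starts at the last point of the grid, which has to be treated as a right end. *)
have n1 : (n.-1 < n)%N by rewrite prednK.
have := interp_cellE phi n1 (grid_cellr n1); rewrite prednK // => ->.
have nE : n%:R = n.-1%:R + 1 :> R by rewrite natr1 prednK.
rewrite val_grid // nE; field; by rewrite gt_eqF // width_gt0.
Qed.

Lemma little_hoelder_sum (J : Type) (r : seq J) (c : J -> R) (f : J -> I -> R) (c0 : R) :
  (forall x, little_hoelder gam (f x)) ->
  little_hoelder gam (fun t => c0 + \sum_(i <- r) c i * f i t).
Proof.
move=> fl; elim: r => [|x r IHr].
  apply/little_hoelderP => e e0; exists (fun _ => c0); first exact: smooth_cst.
  split=> [t|s t]; rewrite !big_nil addr0 !subrr ?subr0 normr0; first exact: ltW.
  by apply: mulr_ge0; [exact: ltW|exact: powR_ge0].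
have -> : (fun t => c0 + \sum_(y <- x :: r) c y * f y t) =
    (fun t => c x * f x t + (c0 + \sum_(y <- r) c y * f y t)).
  by apply/funext => t; rewrite big_cons addrCA.
exact: little_hoelderlP.
Qed.

Lemma interp_little_hoelder phi : little_hoelder gam (interp phi).
Proof.
apply: little_hoelder_sum => i.
have -> : (fun t => ramp (i%:R * d) t - ramp (i.+1%:R * d) t) =
  (fun t => -1 * ramp (i.+1%:R * d) t + ramp (i%:R * d) t).
  by apply/funext => t; rewrite mulN1r addrC.
by apply: little_hoelderlP; exact: ramp_little_hoelder.
Qed.

End Interpolation.
End LittleHoelder.

(** * Density of the sections *)

Section GridMatching.
Variables (R : realType) (A : finType) (T : {posnum R}) (alpha eps : R).
Local Notation F := (forest A).
Local Notation H := {malg R[F]}.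
Local Notation I := (time T).
Local Notation N := (Nlevel alpha).
Local Notation FL := (@FL R A alpha).
Hypothesis Ha : 0 < alpha < 1.
Hypothesis Heps : 0 < eps < 1 - N%:R * alpha.
Implicit Types (X Y : rough_path A T alpha) (h g : F) (s t u a b : I) (z : H) (Z W V : I -> H).
Implicit Types (f : F -> I -> R).

Local Notation th := (1 - eps + alpha).
Local Notation gam := (1 - eps).
Local Notation is_gamma := (@is_gamma R A T alpha eps).
Local Notation gamma_at f := (gamma_at eps f).

Lemma rem_top X Z h s t : span_valued alpha Z ->
  (forall g, g \in FL -> (nodes h < nodes g)%N -> (Z s)@_g = 0) ->
  (rem X Z s t)@_h = (Z t)@_h - (Z s)@_h.
Proof.
move=> spanZ Z0; rewrite remE germE; move: (_@_h) (_@_h) => x y.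
rewrite (pairing_FL (alpha := alpha)); last exact: spanZ.
rewrite big_seq big1 ?subr0 // => g gF.
have [gh|hg] := leqP (nodes g) (nodes h); last by rewrite Z0 // mul0r.
by rewrite [X in _ * X](_ : _ = 0) ?mulr0 //; exact: chi_low.
Qed.

(** Without higher components all additivity defects vanish, and the a priori estimate with C = 0
    leaves no room for a difference between the component and f. *)
Lemma gamma_top f X Z h : span_valued alpha Z -> h \in FL -> gamma_at f X Z h ->
  (forall g t, g \in FL -> (nodes h < nodes g)%N -> (Z t)@_g = 0) ->
  forall t, (Z t)@_h = f h t.
Proof.
move=> spanZ hF [Z0 [B B0 HB]] Ztop t.
pose G s t := (rem X Z s t)@_h - (f h t - f h s).
have th1 := th_gt1 Ha Heps.
have := @sewing_apriori R T G setT B 0 th th (time0 T) t th1 th1 B0 (lexx 0)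
  (fun _ _ _ _ => Logic.I) Logic.I Logic.I (fun u v _ _ => HB u v).
rewrite mulr0 mul0r /G rem_top //; last by move=> g; exact: Ztop.
rewrite Z0 normr_le0 => H0; apply/eqP.
suff : (Z t)@_h - f h (time0 T) - (f h t - f h (time0 T)) == 0.
  by rewrite opprB addrA subrK subr_eq0.
apply: H0 => u v _ _; rewrite rem_increment (pairing_FL (alpha := alpha)).
  rewrite big_seq big1 ?normr0 ?mul0r // => g gF.
  have [gh|hg] := leqP (nodes g) (nodes h); first by rewrite chi_low // mulr0.
  rewrite rem_top //; first by rewrite !Ztop // subrr mul0r.
  by move=> k kF /(ltn_trans hg); exact: Ztop.
exact: rem_supp.
Qed.

(** The top-degree coefficients are the path itself, which lets the values on a grid be corrected
    one degree at a time. *)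
Lemma gamma_top_level f X Z m : is_gamma f X Z ->
  (forall h, h \in FL -> (m < nodes h)%N -> f h = fun=> 0) ->
  forall h t, h \in FL -> (m <= nodes h)%N -> (Z t)@_h = f h t.
Proof.
move=> [spanZ Zat] f0.
suff main k h t : h \in FL -> (m <= nodes h)%N -> (N - k <= nodes h)%N -> (Z t)@_h = f h t.
  by move=> h t hF mh; apply: (main N) => //; rewrite subnn.
elim: k h t => [|k IH] h t hF mh hk.
  move: hF; rewrite in_FL leqNgt => /negP[]; apply: leq_trans hk.
  by rewrite subn0 prednK // N_gt0.
apply: gamma_top (Zat h hF) _ t => // g u gF hg.
have mg := leq_ltn_trans mh hg.
by rewrite IH ?f0 // ?(ltnW mg) //; exact: level_lt hg.
Qed.

Variable P : set H.
Hypothesis HP : primitive_basis P.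
Variable n : nat.
Hypothesis n_gt0 : (0 < n)%N.
Local Notation interp := (@interp R T n).
Local Notation grid := (@grid R T n).

Definition interp_coeffs f := forall h, exists phi, f h = interp phi.

Lemma gam01 : 0 < gam < 1.
Proof.
by apply/andP; split; [exact: (gam_gt0 Ha Heps)|case/andP: Heps => e0 _; lra].
Qed.

Lemma interp0 : interp (fun=> 0) = fun=> 0.
Proof.
apply/funext => t; rewrite /interp add0r big1 // => i _.
by rewrite subrr mul0r mul0r.
Qed.

Lemma interp_hoelder_coeffs f : interp_coeffs f -> hoelder_coeffs alpha eps f.
Proof.
move=> fi h _; have [phi ->] := fi h.
by apply: little_hoelder_bound; [exact: gam01|exact: interp_little_hoelder gam01 _ _].
Qed.

Lemma grid_matching X Z : span_valued alpha Z -> exists f,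
  [/\ interp_coeffs f, forall h, h \notin FL -> f h = fun=> 0 &
      forall i, (i <= n)%N -> Gamma_path P f X (grid i) = Z (grid i)].
Proof.
move=> spanZ.
suff /(_ N (leqnn N))[f [fi f0 fZ]] : forall m, (m <= N)%N -> exists f,
  [/\ interp_coeffs f, forall h, ~~ ((h \in FL) && (N - m <= nodes h)%N) -> f h = fun=> 0 &
      forall i h, (i <= n)%N -> h \in FL -> (N - m <= nodes h)%N ->
        (Gamma_path P f X (grid i))@_h = (Z (grid i))@_h].
  exists f; split=> // [h hF|i i_n]; first by rewrite f0 // negb_and hF.
  have GS : span_valued alpha (Gamma_path P f X) by exact: Gamma_path_span.
  apply/malgP => h; have [hF|hF] := boolP (h \in FL); first by rewrite fZ // subnn.
  rewrite !mcoeff_outdom //; apply: contra hF; rewrite in_FL; first exact: spanZ.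
  exact: GS.
elim=> [|m IH] mN.
  exists (fun _ => interp (fun=> 0)); split=> [h|h _|i h _]; first by exists (fun=> 0).
    exact: interp0.
  rewrite in_FL subn0 => hN Nh; have := N_gt0 Ha.
  by rewrite -ltnS prednK ?N_gt0 // ltnNge Nh in hN.
have [f [fi f0 fZ]] := IH (ltnW mN).
pose l := (N - m.+1)%N.
(* In degree l the correction interpolates the current error. By linearity it is added to the path;
   it contributes nothing above degree l, and exactly k in degree l. *)
pose k h : I -> R := if (h \in FL) && (nodes h == l) then
  interp (fun t => (Z t)@_h - (Gamma_path P f X t)@_h) else interp (fun=> 0).
have ki : interp_coeffs k by move=> h; rewrite /k; case: ifP => _; eexists.
pose f' h := if (h \in FL) && (nodes h == l) then k h else f h.
have fE : f' = (fun h t => 1 * f h t + k h t).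
  apply/funext => h; apply/funext => t; rewrite /f' /k mul1r; case: ifPn => [/andP[hF /eqP hl]|_].
    have -> : f h = fun=> 0.
      by apply: f0; apply/negP => /andP[_]; rewrite hl /l; clear -mN; lia.
    by rewrite /= add0r hF hl eqxx.
  by rewrite interp0 addr0.
have GE : Gamma_path P f' X = Gamma_path P f X + Gamma_path P k X.
  rewrite fE (Gamma_linear Ha Heps HP) ?scale1r //; exact: interp_hoelder_coeffs.
have kg := Gamma_is_gamma Ha Heps HP X (interp_hoelder_coeffs ki).
have ktop : forall h t, h \in FL -> (l <= nodes h)%N -> (Gamma_path P k X t)@_h = k h t.
  apply: gamma_top_level kg _ => h hF lh; rewrite /k gtn_eqF // andbF; exact: interp0.
exists f'; split.
- by move=> h; rewrite /f'; case: ifP => _; [exact: ki|exact: fi].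
- move=> h; rewrite -/l => hl; rewrite /f' /k; case: ifPn => [/andP[hF /eqP lh]|_].
    by rewrite hF lh leqnn in hl.
  apply: f0; apply: contra hl => /andP[-> /=]; apply: leq_trans; rewrite /l; clear; lia.
- move=> i h i_n hF; rewrite -/l => lh; rewrite GE /= mcoeffD ktop // /k hF /=.
  case: eqVneq => [hl|hl]; first by rewrite interp_grid // addrC subrK.
  rewrite interp0 /= addr0; apply: fZ => //; move: lh; rewrite leq_eqVlt eq_sym (negPf hl) /= /l.
  by clear -mN; lia.
Qed.

End GridMatching.

(** * Remainders of piecewise affine sections within one cell *)

Section CellEstimate.
Variables (R : realType) (A : finType) (T : {posnum R}) (alpha eps : R).
Local Notation F := (forest A).
Local Notation H := {malg R[F]}.
Local Notation I := (time T).
Local Notation N := (Nlevel alpha).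
Local Notation FL := (@FL R A alpha).
Hypothesis Ha : 0 < alpha < 1.
Hypothesis Heps : 0 < eps < 1 - N%:R * alpha.
Implicit Types (X Y : rough_path A T alpha) (h g : F) (s t u a b : I) (z : H) (Z W V : I -> H).
Implicit Types (f : F -> I -> R).

Local Notation th := (1 - eps + alpha).
Local Notation is_gamma := (@is_gamma R A T alpha eps).
Local Notation gamma_at f := (gamma_at eps f).
Local Notation interp n := (@interp R T n).
Local Notation grid n := (@grid R T n).
Local Notation cell n := (@cell R T n).
Local Notation width n := (@width R T n).

Let Kal : R := apriori_const (1 + alpha).

Lemma al1 : 1 < 1 + alpha. Proof. by rewrite ltrDl; case/andP: Ha. Qed.

Lemma Kal_ge0 : 0 <= Kal.
Proof. by rewrite invr_ge0 subr_ge0 ltW // half_lt // al1. Qed.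

(** One factor x^alpha is kept and the other powers of x are absorbed into powers of d; with the
    first power of y this gives the order 1 + alpha, enough for sewing inside a cell. *)
Lemma powR_step (d x y : R) k l m : 0 < d -> 0 <= x -> x <= d -> 0 <= y -> y <= d -> (0 < k)%N ->
  (k + l = m.+1)%N ->
  x `^ (alpha *+ k) * (d `^ (alpha *+ l) * (y / d)) <=
    d `^ (alpha *+ m) / d * (x `^ alpha * y).
Proof.
case/andP: Ha => a0 a1 d0 x0 xd y0 yd; case: k => // k _ /eqP; rewrite addSn eqSS => /eqP klm.
have i0 : 0 <= d^-1 by rewrite invr_ge0 ltW.
have le1 : x `^ (alpha *+ k) <= d `^ (alpha *+ k).
  by apply: le_powR_base => //; rewrite mulrn_wge0 // ltW.
have E1 : x `^ (alpha *+ k.+1) = x `^ alpha * x `^ (alpha *+ k).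
  have [->|xn] := eqVneq x 0; last by rewrite mulrS powRD // xn implybT.
  by rewrite powR0 ?mulrn_eq0 ?gt_eqF //= powR0 ?gt_eqF // mul0r.
have E2 : d `^ (alpha *+ m) = d `^ (alpha *+ k) * d `^ (alpha *+ l).
  by rewrite -klm mulrnDr powRD // (gt_eqF d0) implybT.
rewrite E1 E2; have := powR_ge0 x alpha; have := powR_ge0 d (alpha *+ l).
move: (x `^ alpha) (x `^ (alpha *+ k)) (d `^ (alpha *+ k)) (d `^ (alpha *+ l)) le1.
move=> p q r u qr u0 p0.
have -> : p * q * (u * (y / d)) = q * (p * u * y * d^-1) by ring.
have -> : r * u / d * (p * y) = r * (p * u * y * d^-1) by ring.
by apply: ler_wpM2r => //; rewrite !mulr_ge0.
Qed.

Lemma powR_cell (d x : R) m : 0 < d -> 0 <= x -> x <= d ->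
  d `^ (alpha *+ m) / d * x `^ (1 + alpha) <= d `^ (alpha *+ m.+1) * (x / d).
Proof.
case/andP: Ha => a0 a1 d0 x0 xd.
have le1 : x `^ alpha <= d `^ alpha by apply: le_powR_base => //; exact: ltW.
have -> : d `^ (alpha *+ m.+1) = d `^ (alpha *+ m) * d `^ alpha.
  by rewrite mulrSr powRD // (gt_eqF d0) implybT.
have -> : x `^ (1 + alpha) = x * x `^ alpha.
  by rewrite powRD ?powRr1 // gt_eqF ?addr_gt0.
have w0 : 0 <= d `^ (alpha *+ m) / d * x by rewrite mulr_ge0 // divr_ge0 ?powR_ge0 // ltW.
have := ler_wpM2l w0 le1; congr (_ <= _); ring.
Qed.

(** The slope of an affine coefficient is controlled by the remainder between the two ends of the
    cell, where [W] agrees with the path to be approximated. *)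
Lemma interp_cell_bound (M K : R) : 0 <= M -> 0 <= K -> exists2 C, 0 <= C &
  forall X n f W, (0 < n)%N -> bdd X M -> is_gamma f X W ->
  (forall h, h \in FL -> exists phi, f h = interp n phi) ->
  (forall j h, (j < n)%N -> h \in FL -> `|(rem X W (grid n j) (grid n j.+1))@_h| <=
    K * width n `^ (alpha *+ (N - nodes h))) ->
  forall h, h \in FL -> forall j s t, (j < n)%N -> cell n j s -> cell n j t ->
    `|(rem X W s t)@_h| <= C * (width n `^ (alpha *+ (N - nodes h)) * (tdist s t / width n)).
Proof.
move=> M0 K0; case/andP: (Ha) => a0 a1.
suff main k : exists2 C, 0 <= C &
    forall X n f W, (0 < n)%N -> bdd X M -> is_gamma f X W ->
    (forall h, h \in FL -> exists phi, f h = interp n phi) ->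
    (forall j h, (j < n)%N -> h \in FL -> `|(rem X W (grid n j) (grid n j.+1))@_h| <=
      K * width n `^ (alpha *+ (N - nodes h))) ->
    forall h, h \in FL -> (N - k <= nodes h)%N -> forall j s t, (j < n)%N ->
      cell n j s -> cell n j t ->
      `|(rem X W s t)@_h| <= C * (width n `^ (alpha *+ (N - nodes h)) * (tdist s t / width n)).
  have [C C0 HC] := main N; exists C => // X n f W n0 XM Wg fi WK h hF.
  by have := HC X n f W n0 XM Wg fi WK h hF; rewrite subnn => /(_ isT).
elim: k => [|k [C C0 IH]].
  exists 0 => // X n f W _ _ _ _ _ h; rewrite in_FL subn0 => hN Nh; have := N_gt0 Ha.
  by rewrite -ltnS prednK ?N_gt0 // ltnNge Nh in hN.
pose c1 := Kal * (nFL A alpha * (csk A alpha * M * C)).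
have c10 : 0 <= c1.
  by rewrite mulr_ge0 ?Kal_ge0 // mulr_ge0 ?nFL_ge0 // !mulr_ge0 // csk_ge0.
exists (c1 + (K + c1)); first by rewrite !addr_ge0.
move=> X n f W n0 XM Wg fi WK h hF hk j s t jn sj tj.
have d0 := width_gt0 T n0; set d := width n in d0 *.
have rb g u v : g \in FL -> (nodes h < nodes g)%N -> cell n j u -> cell n j v ->
    `|(rem X W u v)@_g| <= C * (d `^ (alpha *+ (N - nodes g)) * (tdist u v / d)).
  move=> gF hg uj vj; apply: (IH _ _ _ _ n0 XM Wg fi WK _ gF _ j) => //; exact: level_lt hg.
have [spanW Wat] := Wg; have [_ [B B0 HB]] := Wat h hF.
pose G s t := (rem X W s t)@_h - (f h t - f h s).
have hN : (nodes h < N)%N by rewrite -[ltnRHS](prednK (N_gt0 Ha)) ltnS -in_FL.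
(* The power of the width that remains in the defect once |t - s|^(1 + alpha) has been taken out. *)
have [q qE] : exists q, q = d `^ (alpha *+ (N - nodes h).-1) / d by eexists.
have q0 : 0 <= q by rewrite qE divr_ge0 ?powR_ge0 // ltW.
have Gb u v : cell n j u -> cell n j v ->
    `|G u v| <= c1 * (d `^ (alpha *+ (N - nodes h)) * (tdist u v / d)).
  move=> uj vj.
  (* Cells are closed under midpoints, so the estimate can be localised. Inside a cell the higher
     remainders are of first order in |t - s|, which replaces the exponent th by 1 + alpha; th only
     remains in the qualitative bound. *)
  have := @sewing_apriori R T G (cell n j) B (nFL A alpha * (csk A alpha * M * C) * q)
    (1 + alpha) th u v al1 (th_gt1 Ha Heps) B0 _ (@cell_midpt R T n j) uj vj (fun u v _ _ => HB u v).
  move=> /(_ _ _)/le_trans; apply.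
  - by rewrite mulr_ge0 // mulr_ge0 ?nFL_ge0 // !mulr_ge0 // csk_ge0.
  - move=> a b aj bj; have mj := cell_midpt aj bj.
    rewrite /G rem_increment (pairing_FL (alpha := alpha)); last exact: rem_supp.
    apply: le_trans (ler_norm_sum _ _ _) _; rewrite /nFL -!mulrA mulr_suml.
    rewrite big_seq [leRHS]big_seq; apply: ler_sum => g gF; rewrite mul1r.
    have x0 := tdist_ge0 a b.
    have r0 : 0 <= csk A alpha * (M * (C * (q * tdist a b `^ (1 + alpha)))).
      apply: mulr_ge0; first exact: csk_ge0.
      do 3!apply: mulr_ge0 => //; exact: powR_ge0.
    have [gh|hg] := leqP (nodes g) (nodes h); first by rewrite chi_low // mulr0 normr0.
    rewrite normrM; apply: le_trans (ler_pM (normr_ge0 _) (normr_ge0 _) (rb g _ _ gF hg aj mj)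
      (chi_bound _ _ XM M0 hF gF)) _.
    have st := @powR_step d (tdist (midpt a b) b) (tdist a (midpt a b)) (nodes g - nodes h)
      (N - nodes g) (N - nodes h).-1 d0 (tdist_ge0 _ _) (cell_dist mj bj)
      (tdist_ge0 _ _) (cell_dist aj mj).
    move: st; rewrite subn_gt0 => /(_ hg); rewrite -qE => st.
    have cMC : 0 <= csk A alpha * M * C by rewrite !mulr_ge0 // csk_ge0.
    have := ler_wpM2l cMC (st _); move=> /(_ _) {}st.
    apply: le_trans (_ : _ <= csk A alpha * M * C *
      (q * (tdist (midpt a b) b `^ alpha * tdist a (midpt a b)))) _.
      apply: le_trans (st _).
        by rewrite le_eqVlt; apply/orP; left; apply/eqP; ring.
      rewrite prednK ?subn_gt0 //; have := FL_leN gF; clear -hg; lia.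
    rewrite -!mulrA; do 4!(apply: ler_wpM2l; rewrite ?csk_ge0 //).
    rewrite tdist_midptl tdist_midptr powRD ?powRr1 //; last first.
      by rewrite gt_eqF ?addr_gt0.
    rewrite mulrC; apply: ler_pM => //; rewrite ?powR_ge0 ?divr_ge0 //; first by lra.
    by apply: le_powR_base; rewrite ?(ltW a0) ?divr_ge0 //; lra.
  - have x0 := tdist_ge0 u v; have xd := cell_dist uj vj.
    have := ler_wpM2l c10 (powR_cell (N - nodes h).-1 d0 x0 xd).
    by rewrite prednK ?subn_gt0 // -qE /c1 /Kal; congr (_ <= _); ring.
have fb u v : cell n j u -> cell n j v ->
    `|f h v - f h u| <= (K + c1) * (d `^ (alpha *+ (N - nodes h)) * (tdist u v / d)).
  move=> uj vj; have [phi fE] := fi h hF.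
  have gl := @grid_celll R T n n0 j jn; have gr := @grid_cellr R T n n0 j jn.
  have fg : f h (grid n j.+1) - f h (grid n j) = phi (grid n j.+1) - phi (grid n j).
    by rewrite fE !interp_grid // ltnW.
  have -> : f h v - f h u = (phi (grid n j.+1) - phi (grid n j)) / d * (\val v - \val u).
    by rewrite fE; exact: interp_cell.
  rewrite -fg.
  rewrite normrM normrM [X in _ * X * _]gtr0_norm ?invr_gt0 // -/(tdist u v).
  have gd : tdist (grid n j) (grid n j.+1) <= d by exact: cell_dist gl gr.
  have p0 := powR_ge0 d (alpha *+ (N - nodes h)).
  (* Between the two ends of the cell the remainder is bounded by hypothesis, and it differs from
     the increment of f by G. *)
  have fgb : `|f h (grid n j.+1) - f h (grid n j)| <= (K + c1) * d `^ (alpha *+ (N - nodes h)).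
    rewrite -(subKr (rem X W (grid n j) (grid n j.+1))@_h (_ - _)) mulrDl.
    apply: le_trans (ler_normB _ _) _; apply: lerD; first exact: WK.
    apply: le_trans (Gb _ _ gl gr) _; apply: ler_wpM2l => //.
    by rewrite ler_piMr // ler_pdivrMr // mul1r.
  have t0 : 0 <= tdist u v / d by rewrite divr_ge0 ?tdist_ge0 // ltW.
  have := ler_wpM2r t0 fgb; congr (_ <= _); ring.
rewrite -[(rem X W s t)@_h](subrK (f h t - f h s)) [leRHS]mulrDl.
by apply: le_trans (ler_normD _ _) _; apply: lerD; [exact: Gb|exact: fb].
Qed.
End CellEstimate.

(** * Paths vanishing on the grid *)

Section Density.
Variables (R : realType) (A : finType) (T : {posnum R}) (alpha beta eps : R).
Local Notation F := (forest A).
Local Notation H := {malg R[F]}.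
Local Notation I := (time T).
Local Notation N := (Nlevel alpha).
Local Notation FL := (@FL R A alpha).
Hypothesis Ha : 0 < alpha < 1.
Hypothesis Hb : 0 < beta < alpha.
Implicit Types (X Y : rough_path A T alpha) (h g : F) (s t u a b : I) (z : H) (Z W V : I -> H).
Implicit Types (f : F -> I -> R).

Local Notation grid n := (@grid R T n).
Local Notation cl n := (@cell R T n).
Local Notation width n := (@width R T n).

Let TN : R := (1 + T%:num) `^ (alpha *+ N).

(** As t is outside the cell of s, one end of that cell lies between s and t. *)
Lemma near_grid n s t : (0 < n)%N ->
  (forall j, (j < n)%N -> cl n j s -> ~ cl n j t) ->
  exists i j, [/\ (i <= n)%N, (j < n)%N, cl n j s, cl n j (grid n i) &
    tdist (grid n i) s <= tdist s t].
Proof.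
move=> n0 st; have [j jn js] := in_cell n0 s; have tj := st j jn js.
have [t1|t1] := leP (j%:R * width n) (\val t); last first.
  exists j, j; split=> //; [exact: (ltnW jn)|exact: grid_celll|].
  have := js; rewrite /cell /mkset => /andP[s1 _].
  rewrite tdist_le ?val_grid ?(ltnW jn) // tdistC tdist_le; last by apply/ltW/(lt_le_trans t1).
  by rewrite lerD2l lerN2 ltW.
have [t2|t2] := leP (\val t) (j.+1%:R * width n).
  by case: tj; rewrite /cell /mkset t1.
exists j.+1, j; split=> //; first exact: grid_cellr.
have := js; rewrite /cell /mkset => /andP[_ s2].
rewrite tdistC tdist_le ?val_grid // tdist_le; last by apply: le_trans s2 (ltW t2).
by rewrite lerD2r ltW.
Qed.

(** Since k >= 1, a factor y^(alpha - beta) can be split off and bounded by d^(alpha - beta): this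
    is the gain that tends to 0. The other powers pass to x, with total exponent at least (k + l)
    beta. *)
Lemma powR_gain (d x y : R) k l : 0 <= y -> y <= x -> x <= T%:num -> y <= d ->
  (0 < k)%N -> (k + l <= N)%N ->
  y `^ (alpha *+ k) * x `^ (alpha *+ l) <=
    TN * (d `^ (alpha - beta) * x `^ (beta *+ (k + l))).
Proof.
case/andP: Ha => a0 a1; case/andP: Hb => b0 ba y0 yx xT yd k0 klN.
have [->|yn] := eqVneq y 0.
  rewrite powR0 ?mul0r ?mulr_ge0 ?powR_ge0 //.
  by rewrite mulrn_eq0 negb_or -lt0n k0 gt_eqF.
have y1 : 0 < y by rewrite lt_def yn.
have x1 := lt_le_trans y1 yx.
have k1 : 1 <= k%:R :> R by rewrite ler1n.
have l0 : 0 <= l%:R :> R by [].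
have kb : (alpha - beta) * 1 <= (alpha - beta) * k%:R by rewrite ler_wpM2l // subr_ge0 ltW.
have lb : 0 <= (alpha - beta) * l%:R by rewrite mulr_ge0 // subr_ge0 ltW.
have bk : 0 <= beta * k%:R by rewrite mulr_ge0 // ltW.
have bl : 0 <= beta * l%:R by rewrite mulr_ge0 // ltW.
have bk1 : 0 < beta * k%:R by rewrite mulr_gt0 // (lt_le_trans ltr01).
have klN' : alpha * (k + l)%:R <= alpha * N%:R by rewrite ler_wpM2l ?(ltW a0) // ler_nat.
rewrite natrD in klN'.
have -> : y `^ (alpha *+ k) = y `^ (alpha - beta) * y `^ (alpha *+ k - (alpha - beta)).
  by rewrite -powRD ?(negPf yn) ?implybT // addrC subrK.
have h1 : y `^ (alpha - beta) <= d `^ (alpha - beta).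
  by apply: le_powR_base => //; rewrite subr_ge0 ltW.
have h2 : y `^ (alpha *+ k - (alpha - beta)) <= x `^ (alpha *+ k - (alpha - beta)).
  by apply: le_powR_base => //; rewrite -mulr_natr; lra.
have h3 : x `^ (alpha *+ k - (alpha - beta)) * x `^ (alpha *+ l) <= TN * x `^ (beta *+ (k + l)).
  rewrite -powRD; last by rewrite (gt_eqF x1) implybT.
  rewrite /TN -!(mulr_natr alpha) -(mulr_natr beta) natrD.
  apply: powR_le_exp; [by rewrite (ltW x1)|lra|lra|lra|left; lra].
rewrite -mulrA [leRHS]mulrCA; apply: ler_pM => //; rewrite ?mulr_ge0 ?powR_ge0 //.
by apply: le_trans h3; apply: ler_wpM2r => //; exact: powR_ge0.
Qed.

Lemma rem_vanish X V u t : V u = 0 -> rem X V u t = V t.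
Proof. by rewrite /rem => ->; rewrite linear0 subr0. Qed.

Lemma star_rp_low X h s t g : (nodes g < nodes h)%N -> star (rp X s t) (dirac R h) g = 0.
Proof.
move=> gh; have : chi X h s t g = 0 by apply: chi_low; exact: ltnW.
rewrite /chi starBl star1f diracE => /eqP; rewrite subr_eq0 => /eqP ->.
by case: eqP => // gE; rewrite gE ltnn in gh.
Qed.

(** Times in different cells are separated by points of the grid, at which [V] vanishes. *)
Lemma vanish_rem_bound X M V n D : (0 < n)%N -> bdd X M -> 0 <= M -> 0 <= D ->
  span_valued alpha V -> (forall i, (i <= n)%N -> V (grid n i) = 0) ->
  (forall h j s t, h \in FL -> (j < n)%N -> cl n j s -> cl n j t ->
    `|(rem X V s t)@_h| <= D * tdist s t `^ (alpha *+ (N - nodes h))) ->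
  forall h s t, h \in FL -> `|(rem X V s t)@_h| <=
    D * (1 + nFL A alpha * (csk A alpha * M)) * TN * width n `^ (alpha - beta) *
    tdist s t `^ (beta *+ (N - nodes h)).
Proof.
move=> n0 XM M0 D0 spanV V0 VD h s t hF; case/andP: (Ha) => a0 a1.
have d0 := width_gt0 T n0; set d := width n in d0 *; set x := tdist s t.
have x0 : 0 <= x := tdist_ge0 s t; have xT : x <= T%:num := tdist_leT s t.
have nh g : g \in FL -> (0 < N - nodes g)%N.
  by have := N_gt0 Ha; rewrite in_FL; clear; lia.
have c0 : 0 <= nFL A alpha * (csk A alpha * M) by rewrite mulr_ge0 ?nFL_ge0 // mulr_ge0 // csk_ge0.
have w0 : 0 <= d `^ (alpha - beta) * x `^ (beta *+ (N - nodes h)) by rewrite mulr_ge0 // powR_ge0.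
have TN0 : 0 <= TN by exact: powR_ge0.
rewrite -!mulrA; set w := d `^ _ * _ in w0 *.
have [[j [jn sj tj]]|ncell] := pselect (exists j, [/\ (j < n)%N, cl n j s & cl n j t]).
  apply: le_trans (VD h j s t hF jn sj tj) _; apply: ler_wpM2l => //.
  have xd := cell_dist sj tj.
  have := @powR_gain d x x (N - nodes h) 0 x0 (lexx x) xT xd (nh h hF).
  rewrite addn0 mulr0n powRr0 mulr1 leq_subr => /(_ isT) /le_trans; apply.
  by rewrite mulrDl mul1r lerDl mulr_ge0 // mulr_ge0.
(* Bounds the distance from s, and from t, to a point of the grid in the same cell. *)
pose y := Num.min x d.
have y0 : 0 <= y by rewrite le_min x0 ltW.
have yx : y <= x by rewrite ge_min lexx.
have yd : y <= d by rewrite ge_min lexx orbT.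
have Vb u v g : tdist u v = x -> (forall j, (j < n)%N -> cl n j u -> ~ cl n j v) ->
    g \in FL -> `|(V u)@_g| <= D * y `^ (alpha *+ (N - nodes g)).
  move=> uvx uv gF; have [i [j [i_n jn uj ij iu]]] := near_grid n0 uv.
  rewrite -(rem_vanish X u (V0 i i_n)); apply: le_trans (VD g j _ _ gF jn ij uj) _.
  apply: ler_wpM2l => //; apply: le_powR_base; rewrite ?mulrn_wge0 ?tdist_ge0 ?(ltW a0) //.
  by rewrite le_min -uvx iu; exact: cell_dist ij uj.
have Vs g : g \in FL -> `|(V s)@_g| <= D * y `^ (alpha *+ (N - nodes g)).
  by apply: (Vb s t) => // j jn sj tj; apply: ncell; exists j.
have Vt : `|(V t)@_h| <= D * y `^ (alpha *+ (N - nodes h)).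
  by apply: (Vb t s) => //; [exact: tdistC|move=> j jn tj sj; apply: ncell; exists j].
(* The values of V at both times are already small, so V_t and the transport of V_s are estimated
   separately, without cancellation. *)
rewrite /rem mcoeffB coeff_shift (pairing_FL (alpha := alpha)); last exact: spanV.
apply: le_trans (ler_normB _ _) _; rewrite mulrDl mul1r mulrDr; apply: lerD.
  apply: le_trans Vt _; apply: ler_wpM2l => //.
  have := @powR_gain d x y (N - nodes h) 0 y0 yx xT yd (nh h hF).
  by rewrite addn0 mulr0n powRr0 mulr1 leq_subr => /(_ isT).
apply: le_trans (ler_norm_sum _ _ _) _.
rewrite /nFL -!mulrA mulr_suml mulr_sumr big_seq [leRHS]big_seq; apply: ler_sum => g gF.
rewrite mul1r.
have r0 : 0 <= D * (csk A alpha * (M * (TN * w))).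
  apply: mulr_ge0 => //; apply: mulr_ge0; first exact: csk_ge0.
  by do 2!apply: mulr_ge0 => //.
have [gh|hg] := ltnP (nodes g) (nodes h); first by rewrite star_rp_low // mulr0 normr0.
rewrite normrM; apply: le_trans (ler_pM (normr_ge0 _) (normr_ge0 _) (Vs g gF)
  (star_bound _ _ XM M0 hF gF)) _.
have gN : (nodes g <= N)%N by exact: FL_leN gF.
have klE : (N - nodes g + (nodes g - nodes h) = N - nodes h)%N by clear -gN hg; lia.
have := @powR_gain d x y (N - nodes g) (nodes g - nodes h) y0 yx xT yd (nh g gF).
rewrite klE leq_subr => /(_ isT) le1.
have m0 : 0 <= D * (csk A alpha * M) by rewrite mulr_ge0 // mulr_ge0 // csk_ge0.
have := ler_wpM2l m0 le1; rewrite -/w -/x; congr (_ <= _); ring.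
Qed.

End Density.

Section InterpolationDensity.
Variables (R : realType) (A : finType) (T : {posnum R}) (alpha beta eps : R).
Local Notation F := (forest A).
Local Notation H := {malg R[F]}.
Local Notation I := (time T).
Local Notation N := (Nlevel alpha).
Local Notation FL := (@FL R A alpha).
Hypothesis Ha : 0 < alpha < 1.
Hypothesis Hb : 0 < beta < alpha.
Hypothesis Heps : 0 < eps < 1 - N%:R * alpha.
Variable P : set H.
Hypothesis HP : primitive_basis P.
Implicit Types (X Y : rough_path A T alpha) (h g : F) (s t u a b : I) (z : H) (Z W V : I -> H).
Implicit Types (f : F -> I -> R).

Local Notation gam := (1 - eps).

(** Equivalent to (x / d)^(1 - a) <= 1 for x > 0. It is applied with a = (N - |h|) alpha, which is
    at most N alpha < 1. *)
Lemma cell_powR (d x a : R) : 0 < d -> 0 <= x -> x <= d -> 0 < a -> a <= 1 ->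
  d `^ a * (x / d) <= x `^ a.
Proof.
move=> d0 x0 xd a0 a1; have [->|xn] := eqVneq x 0.
  by rewrite mul0r mulr0 powR_ge0.
have le1 : x `^ (1 - a) <= d `^ (1 - a) by apply: le_powR_base; rewrite ?subr_ge0.
have E y : y != 0 -> 0 <= y -> y `^ a * y `^ (1 - a) = y.
  by move=> yn y0; rewrite -powRD ?yn ?implybT // addrC subrK powRr1.
rewrite -[x in x / d](E x xn x0) -[d in _ / d](E d (lt0r_neq0 d0) (ltW d0)).
rewrite mulrA ler_pdivrMr ?mulr_gt0 ?powR_gt0 // mulrCA; apply: ler_wpM2l => //.
  exact: powR_ge0.
by apply: ler_wpM2l => //; exact: powR_ge0.
Qed.

Lemma ctrl_approx X Z e : ctrl X Z -> 0 < e -> exists f,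
  coeffs alpha (little_hoelder gam) f /\
  (ctrl_norm X beta (Z - Gamma_path P f X)%R < e%:E)%E.
Proof.
move=> [spanZ Zfin] e0; case/andP: (Ha) => a0 a1; case/andP: (Hb) => b0 ba.
have [M M1 XM] := rough_bound X a0; have M0 := le_trans ler01 M1.
have [K K0 ZK] : exists2 K, 0 <= K & (ctrl_norm X alpha Z <= K%:E)%E.
  have fin : ctrl_norm X alpha Z \is a fin_num by rewrite ge0_fin_numE // ctrl_norm_ge0.
  exists (fine (ctrl_norm X alpha Z)); first exact/fine_ge0/ctrl_norm_ge0.
  by rewrite fineK.
have Zrem h s t : h \in FL -> `|(rem X Z s t)@_h| <= K * tdist s t `^ (alpha *+ (N - nodes h)).
  move=> hF; have [_ HK] := ctrl_norm_rem ZK hF; have [->|/eqP st] := eqVneq s t; last exact: HK.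
  by rewrite rem_diag mcoeff0 normr0 mulr_ge0 ?powR_ge0.
have [C C0 HC] := interp_cell_bound A T Ha Heps M0 K0.
have D0 : 0 <= K + C by rewrite addr_ge0.
pose c := (K + C) * (1 + nFL A alpha * (csk A alpha * M)) * (1 + T%:num) `^ (alpha *+ N).
have c0 : 0 <= c.
  rewrite /c mulr_ge0 ?powR_ge0 // mulr_ge0 // addr_ge0 // mulr_ge0 ?nFL_ge0 //.
  by rewrite mulr_ge0 ?csk_ge0.
(* Chosen backwards: the final bound is [nFL] times c times the power alpha - beta of the width, r
   is the width for which this power equals e1, and n makes the actual width at most r. *)
pose e1 := e / (nFL A alpha * c + 1).
have k0 : 0 < nFL A alpha * c + 1 by rewrite ltr_wpDl // mulr_ge0 // nFL_ge0.
have e10 : 0 < e1 by rewrite divr_gt0.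
pose r := e1 `^ (alpha - beta)^-1.
have r0 : 0 < r by rewrite powR_gt0.
pose n := (Num.truncn (T%:num / r)).+1.
have n0 : (0 < n)%N by [].
have dr : width T n <= r.
  rewrite /width ler_pdivrMr ?ltr0n // mulrC -ler_pdivrMr //.
  by apply/ltW/truncnS_gt.
have de : width T n `^ (alpha - beta) <= e1.
  apply: (@le_trans _ _ (r `^ (alpha - beta))).
    by apply: le_powR_base => //; [rewrite subr_ge0 ltW|exact/ltW/width_gt0].
  by rewrite /r -powRrM mulVf ?powRr1 ?(ltW e10) // subr_eq0 gt_eqF.
have [f [fi f0 fZ]] := grid_matching Ha Heps HP n0 X spanZ.
exists f; split.
  move=> h; split=> hF; last first.
    by rewrite f0 // in_FL; apply/negP.
  by have [phi ->] := fi h; apply: interp_little_hoelder => //; exact: gam01 Ha Heps.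
have fH : hoelder_coeffs alpha eps f by exact: (interp_hoelder_coeffs Ha Heps fi).
have Wg := Gamma_is_gamma Ha Heps HP X fH.
set W := Gamma_path P f X in fZ Wg *.
have spanW := Wg.1.
have remV h s t : (rem X (Z - W) s t)@_h = (rem X Z s t)@_h - (rem X W s t)@_h.
  by rewrite addrC -scaleN1r rem_linear mcoeffD mcoeffZ mulN1r addrC.
have spanV : span_valued alpha (Z - W).
  move=> t; apply: on_suppD; first exact: spanZ.
  by rewrite -scaleN1r; apply: on_suppZ; exact: spanW.
have V0 i : (i <= n)%N -> (Z - W) (grid T n i) = 0.
  by move=> i_n; rewrite [LHS](_ : _ = Z (grid T n i) - W (grid T n i)) // fZ // subrr.
have gdist j : (j < n)%N -> tdist (grid T n j) (grid T n j.+1) <= width T n.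
  by move=> jn; exact: cell_dist (@grid_celll R T n n0 j jn) (@grid_cellr R T n n0 j jn).
have nh g : g \in FL -> (0 < N - nodes g)%N by have := N_gt0 Ha; rewrite in_FL; clear; lia.
(* A remainder depends only on the values of the path at its two times, and on the grid W agrees
   with Z. *)
have WK j h : (j < n)%N -> h \in FL -> `|(rem X W (grid T n j) (grid T n j.+1))@_h| <=
    K * width T n `^ (alpha *+ (N - nodes h)).
  move=> jn hF; have -> : rem X W (grid T n j) (grid T n j.+1) = rem X Z (grid T n j) (grid T n j.+1).
    by rewrite /rem !fZ // ltnW.
  apply: le_trans (Zrem h _ _ hF) _; apply: ler_wpM2l => //; apply: le_powR_base => //.
  - by rewrite mulrn_wge0 // ltW.
  - exact: tdist_ge0.
  - exact: gdist.
have Wcell := HC X n f W n0 XM Wg (fun h _ => fi h) WK.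
have Vcell h j s t : h \in FL -> (j < n)%N -> cell n j s -> cell n j t ->
    `|(rem X (Z - W) s t)@_h| <= (K + C) * tdist s t `^ (alpha *+ (N - nodes h)).
  move=> hF jn sj tj; rewrite remV mulrDl; apply: le_trans (ler_normB _ _) _; apply: lerD.
    exact: Zrem.
  apply: le_trans (Wcell h hF j s t jn sj tj) _; apply: ler_wpM2l => //.
  apply: cell_powR; [exact: width_gt0|exact: tdist_ge0|exact: cell_dist sj tj| |].
    by rewrite mulrn_wgt0 ?nh.
  apply: (@le_trans _ _ (N%:R * alpha)).
    by rewrite -[alpha *+ _]mulr_natl ler_wpM2r ?(ltW a0) // ler_nat leq_subr.
  by have := gam_gtN Heps; case/andP: Heps => ? _; lra.
have Vb := vanish_rem_bound Ha Hb n0 XM M0 D0 spanV V0 Vcell.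
have grid0 : time0 T = grid T n 0 by apply: val_inj; rewrite val_grid // mul0r.
have := @ctrl_norm_le R A T alpha X beta 0 (c * width T n `^ (alpha - beta)) (Z - W).
move=> /(_ _ _)/le_lt_trans; apply.
- by move=> h hF; rewrite grid0 V0 // mcoeff0 normr0.
- by move=> h hF s t _; exact: Vb.
rewrite lte_fin add0r.
have le1 : nFL A alpha * (c * width T n `^ (alpha - beta)) <= nFL A alpha * (c * e1).
  by apply: ler_wpM2l; [exact: nFL_ge0|exact: ler_wpM2l].
have eE : e = nFL A alpha * (c * e1) + e1 by rewrite /e1; field; rewrite gt_eqF.
by apply: (le_lt_trans le1); rewrite [ltRHS]eE ltrDl.
Qed.

End InterpolationDensity.

(** * Norm estimates for sections and the three claims *)

Section Sections.
Variables (R : realType) (A : finType) (T : {posnum R}) (alpha beta eps : R).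
Local Notation F := (forest A).
Local Notation H := {malg R[F]}.
Local Notation I := (time T).
Local Notation N := (Nlevel alpha).
Local Notation FL := (@FL R A alpha).
Hypothesis Ha : 0 < alpha < 1.
Hypothesis Hb : 0 < beta < alpha.
Hypothesis Heps : 0 < eps < 1 - N%:R * alpha.
Variable P : set H.
Hypothesis HP : primitive_basis P.
Implicit Types (X Y : rough_path A T alpha) (h g : F) (s t u : I) (z : H) (Z W V : I -> H).
Implicit Types (f : F -> I -> R).

Local Notation gam := (1 - eps).
Local Notation lh := (@little_hoelder R T gam).

Lemma level_gt0 h : h \in FL -> (0 < N - nodes h)%N.
Proof. by have := N_gt0 Ha; rewrite in_FL; clear; lia. Qed.

Lemma FL_forest h : h \in FL <-> forest_le N.-1 h.
Proof. by rewrite in_FL. Qed.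

(** (N - |h|) g <= N alpha < 1 - eps. Both exponents lie in [0, 1], whence the constant 1 + T. *)
Lemma gam_to_level s t (g : R) h : 0 < g -> g <= alpha -> h \in FL ->
  tdist s t `^ gam <= (1 + T%:num) * tdist s t `^ (g *+ (N - nodes h)).
Proof.
move=> g0 ga hF; rewrite -[X in X * _]powRr1 ?addr_ge0 //.
have gN : g *+ (N - nodes h) < gam.
  apply: le_lt_trans (gam_gtN Heps); rewrite -[g *+ _]mulr_natl.
  by apply: ler_pM => //; [exact: ltW|rewrite ler_nat leq_subr].
apply: powR_le_exp; rewrite ?tdist_itv //.
- by rewrite mulrn_wge0 // ltW.
- exact: ltW.
- have : 0 <= g *+ (N - nodes h) by rewrite mulrn_wge0 // ltW.
  by case/andP: Heps => e0 _; move: (g *+ _) => x x0; lra.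
- by left; rewrite mulrn_wgt0 // level_gt0.
Qed.

Lemma hoelder_coeffs_unif f : hoelder_coeffs alpha eps f -> exists2 B, 0 <= B &
  forall h, h \in FL -> forall s t, `|f h t - f h s| <= B * tdist s t `^ gam.
Proof.
move=> fH; have /choice[B HB] : forall h, exists B, h \in FL -> 0 <= B /\
    forall s t, `|f h t - f h s| <= B * tdist s t `^ gam.
  move=> h; have [hF|hF] := boolP (h \in FL); last by exists 0.
  by have [B B0 HB] := fH h hF; exists B.
exists (\sum_(h <- FL) `|B h|); first exact: sumr_ge0.
move=> h hF s t; have [B0 Hh] := HB h hF; apply: le_trans (Hh s t) _.
apply: ler_wpM2r; first exact: powR_ge0.
by apply: le_trans (ler_norm _) _; apply: (le_fsum (f := fun h => `|B h|)).
Qed.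

Lemma coeffs_hoelder f : coeffs alpha lh f -> hoelder_coeffs alpha eps f.
Proof.
move=> fc h hF; apply: little_hoelder_bound; first exact: gam01 Ha Heps.
by apply: (fc h).1; apply/FL_forest.
Qed.

Lemma little_hoelder0 : lh 0.
Proof.
apply/little_hoelderP => e e0; exists (fun _ => 0); first exact: smooth_cst.
split=> [t|s t]; rewrite !subrr ?subr0 normr0; first exact: ltW.
by rewrite mulr_ge0 ?powR_ge0 // ltW.
Qed.

Lemma coeffs0 : coeffs (A := A) alpha lh (fun _ _ => 0).
Proof. by move=> h; split=> // _; exact: little_hoelder0. Qed.

Lemma coeffsP c f f' : coeffs alpha lh f -> coeffs alpha lh f' ->
  coeffs alpha lh (fun h t => c * f h t + f' h t).
Proof.
move=> fc fc' h; have [f1 f2] := fc h; have [f1' f2'] := fc' h; split=> hF.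
  by apply: little_hoelderlP; [exact: f1|exact: f1'].
by apply/funext => t; rewrite f2 // f2' // /= mulr0 addr0.
Qed.

(** The same constant serves g = alpha and g = beta, and the bound is linear in the data of f: this
    gives both finiteness and the approximation by coefficients in Omega. *)
Lemma gamma_ctrl_norm M : 0 <= M -> exists2 C, 0 <= C & forall X f Z (B b g : R),
  0 < g -> g <= alpha -> bdd X M -> 0 <= B -> is_gamma eps f X Z ->
  (forall h, h \in FL -> `|f h (time0 T)| <= b) ->
  (forall h, h \in FL -> forall s t, `|f h t - f h s| <= B * tdist s t `^ gam) ->
  (ctrl_norm X g Z <= (nFL A alpha * (b + C * B))%:E)%E.
Proof.
move=> M0; have [C C0 HC] := gamma_rem_bound A T Ha Heps M0.
exists (C * (1 + T%:num)); first by rewrite mulr_ge0 // addr_ge0.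
move=> X f Z B b g g0 ga XM B0 Zg fb fB; apply: ctrl_norm_le.
  by move=> h hF; have [-> _] := Zg.2 h hF; exact: fb.
move=> h hF s t _; apply: le_trans (HC X f Z B XM B0 Zg fB h hF s t) _.
have CB0 : 0 <= C * B by rewrite mulr_ge0.
have := ler_wpM2l CB0 (gam_to_level s t g0 ga hF).
by congr (_ <= _); ring.
Qed.

Lemma Gamma_norm_fin X f (g : R) : 0 < g -> g <= alpha -> hoelder_coeffs alpha eps f ->
  (ctrl_norm X g (Gamma_path P f X) < +oo)%E.
Proof.
move=> g0 ga fH; case/andP: (Ha) => a0 a1.
have [M M1 XM] := rough_bound X a0.
have [C C0 HC] := gamma_ctrl_norm (le_trans ler01 M1).
have [B B0 fB] := hoelder_coeffs_unif fH.
apply: le_lt_trans (HC X f _ B (\sum_(h <- FL) `|f h (time0 T)|) g g0 ga XM B0 _ _ fB) _.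
- exact: (Gamma_is_gamma Ha Heps HP).
- by move=> h hF; apply: (le_fsum (f := fun h => `|f h (time0 T)|)).
- by rewrite ltry.
Qed.

Lemma Gamma_ctrl X f : hoelder_coeffs alpha eps f -> ctrl X (Gamma_path P f X).
Proof.
case/andP: (Ha) => a0 _ fH; split; first exact: (Gamma_is_gamma Ha Heps HP X fH).1.
exact: Gamma_norm_fin.
Qed.

Lemma ctrl_norm0 X (g : R) : ctrl_norm X g (0 : I -> H) = 0%E.
Proof.
apply/le_anti; rewrite ctrl_norm_ge0 andbT.
have := @ctrl_norm_le R A T alpha X g 0 0 0; rewrite addr0 mulr0; apply.
  by move=> h _; rewrite /= mcoeff0 normr0.
by move=> h _ s t _; rewrite /rem /= linear0 subr0 mcoeff0 normr0 mul0r.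
Qed.

Lemma ctrl_sub_closure X Z : ctrl X Z -> ctrl_closure X beta Z.
Proof.
move=> Zc; have [spanZ Zfin] := Zc; case/andP: (Ha) => a0 a1; case/andP: (Hb) => b0 ba.
split; [exact: spanZ| |by move=> e e0; exists Z => //; rewrite subrr ctrl_norm0].
have fin : ctrl_norm X alpha Z \is a fin_num by rewrite ge0_fin_numE // ctrl_norm_ge0.
have ZK : (ctrl_norm X alpha Z <= (fine (ctrl_norm X alpha Z))%:E)%E by rewrite fineK.
have K0 : 0 <= fine (ctrl_norm X alpha Z) by exact/fine_ge0/ctrl_norm_ge0.
move: (fine _) ZK K0 => K ZK K0.
apply: le_lt_trans (ltry _); apply: (ctrl_norm_le (b := K)
  (c := K * (1 + T%:num) `^ (alpha *+ N))).
  by move=> h hF; have [] := ctrl_norm_rem ZK hF.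
move=> h hF s t st; have [_ HK] := ctrl_norm_rem ZK hF.
apply: le_trans (HK s t st) _; rewrite -mulrA; apply: ler_wpM2l => //.
apply: powR_le_exp; rewrite ?tdist_itv //.
- by rewrite mulrn_wge0 // ltW.
- by rewrite lerMn2r ltW ?orbT.
- apply: (@le_trans _ _ (alpha *+ N)); first by rewrite ler_wpMn2l ?(ltW a0) // leq_subr.
  by rewrite lerDr mulrn_wge0 // ltW.
- by left; rewrite mulrn_wgt0 // level_gt0.
Qed.

(** A substitute for the triangle inequality: the two norms belong to different rough paths, so the
    remainders are compared instead of subtracting the paths. *)
Lemma ctrl_norm_close X Y (g c : R) Z W :
  (forall h, h \in FL -> (Z (time0 T))@_h = (W (time0 T))@_h) ->
  (forall h, h \in FL -> forall s t, s <> t ->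
    `|(rem X Z s t)@_h - (rem Y W s t)@_h| <= c * tdist s t `^ (g *+ (N - nodes h))) ->
  (ctrl_norm Y g W <= ctrl_norm X g Z + (nFL A alpha * c)%:E)%E.
Proof.
move=> ZW0 ZWc; rewrite !ctrl_normE /nFL mulr_suml.
have -> : (\sum_(h <- FL) 1 * c)%:E = (\sum_(h <- FL) c%:E)%E.
  by rewrite sumEFin; congr EFin; apply: eq_bigr => h _; rewrite mul1r.
rewrite -big_split /= big_seq [leRHS]big_seq; apply: lee_sum => h hF.
rewrite ZW0 // -addeA; apply: leeD => //.
have -> : (fun s t => (rem Y W s t)@_h) = (fun s t => (rem X Z s t)@_h +
    ((rem Y W s t)@_h - (rem X Z s t)@_h)).
  by apply/funext => s; apply/funext => t; rewrite addrC subrK.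
apply: le_trans (hoelderD _ _ _) _; apply: leeD => //.
by apply: hoelder_le => s t st; rewrite distrC; exact: ZWc.
Qed.

Lemma bdd_le X M M' : M <= M' -> bdd X M -> bdd X M'.
Proof.
move=> MM' XM h hN s t; apply: le_trans (XM h hN s t) _.
by apply: ler_wpM2r => //; exact: powR_ge0.
Qed.

Lemma Gamma_norm_continuous X f e : hoelder_coeffs alpha eps f -> 0 < e ->
  exists2 d : R, 0 < d & forall Y, (rough_dist X Y < d%:E)%E ->
    `|fine (ctrl_norm Y alpha (Gamma_path P f Y)) -
      fine (ctrl_norm X alpha (Gamma_path P f X))| < e.
Proof.
move=> fH e0; case/andP: (Ha) => a0 a1.
have [M M1 XM] := rough_bound X a0.
have M10 : 0 <= M + 1 by rewrite addr_ge0 // (le_trans ler01).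
have [C C0 HC] := gamma_rem_close A T Ha Heps M10.
have [B B0 fB] := hoelder_coeffs_unif fH.
pose c := nFL A alpha * (C * B * (1 + T%:num)).
have c0 : 0 <= c by rewrite /c mulr_ge0 ?nFL_ge0 // !mulr_ge0 // addr_ge0.
have ec0 : 0 < e / (c + 1) by rewrite divr_gt0 // ltr_wpDl.
(* The 1 keeps Y bounded by M + 1, so that C can be fixed before Y; the second term makes c times d
   smaller than e. *)
exists (Num.min 1 (e / (c + 1))); first by rewrite lt_min ltr01.
set d := Num.min _ _ => Y XYd.
have d0 : 0 < d by rewrite /d lt_min ltr01.
have d1 : d <= 1 by rewrite /d ge_min lexx.
have XY := rough_dist_close a0 d0 XYd.
have XM' : bdd X (M + 1) by apply: bdd_le XM; rewrite lerDl.
have YM' : bdd Y (M + 1) by apply: bdd_le (close_bdd (ltW d0) XM XY); rewrite lerD2l.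
have Xg := Gamma_is_gamma Ha Heps HP X fH; have Yg := Gamma_is_gamma Ha Heps HP Y fH.
set Z := Gamma_path P f X in Xg *; set W := Gamma_path P f Y in Yg *.
have Z0 h : h \in FL -> (Z (time0 T))@_h = (W (time0 T))@_h.
  by move=> hF; have [-> _] := Xg.2 h hF; have [-> _] := Yg.2 h hF.
have ZW h : h \in FL -> forall s t, s <> t -> `|(rem X Z s t)@_h - (rem Y W s t)@_h| <=
    C * B * (1 + T%:num) * d * tdist s t `^ (alpha *+ (N - nodes h)).
  move=> hF s t _.
  apply: le_trans (HC X Y f Z W B d XM' YM' XY (ltW d0) B0 Xg Yg fB h hF s t) _.
  have CB0 : 0 <= C * (B * d) by rewrite !mulr_ge0 // ltW.
  have := ler_wpM2l CB0 (gam_to_level s t a0 (lexx alpha) hF).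
  by congr (_ <= _); ring.
have n1 := ctrl_norm_close Z0 ZW.
have n2 := @ctrl_norm_close Y X alpha _ W Z (fun h hF => esym (Z0 h hF))
  (fun h hF s t st => eq_ind_r (fun x => x <= _) (ZW h hF s t st) (distrC _ _)).
have finX : ctrl_norm X alpha Z \is a fin_num.
  by rewrite ge0_fin_numE ?ctrl_norm_ge0 // Gamma_norm_fin.
have finY : ctrl_norm Y alpha W \is a fin_num.
  by rewrite ge0_fin_numE ?ctrl_norm_ge0 // Gamma_norm_fin.
move: n1 n2; rewrite -(fineK finX) -(fineK finY) -!EFinD !lee_fin.
have le_e : nFL A alpha * (C * B * (1 + T%:num) * d) < e.
  rewrite mulrA -/c; apply: (@le_lt_trans _ _ (c * (e / (c + 1)))).
    by apply: ler_wpM2l => //; rewrite /d ge_min lexx orbT.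
  rewrite mulrA ltr_pdivrMr ?ltr_wpDl // mulrC ltr_pM2l //.
  by rewrite ltrDl.
by rewrite ltr_norml => n1 n2; apply/andP; split; lra.
Qed.

Variable Omega : set (I -> R).
Hypothesis HOmega : countable_dense gam Omega.

Lemma coeffs_Omega_sub f : coeffs alpha Omega f -> coeffs alpha lh f.
Proof.
have [_ Osub _] := HOmega.
by move=> fO h; have [f1 f2] := fO h; split=> // hF; exact/Osub/f1.
Qed.

(** An element is determined by its finitely many components in F_(N-1), hence coded by the finite
    sequence of their codes. *)
Lemma countable_coeffs : countable (coeffs (A := A) alpha Omega).
Proof.
have [/countable_injP[c cinj] _ _] := HOmega.
apply/countable_injP; exists (fun f => choice.pickle [seq c (f h) | h <- FL]).
move=> f f'; rewrite !inE => fO fO' /(pcan_inj choice.pickleK)/eq_in_map ff'.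
apply/funext => h; have [f1 f2] := fO h; have [f1' f2'] := fO' h.
have [hF|hF] := boolP (h \in FL).
  have hF' : forest_le N.-1 h by apply/FL_forest.
  by apply: cinj; rewrite ?inE; [exact: f1|exact: f1'|exact: ff'].
have hF' : ~ forest_le N.-1 h by move=> /FL_forest; apply/negP.
by rewrite f2 // f2'.
Qed.

(** By linearity the difference of the two paths is the section of the difference of the
    coefficients, so [gamma_ctrl_norm] bounds it by a multiple of their Hoelder distance. *)
Lemma Gamma_Omega_approx X f e : coeffs alpha lh f -> 0 < e -> exists f',
  coeffs alpha Omega f' /\
  (ctrl_norm X beta (Gamma_path P f X - Gamma_path P f' X)%R < e%:E)%E.
Proof.
move=> fc e0; case/andP: (Ha) => a0 a1; case/andP: (Hb) => b0 ba.
have [M M1 XM] := rough_bound X a0.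
have [C C0 HC] := gamma_ctrl_norm (le_trans ler01 M1).
pose n := nFL A alpha * (1 + C).
have n0 : 0 <= n by rewrite mulr_ge0 ?nFL_ge0 // addr_ge0.
pose d := e / (n + 1).
have d0 : 0 < d by rewrite divr_gt0 // ltr_wpDl.
have [_ _ Odense] := HOmega.
have /choice[k kP] : forall h, exists k, h \in FL -> Omega k /\ hoelder_close gam (f h) k d.
  move=> h; have [hF|hF] := boolP (h \in FL); last by exists 0.
  have hF' : forest_le N.-1 h by apply/FL_forest.
  have [k Ok kf] := Odense _ ((fc h).1 hF') d d0.
  by exists k => _; split=> //; exact: hoelder_norm_close.
pose f' h : I -> R := if h \in FL then k h else 0.
have f'O : coeffs alpha Omega f'.
  move=> h; rewrite /f'; split=> [/FL_forest hF|hF].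
    by rewrite hF; apply: (kP h hF).1.
  by rewrite ifN //; apply/negP => /FL_forest.
exists f'; split=> //.
have fH := coeffs_hoelder fc; have fH' := coeffs_hoelder (coeffs_Omega_sub f'O).
have Vg := Gamma_is_gamma Ha Heps HP X (hoelder_coeffsP (-1) fH' fH).
rewrite (Gamma_linear Ha Heps HP X (-1) fH' fH) scaleN1r addrC in Vg.
apply: le_lt_trans (HC X _ _ d d beta b0 (ltW ba) XM (ltW d0) Vg _ _) _.
- move=> h hF; rewrite /f' hF mulN1r addrC; exact: (kP h hF).2.1.
- move=> h hF s t; rewrite /f' hF.
  have -> : -1 * k h t + f h t - (-1 * k h s + f h s) = f h t - k h t - (f h s - k h s) by ring.
  exact: (kP h hF).2.2.
rewrite lte_fin; have -> : nFL A alpha * (d + C * d) = n * d by rewrite /n; ring.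
by rewrite /d mulrA ltr_pdivrMr ?ltr_wpDl // mulrC ltr_pM2l // ltrDl.
Qed.

Lemma closure_approx X Z e : ctrl_closure X beta Z -> 0 < e -> exists f,
  coeffs alpha Omega f /\ (ctrl_norm X beta (Z - Gamma_path P f X)%R < e%:E)%E.
Proof.
move=> [_ _ Zc] e0; have e30 : 0 < e / 3 by rewrite divr_gt0.
have [Z1 Z1c ZZ1] := Zc _ e30.
have [f [fc Z1f]] := ctrl_approx Ha Hb Heps HP Z1c e30.
have [f' [fO ff']] := Gamma_Omega_approx X fc e30.
exists f'; split=> //.
have -> : Z - Gamma_path P f' X = (Z - Z1) + ((Z1 - Gamma_path P f X) +
    (Gamma_path P f X - Gamma_path P f' X)).
  by rewrite !subrKA.
apply: le_lt_trans (ctrl_normD _ _ _ _) _.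
have -> : e = e / 3 + (e / 3 + e / 3) by field.
rewrite !EFinD; apply: lteD => //.
by apply: le_lt_trans (ctrl_normD _ _ _ _) _; exact: lteD.
Qed.

Lemma sections_subspace : linear_subspace
  (sections P lh : set (rough_path A T alpha -> I -> H)).
Proof.
split.
- exists (fun _ _ => 0); first exact: coeffs0.
  by apply/funext => X; rewrite (Gamma_path0 Ha Heps HP).
- move=> _ _ [f fc <-] [f' fc' <-].
  exists (fun h t => 1 * f h t + f' h t); first exact: coeffsP.
  apply/funext => X; rewrite (Gamma_linear Ha Heps HP) ?scale1r //; exact: coeffs_hoelder.
- move=> c _ [f fc <-].
  exists (fun h t => c * f h t + 0); first exact: coeffsP fc coeffs0.
  apply/funext => X.
  rewrite (Gamma_linear Ha Heps HP X c (coeffs_hoelder fc) (coeffs_hoelder coeffs0)).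
  by rewrite (Gamma_path0 Ha Heps HP) addr0.
Qed.

Lemma Gamma_closure X f : coeffs alpha lh f -> ctrl_closure X beta (Gamma_path P f X).
Proof. by move=> fc; apply/ctrl_sub_closure/Gamma_ctrl/coeffs_hoelder. Qed.

End Sections.

Theorem theorem3p10 (R : realType) (A : finType) (T : {posnum R})
    (alpha beta eps : R) (P : set {malg R[forest A]}) (Omega : set (time T -> R))
    (HA : (0 < #|A|)%N)
    (Halpha : 0 < alpha < 1)
    (Halpha_inv : forall n : nat, alpha != n%:R^-1)
    (Hbeta : 0 < beta < alpha)
    (Heps : 0 < eps < 1 - (Nlevel alpha)%:R * alpha)
    (HP : primitive_basis P)
    (HOmega : countable_dense (1 - eps) Omega) :
  let Gamma : set (rough_path A T alpha -> time T -> {malg R[forest A]}) :=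
    sections P (little_hoelder (1 - eps)) in
  let Gamma0 : set (rough_path A T alpha -> time T -> {malg R[forest A]}) :=
    sections P Omega in
  [/\ linear_subspace Gamma /\
      (forall gamma X, Gamma gamma -> ctrl_closure X beta (gamma X)),
      forall X : rough_path A T alpha,
        [/\ countable [set gamma X | gamma in Gamma0],
            [set gamma X | gamma in Gamma0] `<=` ctrl_closure X beta
          & forall Z, ctrl_closure X beta Z -> forall e : R, 0 < e ->
              exists2 W, [set gamma X | gamma in Gamma0] W &
                (ctrl_norm X beta (Z - W)%R < e%:E)%E]
    & forall gamma, Gamma gamma ->
        (forall X, (ctrl_norm X alpha (gamma X) < +oo)%E) /\
        (forall X (e : R), 0 < e -> exists2 d : R, 0 < d &
           forall Y, (rough_dist X Y < d%:E)%E ->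
             `|fine (ctrl_norm Y alpha (gamma Y)) -
               fine (ctrl_norm X alpha (gamma X))| < e)].
Proof.
split.
- split; first exact: (sections_subspace T Halpha Heps HP).
  by move=> _ X [f fc <-]; exact: (Gamma_closure Halpha Hbeta Heps HP).
- move=> X; split.
  + apply: (@sub_countable _ _ _ (coeffs alpha Omega)); last exact: countable_coeffs HOmega.
    rewrite image_comp; exact: card_image_le.
  + move=> _ [_ [f fO <-] <-]; exact: (Gamma_closure Halpha Hbeta Heps HP X (coeffs_Omega_sub HOmega fO)).
  + move=> Z Zc e e0; have [f [fO Zf]] := closure_approx Halpha Hbeta Heps HP HOmega Zc e0.
    by exists (Gamma_path P f X) => //; exists (Gamma_path P f) => //; exists f.
- move=> _ [f fc <-]; have fH := coeffs_hoelder Halpha Heps fc.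
  case/andP: (Halpha) => a0 a1; split=> [X|X e e0]; first exact: (Gamma_norm_fin Halpha Heps HP).
  exact: (Gamma_norm_continuous Halpha Heps HP).
Qed.
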